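(* For every $\delta\in(0,1]$ there exist $C(\delta)$ and $c(\delta)>0$ such that the following holds. If $f:[N]\to\mathbb{C}$ satisfies $|f|\le1$ and $\Vert f\Vert_{U^3[N]}\ge\delta$, then $|\mathbb{E}_{n\in[N]}f(n)\overline{\chi(n)}|\ge c(\delta)$, where \[\chi(n)=e(\alpha n^2+\beta n)\prod_{1\le i<i'\le k}F_{[i',i]}^{m_{[i',i]}}(g(n)\Gamma)\] for some $\alpha,\beta\in\mathbb{R}$, some $k\le C(\delta)$, integers $|m_{[i',i]}|\le C(\delta)$, and a polynomial sequence $g:\mathbb{Z}\to G$ into the free $2$-step nilpotent Lie group $G$ on $k$ generators whose Mal'cev coordinates are $t_i=\xi_in$ ($1\le i\le k$) and $t_{[i',i]}=q_{[i',i]}(n)$ for some reals $\xi_i$ and quadratic polynomials $q_{[i',i]}$.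
   Context: $e(x)=e^{2\pi ix}$. $\Vert\cdot\Vert_{U^3[N]}$: for $f:[N]\to\mathbb{C}$, $\Vert f\Vert_{U^3[N]}=\Vert\tilde f\Vert_{U^3(\mathbb{Z}/\tilde N\mathbb{Z})}/\Vert1_{[N]}\Vert_{U^3(\mathbb{Z}/\tilde N\mathbb{Z})}$ with $\tilde N\ge8N$, $\tilde f$ the zero extension, and $\Vert f\Vert_{U^3(G)}^8=\mathbb{E}_{x,h_1,h_2,h_3}\Delta_{h_1}\Delta_{h_2}\Delta_{h_3}f(x)$, $\Delta_hf(x)=f(x+h)\overline{f(x)}$. Free $2$-step nilpotent Lie group on $e_1,\dots,e_k$: elements $e_1^{t_1}\cdots e_k^{t_k}\prod_{1\le i<i'\le k}e_{[i',i]}^{t_{[i',i]}}$ ($t$'s real) with $e_{[i',i]}=[e_{i'},e_i]=e_{i'}^{-1}e_i^{-1}e_{i'}e_i$ central; in these coordinates $(t_i,t_{[i',i]})*(u_i,u_{[i',i]})=(t_i+u_i,\,t_{[i',i]}+u_{[i',i]}+t_{i'}u_i)$. $\Gamma$ is the lattice of elements with all coordinates integers. For $g$ with coordinates $(t_i,t_{[i',i]})$, the coset $g\Gamma$ has coordinates $(\{t_i\},\{t_{[i',i]}-t_{i'}\lfloor t_i\rfloor\})$ in $[0,1)$, and $F_{[i',i]}:G/\Gamma\to\mathbb{C}$ is $F_{[i',i]}(g\Gamma)=e(t_{[i',i]}-t_{i'}\lfloor t_i\rfloor)$. *)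

(* Defs.v *)
From mathcomp Require Import all_boot all_order all_algebra.
From mathcomp Require Export complex.
From mathcomp Require Export reals Rstruct trigo.
Set Implicit Arguments. Unset Strict Implicit. Unset Printing Implicit Defensive.
Import Order.TTheory GRing.Theory Num.Theory.
Local Open Scope ring_scope.

Notation R := Rdefinitions.R.
Notation C := (R[i]).

Definition e (x : R) : C := Complex (cos (2 * pi * x)) (sin (2 * pi * x)).

(* Delta_h F (x) = F(x+h) * conj(F x), for F : Z/MZ -> C represented on nat
   (F is expected to reduce its argument mod M itself). *)
Definition Delta (h : nat) (F : nat -> C) (x : nat) : C := F (x + h)%N * (F x)^*.

Definition gowers8 (M : nat) (F : nat -> C) : C :=
  (M%:R ^- 4) * \sum_(x < M) \sum_(h1 < M) \sum_(h2 < M) \sum_(h3 < M)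
      Delta h1 (Delta h2 (Delta h3 F)) x.

(* The eighth root; the quantity gowers8 M F is a nonnegative real, so we
   take its real part and the real nonnegative 8th root. *)
Definition U3norm_cyclic (M : nat) (F : nat -> C) : R :=
  Num.sqrt (Num.sqrt (Num.sqrt (complex.Re (gowers8 M F)))).

Definition zext (M N : nat) (f : nat -> C) (x : nat) : C :=
  let y := (x %% M)%N in if (1 <= y <= N)%N then f y else 0.

(* ||f||_{U^3[N]} with the choice tilde N = 8N (>= 8N). *)
Definition U3normN (N : nat) (f : nat -> C) : R :=
  U3norm_cyclic (8 * N) (zext (8 * N) N f) /
  U3norm_cyclic (8 * N) (zext (8 * N) N (fun _ => 1)).

(* Generators indexed 0..k-1 (paper: 1..k); an element is given by its
   coordinates t_i (i < k) and t_[i',i] (i < i' < k). *)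
Record free2 := Free2 { t1 : nat -> R ; t2 : nat -> nat -> R }.

Definition free2_mul (g h : free2) : free2 :=
  Free2 (fun i => t1 g i + t1 h i)
        (fun i' i => t2 g i' i + t2 h i' i + t1 g i' * t1 h i).

Definition F_coset (i' i : nat) (g : free2) : C :=
  e (t2 g i' i - t1 g i' * (Num.floor (t1 g i))%:~R).

Definition gseq (xi : nat -> R) (q : nat -> nat -> {poly R}) (n : int) : free2 :=
  Free2 (fun i => xi i * n%:~R) (fun i' i => (q i' i).[n%:~R]).

Definition chi (alpha beta : R) (k : nat) (m : nat -> nat -> int)
  (xi : nat -> R) (q : nat -> nat -> {poly R}) (n : int) : C :=
  e (alpha * n%:~R ^+ 2 + beta * n%:~R) *
  \prod_(i' < k) \prod_(i < i') F_coset i' i (gseq xi q n) ^ (m i' i).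

Definition avgN (N : nat) (a : nat -> C) : C :=
  (N%:R)^-1 * \sum_(1 <= n < N.+1) a n.

(* Main.v *)
(**
The argument follows Green and Tao, with all constants qualitative.

Place [f] in [G = Z/M] with [M = 8N].  If the U3 norm is large, then for many
[h] the derivative [F (x + h) * (F x)^*] has a large Fourier coefficient, at a
frequency [xi h].  A Cauchy-Schwarz argument shows that many additive
quadruples of [h] are also additive for [xi], so by Balog-Szemeredi and
Bogolyubov [xi] agrees on a dense set with a translate of a map [phi] that is
additive on a Bohr set.  A reduced basis of the lattice attached to the Bohr
set gives integer coordinates [n_i] in which [phi] is linear with slopes
[slope i].  The same Cauchy-Schwarz argument, localized, shows that after
multiplication by a bounded integer the bilinear form [phi(x) y] is nearly
symmetric.  On a small translate of the Bohr set [phi(x) y] is then, up to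
functions of one variable, a function of [x + y], namely the polarization of a
quadratic form in the [n_i]; removing it leaves a trilinear form, controlled
by one Fourier coefficient.  Finally this local quadratic form is a sum of
products of signed fractional parts, one of which is linear in [n] on [1..N];
rounding [sigma * n] to the nearest integer can be expressed by the floors of
[sigma * n] and [2 * sigma * n], which yields the bracket quadratic.
*)
From HB Require Import structures.
Require Import Defs.
From mathcomp Require Import all_boot all_order all_algebra.
From mathcomp Require Import complex boolp reals Rstruct trigo.
From mathcomp Require topology normedtype derive.
From mathcomp Require Import ring lra zify.
Import Order.TTheory GRing.Theory Num.Theory.
Local Open Scope ring_scope.

(** The obstacle is that the form [phi(x) y] is symmetric only approximately: for generators with
    side lengths [L i] and [L j] the defect, after multiplication by q = T!, is O(1 / (L_i L_j)). It
    becomes harmless on boxes shrunk by a large [J]: there n_i n_j is at most L_i L_j / J^2, and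
    every coordinate with L_i < J vanishes. Coordinates are moreover fixed modulo 2q, so that q and
    the denominator 2 of the polarization both divide one of the two variables. The frequency 1 is
    adjoined to the Bohr set, and M = 8N leaves room against wrap-around, so that one signed
    fractional part really is affine in n. The phases that make the Fourier coefficients of the
    derivatives nonnegative are chosen once for all h, so that passing to a subset of the h keeps
    the correlation. On the nilpotent side each term tau n floor(sigma n) gets its own pair of
    generators, and the polynomials q are zero. *)

Notation ind b := ((nat_of_bool b)%:R : R) (only parsing).

(** * Norms and Cauchy-Schwarz *)

Definition nrm (z : C) : R := ComplexField.Normc.normc z.

Lemma le_of_eq (x y : R) : x = y -> x <= y. Proof. by move=> ->. Qed.

Lemma normC_nrm (z : C) : `|z| = ((nrm z)%:C)%C. Proof. by []. Qed.

Lemma nrm_ge0 z : 0 <= nrm z.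
Proof. by case: z => a b; rewrite /nrm /=; apply: sqrtr_ge0. Qed.

Lemma nrm_eq (z w : C) : `|z| = `|w| -> nrm z = nrm w.
Proof. by rewrite !normC_nrm => -[]. Qed.

Lemma nrm0 : nrm 0 = 0. Proof. exact: ComplexField.Normc.normc0. Qed.
Lemma nrm1 : nrm 1 = 1. Proof. exact: ComplexField.Normc.normc1. Qed.
Lemma nrmM x y : nrm (x * y) = nrm x * nrm y.
Proof. exact: ComplexField.Normc.normcM. Qed.
Lemma nrmN x : nrm (- x) = nrm x. Proof. by apply: nrm_eq; rewrite normrN. Qed.
Lemma nrmJ (x : C) : nrm x^* = nrm x. Proof. by apply: nrm_eq; rewrite norm_conjC. Qed.
Lemma ler_nrmD x y : nrm (x + y) <= nrm x + nrm y.
Proof. exact: (@le_normcD R). Qed.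
Lemma ler_nrmB x y : nrm (x - y) <= nrm x + nrm y.
Proof. by rewrite -(nrmN y) ler_nrmD. Qed.
Lemma nrm_real (x : R) : nrm ((x%:C)%C) = `|x|.
Proof. by rewrite /nrm /= expr0n /= addr0 sqrtr_sqr. Qed.
Lemma nrm_nat (n : nat) : nrm n%:R = n%:R.
Proof. by rewrite -(rmorph_nat (real_complex R)) nrm_real ger0_norm. Qed.
Lemma nrmX x n : nrm (x ^+ n) = nrm x ^+ n.
Proof. by elim: n => [|n IH]; rewrite ?expr0 ?nrm1 // !exprS nrmM IH. Qed.
Lemma nrmV x : nrm x^-1 = (nrm x)^-1.
Proof. exact: ComplexField.Normc.normcV. Qed.

Lemma ler_nrm_sum (I : Type) (r : seq I) (P : pred I) (F : I -> C) :
  nrm (\sum_(i <- r | P i) F i) <= \sum_(i <- r | P i) nrm (F i).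
Proof.
elim/big_rec2: _ => [|i y1 y2 _ H]; first by rewrite nrm0.
by apply: le_trans (ler_nrmD _ _) _; rewrite lerD2l.
Qed.

Lemma mulCJ_nrm (z : C) : z * z^* = ((nrm z ^+ 2)%:C)%C.
Proof. by rewrite -normCK normC_nrm -rmorphXn. Qed.

Lemma Re_le_nrm (z : C) : complex.Re z <= nrm z.
Proof.
case: z => a b; rewrite /nrm /=; apply: le_trans (ler_norm _) _.
by rewrite -sqrtr_sqr ler_wsqrtr // lerDl sqr_ge0.
Qed.

Lemma Re_sum (I : Type) (r : seq I) (P : pred I) (F : I -> C) :
  complex.Re (\sum_(i <- r | P i) F i) = \sum_(i <- r | P i) complex.Re (F i).
Proof. by elim/big_rec2: _ => [//|i y1 [a b] _ /= <-]; case: (F i). Qed.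

Lemma cauchy_schwarz (I : finType) (P : pred I) (a b : I -> R) :
  (\sum_(i | P i) a i * b i) ^+ 2
    <= (\sum_(i | P i) a i ^+ 2) * (\sum_(i | P i) b i ^+ 2).
Proof.
set A := \sum_(i | P i) a i ^+ 2; set B := \sum_(i | P i) b i ^+ 2.
set S := \sum_(i | P i) a i * b i.
have A0 : 0 <= A by apply: sumr_ge0 => i _; apply: sqr_ge0.
have H (t : R) : 0 <= A * t ^+ 2 + B - 2 * S * t.
  have -> : A * t ^+ 2 + B - 2 * S * t = \sum_(i | P i) (a i * t - b i) ^+ 2.
    rewrite /A /B /S mulr_suml -big_split /= mulr_sumr mulr_suml -sumrB.
    by apply: eq_bigr => i _; ring.
  by apply: sumr_ge0 => i _; apply: sqr_ge0.
have [A_eq0|A_neq0] := eqVneq A 0.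
  suff -> : S = 0 by rewrite A_eq0 expr0n mul0r.
  rewrite /S big1 // => i Pi.
  have : a i ^+ 2 = 0.
    have := psumr_eq0P (P := P) (F := fun i => a i ^+ 2) _ A_eq0 Pi.
    by apply => j _; apply: sqr_ge0.
  by move/eqP; rewrite sqrf_eq0 => /eqP ->; rewrite mul0r.
have := H (S / A).
have -> : A * (S / A) ^+ 2 + B - 2 * S * (S / A) = (A * B - S ^+ 2) / A by field.
by rewrite pmulr_lge0 ?invr_gt0 ?lt_def ?A_neq0 // subr_ge0.
Qed.

Lemma sum_sqr_le (I : finType) (P : pred I) (a : I -> R) :
  (\sum_(i | P i) a i) ^+ 2 <= #|P|%:R * \sum_(i | P i) a i ^+ 2.
Proof.
have := @cauchy_schwarz I P (fun=> 1) a.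
under eq_bigr do rewrite mul1r.
by rewrite [X in X * _](_ : _ = #|P|%:R) // expr1n sumr_const.
Qed.

Lemma nrm_sum_sqr_le (I : finType) (P : pred I) (a b : I -> C) :
  (forall i, nrm (a i) <= 1) ->
  nrm (\sum_(i | P i) a i * b i) ^+ 2 <= #|P|%:R * \sum_(i | P i) nrm (b i) ^+ 2.
Proof.
move=> a1; apply: le_trans (sum_sqr_le _ _ _).
rewrite lerXn2r ?nnegrE ?nrm_ge0 ?sumr_ge0 // => [i _|]; first exact: nrm_ge0.
apply: le_trans (ler_nrm_sum _ _ _ _) _; apply: ler_sum => i _.
by rewrite nrmM ler_piMl ?nrm_ge0.
Qed.

Lemma nrm_sum_sqrE (I : finType) (P : pred I) (b : I -> C) :
  ((nrm (\sum_(i | P i) b i) ^+ 2)%:C)%C =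
  \sum_(i | P i) \sum_(j | P j) b i * (b j)^*.
Proof.
rewrite -mulCJ_nrm rmorph_sum mulr_suml.
by apply: eq_bigr => i _; rewrite mulr_sumr.
Qed.

Lemma nrm_realsum (I : finType) (P : pred I) (F : I -> R) :
  (forall i, P i -> 0 <= F i) ->
  nrm (\sum_(i | P i) ((F i)%:C)%C) = \sum_(i | P i) F i.
Proof. by move=> H; rewrite -rmorph_sum nrm_real ger0_norm ?sumr_ge0. Qed.

Lemma sum_nrm_sqrE (I J : finType) (P : pred I) (Q : pred J) (b : I -> J -> C) :
  \sum_(i | P i) nrm (\sum_(j | Q j) b i j) ^+ 2 =
  nrm (\sum_(i | P i) \sum_(j | Q j) \sum_(k | Q k) b i j * (b i k)^*).
Proof.
rewrite -nrm_realsum; last by move=> i _; apply/exprn_ge0/nrm_ge0.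
by congr nrm; apply: eq_bigr => i _; apply: nrm_sum_sqrE.
Qed.

Lemma nrm_sum_le1 (I : finType) (P : pred I) (F : I -> C) :
  (forall i, nrm (F i) <= 1) -> nrm (\sum_(i | P i) F i) <= #|P|%:R.
Proof.
move=> H; apply: le_trans (ler_nrm_sum _ _ _ _) _.
by rewrite -sumr_const; apply: ler_sum => i _.
Qed.

Section Box.
Variables (X Y : finType) (PX : pred X) (PY : pred Y).
Variables (K : X -> Y -> C).

(** One Cauchy-Schwarz in [x] removes [F2]; after expanding the square, the triangle inequality over
    [(y, y')] removes [F1]. This half step is used alone in [many_near_symmetric], where the inner
    sum is a character sum over a box. *)
Lemma half_box (F1 : Y -> C) (F2 : X -> C) :
  (forall y, nrm (F1 y) <= 1) -> (forall x, nrm (F2 x) <= 1) ->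
  nrm (\sum_(x | PX x) \sum_(y | PY y) F2 x * F1 y * K x y) ^+ 2
   <= #|PX|%:R * \sum_(y | PY y) \sum_(y' | PY y')
        nrm (\sum_(x | PX x) K x y * (K x y')^*).
Proof.
move=> H1 H2.
under eq_bigr => x _ do under eq_bigr => y _ do rewrite -mulrA.
under eq_bigr => x _ do rewrite -mulr_sumr.
apply: le_trans (nrm_sum_sqr_le _ _ _ _ H2) _.
rewrite ler_wpM2l //.
rewrite sum_nrm_sqrE exchange_big /=.
under eq_bigr => y _ do rewrite exchange_big /=.
apply: le_trans (ler_nrm_sum _ _ _ _) _; apply: ler_sum => y _.
apply: le_trans (ler_nrm_sum _ _ _ _) _; apply: ler_sum => y' _.
under eq_bigr => x _ do rewrite rmorphM mulrACA.
rewrite -mulr_sumr nrmM ler_piMl ?nrm_ge0 // nrmM nrmJ.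
by rewrite mulr_ile1 ?nrm_ge0.
Qed.

(** A second Cauchy-Schwarz, over the pairs [(y, y')] left by [half_box], turns the inner norms into
    a sum over rectangles free of the bounded weights. *)
Lemma box_cauchy_schwarz (F1 : Y -> C) (F2 : X -> C) :
  (forall y, nrm (F1 y) <= 1) -> (forall x, nrm (F2 x) <= 1) ->
  nrm (\sum_(x | PX x) \sum_(y | PY y) F2 x * F1 y * K x y) ^+ 4
   <= #|PX|%:R ^+ 2 * #|PY|%:R ^+ 2 *
      nrm (\sum_(x | PX x) \sum_(x' | PX x') \sum_(y | PY y) \sum_(y' | PY y')
        K x y * (K x y')^* * (K x' y)^* * K x' y').
Proof.
move=> H1 H2; rewrite (exprM _ 2 2).
apply: le_trans (_ : (#|PX|%:R * \sum_(y | PY y) \sum_(y' | PY y')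
        nrm (\sum_(x | PX x) K x y * (K x y')^*)) ^+ 2 <= _).
  by rewrite lerXn2r ?nnegrE ?sqr_ge0 ?half_box // mulr_ge0 // !sumr_ge0 // => ? _;
     rewrite sumr_ge0 // => ? _; apply: nrm_ge0.
rewrite exprMn -mulrA ler_wpM2l ?sqr_ge0 //.
rewrite pair_big /=; apply: le_trans (sum_sqr_le _ _ _) _.
have -> : #|(fun p : Y * Y => PY p.1 && PY p.2)| = (#|PY| ^ 2)%N.
  by rewrite expnS expn1 -cardX; apply: eq_card => -[].
rewrite natrX ler_wpM2l ?exprn_ge0 //.
rewrite sum_nrm_sqrE le_eqVlt; apply/orP; left; apply/eqP; congr nrm.
rewrite exchange_big /=; apply: eq_bigr => x _.
rewrite exchange_big /=; apply: eq_bigr => x' _.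
rewrite pair_big /=; apply: eq_bigr => -[y y'] _ /=.
by rewrite rmorphM /= conjCK mulrA.
Qed.
End Box.

(** * Distance to the nearest integer *)

Section AbsSin.
Import topology normedtype derive numFieldNormedType.Exports.

Lemma abs_sin_le (K : realType) (x : K) : 0 <= x -> `|sin x| <= x.
Proof.
move=> x0; have [|c _] := @MVT_segment K (@sin K) (@cos K) 0 x x0 (fun t _ => is_derive_sin t).
- by apply: continuous_subspaceT => t; apply: continuous_sin.
by rewrite sin0 !subr0 => ->; rewrite normrM (ger0_norm x0) ler_piMl // cos_max.
Qed.
End AbsSin.

Definition sfr (x : R) : R := x - (Num.floor (x + 2^-1))%:~R.
Definition nint (x : R) : R := `|sfr x|.

Lemma sfr_itv x : - 2^-1 <= sfr x < 2^-1.
Proof.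
have := Num.Theory.floor_itv (x + 2^-1).
rewrite intrD /sfr; set k := _%:~R => /andP[]; lra.
Qed.

Lemma sfr_int x : exists k : int, sfr x = x - k%:~R.
Proof. by exists (Num.floor (x + 2^-1)). Qed.

Lemma sfr_uniq (x y : R) (k : int) : - 2^-1 <= y < 2^-1 -> x = y + k%:~R -> sfr x = y.
Proof.
move=> Hy ->; rewrite /sfr.
suff -> : Num.floor (y + k%:~R + 2^-1) = k by rewrite addrK.
apply: floor_def; rewrite intrD; lra.
Qed.

Lemma sfr_id x : - 2^-1 <= x < 2^-1 -> sfr x = x.
Proof. by move=> H; apply: (@sfr_uniq _ _ 0) => //; rewrite addr0. Qed.

Lemma sfrDz (x : R) (k : int) : sfr (x + k%:~R) = sfr x.
Proof.
have [j Hj] := sfr_int x; apply: (@sfr_uniq _ _ (j + k)); first exact: sfr_itv.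
by rewrite Hj intrD; ring.
Qed.

Lemma nint_ge0 x : 0 <= nint x. Proof. exact: normr_ge0. Qed.

Lemma nint_le_half x : nint x <= 2^-1.
Proof. by have := sfr_itv x; rewrite /nint; case: (ger0P (sfr x)); lra. Qed.

Lemma nintDz (x : R) (k : int) : nint (x + k%:~R) = nint x.
Proof. by rewrite /nint sfrDz. Qed.

Lemma nint_le_dist (x : R) (k : int) : nint x <= `|x - k%:~R|.
Proof.
have [j Hj] := sfr_int x; rewrite /nint.
have := sfr_itv x; have -> : x - k%:~R = sfr x + (j - k)%:~R.
  by rewrite Hj intrB; ring.
move: (sfr x) (j - k) => y i {Hj}.
have : i = 0 \/ 1%:Z <= i \/ i <= -1 by lia.
case=> [->|[]]; first by rewrite addr0.
  rewrite -(ler_int R); move: (i%:~R : R) => z; case: (ger0P y); case: (ger0P (y + z)); lra.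
rewrite -(ler_int R) intrN; move: (i%:~R : R) => z.
case: (ger0P y); case: (ger0P (y + z)); lra.
Qed.

Lemma nint_le_norm x : nint x <= `|x|.
Proof. by have := nint_le_dist x 0; rewrite subr0. Qed.

Lemma nint_small x : `|x| <= 2^-1 -> nint x = `|x|.
Proof.
(* [sfr] takes values in [-1/2, 1/2), so at 1/2 it equals -1/2 and only the absolute values
   agree. *)
move=> H; have [Hx|Hx] := eqVneq x 2^-1.
  rewrite /nint (@sfr_uniq x (- 2^-1) 1) ?normrN ?Hx //; last by rewrite mulr1z; lra.
  by apply/andP; split; lra.
rewrite /nint sfr_id //; move: H Hx; rewrite ler_norml => /andP[-> H1] H2 /=.
by rewrite lt_def eq_sym H2.
Qed.

Lemma nintD x y : nint (x + y) <= nint x + nint y.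
Proof.
have [j Hj] := sfr_int x; have [k Hk] := sfr_int y.
apply: le_trans (nint_le_dist _ (j + k)) _.
apply: le_trans (ler_normD (sfr x) (sfr y)).
by rewrite Hj Hk intrD opprD addrACA.
Qed.

Lemma nintN x : nint (- x) = nint x.
Proof.
wlog suff: x / nint (- x) <= nint x.
  by move=> H; apply/eqP; rewrite eq_le H -{1}(opprK x) H.
have [j Hj] := sfr_int x; apply: le_trans (nint_le_dist _ (- j)) _.
by rewrite /nint Hj -normrN opprB intrN opprK addrC.
Qed.

Lemma nint_mulz x (k : int) : nint (k%:~R * x) <= `|k|%:~R * nint x.
Proof.
have [j Hj] := sfr_int x; apply: le_trans (nint_le_dist _ (k * j)) _.
by rewrite intr_norm -normrM Hj intrM mulrBr.
Qed.

Lemma nint_sum (I : Type) (r : seq I) (P : pred I) (F : I -> R) :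
  nint (\sum_(i <- r | P i) F i) <= \sum_(i <- r | P i) nint (F i).
Proof.
elim/big_rec2: _ => [|i a b _ H]; first by apply: le_trans (nint_le_norm _) _; rewrite normr0.
by apply: le_trans (nintD _ _) _; rewrite lerD2l.
Qed.

Lemma eD x y : e (x + y) = e x * e y.
Proof. by rewrite /e mulrDr cosD sinD; congr Complex; ring. Qed.

Lemma e0 : e 0 = 1. Proof. by rewrite /e mulr0 cos0 sin0. Qed.

Lemma eN x : e (- x) = (e x)^*.
Proof. by rewrite /e mulrN cosN sinN. Qed.

Lemma nrm_e x : nrm (e x) = 1.
Proof. by rewrite /nrm /e /= cos2Dsin2 sqrtr1. Qed.

Lemma eJ x : e x * (e x)^* = 1.
Proof. by rewrite mulCJ_nrm nrm_e expr1n. Qed.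

Lemma e1 : e 1 = 1.
Proof. by rewrite /e mulr1 mulr_natl cos2pi sin2pi. Qed.

Lemma e_int (k : int) : e k%:~R = 1.
Proof.
have H (n : nat) : e n%:R = 1.
  by elim: n => [|n IH]; rewrite ?e0 // -natr1 eD IH e1 mulr1.
by case: k => n; rewrite ?H // NegzE intrN eN H rmorph1.
Qed.

Lemma eDz x (k : int) : e (x + k%:~R) = e x.
Proof. by rewrite eD e_int mulr1. Qed.

Lemma e_sfr x : e (sfr x) = e x.
Proof. by have [k ->] := sfr_int x; rewrite -intrN eDz. Qed.

Lemma nrm_eB1_sqr x : nrm (e x - 1) ^+ 2 = 2 - 2 * cos (2 * pi * x).
Proof.
rewrite /nrm /e /= oppr0 addr0 sqr_sqrtr ?addr_ge0 ?sqr_ge0 //.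
have := cos2Dsin2 (2 * pi * x); move: (cos _) (sin _) => a b H.
by rewrite sqrrB; lra.
Qed.

(** The chord is 2 |sin(pi x)|, at most 2 pi times the distance to the nearest integer, and pi is
    rounded up to 4. *)
Lemma nrm_eB1_le x : nrm (e x - 1) <= 8 * nint x.
Proof.
rewrite -e_sfr /nint; move: (sfr x) => y {x}.
rewrite -(@ler_pXn2r _ 2) ?nnegrE ?nrm_ge0 ?mulr_ge0 // nrm_eB1_sqr.
have -> : 2 * pi * y = (pi * y) *+ 2 :> R by rewrite mulr2n; ring.
rewrite cos_mulr2n.
have -> : 2 - 2 * (cos (pi * y) ^+ 2 *+ 2 - 1) = (2 * sin (pi * y)) ^+ 2 :> R.
  by have := cos2Dsin2 (pi * y); rewrite exprMn -mulr_natl; lra.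
rewrite -(real_normK (num_real (2 * _))) ler_pXn2r ?nnegrE ?mulr_ge0 // normrM.
have H : `|sin (pi * y)| <= pi * `|y|.
  have -> : pi * `|y| = `|pi * y| by rewrite normrM (ger0_norm (pi_ge0 R)).
  have [h|h] := ger0P (pi * y); first exact: abs_sin_le.
  by rewrite -normrN -sinN abs_sin_le // oppr_ge0 ltW.
have : pi * `|y| <= 4 * `|y|.
  by apply: ler_wpM2r => //; have := pihalf_lt2 R; lra.
rewrite (ger0_norm (_ : 0 <= 2)) //; lra.
Qed.

Lemma cos_le0_of_quarter (t : R) : 1/4 <= t <= 2^-1 -> cos (2 * pi * t) <= 0.
Proof.
move=> /andP[t1 t2]; have := pi_gt0 R => p0.
have -> : cos (2 * pi * t) = - cos (pi - 2 * pi * t).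
  by rewrite cosB cospi sinpi; ring.
rewrite oppr_le0; apply: cos_ge0_pihalf.
by apply/andP; split; nra.
Qed.

(* Doubling the angle at most doubles the chord, and after finitely many
   doublings the angle reaches the quarter turn, where the chord is at least 1. *)
Lemma nint_le_nrm_eB1 x : 2 * nint x <= nrm (e x - 1).
Proof.
have key n : forall y : R, `|y| <= 2^-1 -> 1 <= 2 ^+ n * (4 * `|y|) ->
    2 * `|y| <= nrm (e y - 1).
  elim: n => [|n IH] y y1.
    rewrite expr0 mul1r => y2.
    suff H : 1 <= nrm (e y - 1) by lra.
    rewrite -(@ler_pXn2r _ 2) ?nnegrE ?nrm_ge0 // expr1n nrm_eB1_sqr.
    suff : cos (2 * pi * y) <= 0 by lra.
    have -> : cos (2 * pi * y) = cos (2 * pi * `|y|).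
      by have [//|_] := ger0P y; rewrite mulrN cosN.
    by apply: cos_le0_of_quarter; lra.
  move=> H; have [h|h] := lerP (1/4) `|y|.
    apply: (IH y) => //; have : 1 <= 2 ^+ n :> R by apply: exprn_ege1; lra.
    nra.
  have := IH (2 * y); rewrite normrM (ger0_norm (_ : 0 <= 2)) //.
  have -> : e (2 * y) - 1 = (e y - 1) * (e y + 1).
    by rewrite mulr_natl mulr2n eD; ring.
  rewrite nrmM => IH2.
  have : nrm (e y + 1) <= 2.
    by apply: le_trans (ler_nrmD _ _) _; rewrite nrm_e nrm1; lra.
  have := nrm_ge0 (e y - 1); have := nrm_ge0 (e y + 1).
  have : 2 * (2 * `|y|) <= nrm (e y - 1) * nrm (e y + 1).
    apply: IH2; first lra.
    by move: H; rewrite exprS; move: (_ ^+ n) => t; lra.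
  move: (nrm _) (nrm _) => a b; nra.
rewrite -e_sfr /nint; have [->|y0] := eqVneq (sfr x) 0.
  by rewrite normr0 mulr0 nrm_ge0.
have [n Hn] : exists n : nat, 1 <= 2 ^+ n * (4 * `|sfr x|).
  exists (Num.bound (1 / (4 * `|sfr x|))).
  have y1 : 0 < 4 * `|sfr x| by rewrite mulr_gt0 ?normr_gt0.
  rewrite -ler_pdivrMr //; apply: le_trans (ltW (archi_boundP _)) _.
    by rewrite divr_ge0 // ltW.
  by rewrite -natrX ler_nat ltnW // ltn_expl.
by apply: key Hn; apply: nint_le_half.
Qed.

Lemma Re_e_ge0 x : nint x <= 1/4 -> 0 <= complex.Re (e x).
Proof.
rewrite -e_sfr /nint /e /= ler_norml => /andP[h1 h2].
have := pi_gt0 R => p0; apply: cos_ge0_pihalf.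
by apply/andP; split; nra.
Qed.

(** * Fourier analysis on Z/M *)

Section Characters.
Variable m : nat.
Notation G := 'I_m.+2.
Notation M := (m.+2%:R : R).

Lemma modulus_gt0 : 0 < M. Proof. by rewrite ltr0n. Qed.
Lemma modulus_neq0 : M != 0. Proof. by rewrite pnatr_eq0. Qed.

Definition psi (x : G) : C := e ((x : nat)%:R / M).
Definition circ (x : G) : R := nint ((x : nat)%:R / M).

Lemma lift_nat (n : nat) : exists k : int,
  (((n%:R : G) : nat)%:R : R) / M = n%:R / M - k%:~R.
Proof.
exists (n %/ m.+2)%N; rewrite Zp_nat /=.
rewrite [in n%:R / M](divn_eq n m.+2) natrD natrM -pmulrn mulrDl.
by rewrite mulfK ?modulus_neq0 // [RHS]addrAC subrr add0r.
Qed.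

Lemma lift_int (a : int) : exists k : int,
  (((a%:~R : G) : nat)%:R : R) / M = a%:~R / M - k%:~R.
Proof.
case: a => n; first exact: lift_nat.
have : exists k : int, exists j : nat, Negz n = (j : int) - k * m.+2.
  (* -(n+1) = (n+1)(m+1) - (n+1)(m+2), which reduces a negative integer to a natural number modulo
     [M]. *)
  exists n.+1, (n.+1 * m.+1)%N; rewrite NegzE; lia.
move=> [k [j E]]; have [i Hi] := lift_nat j.
exists (i - k); rewrite E intrB intrM.
have -> : (m.+2 : int)%:~R = 0 :> G.
  by rewrite -pmulrn Zp_nat; apply/val_inj; rewrite /= modnn.
rewrite mulr0 subr0 Hi !intrB intrM mulrBl -!pmulrn mulfK ?modulus_neq0 //.
by ring.
Qed.

Lemma psi_int (a : int) : psi a%:~R = e (a%:~R / M).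
Proof. by rewrite /psi; have [k ->] := lift_int a; rewrite -intrN eDz. Qed.

Lemma circ_int (a : int) : circ a%:~R = nint (a%:~R / M).
Proof. by rewrite /circ; have [k ->] := lift_int a; rewrite -intrN nintDz. Qed.

Lemma intr_ord (x : G) : ((x : nat) : int)%:~R = x.
Proof. exact: natr_Zp. Qed.

Lemma psiD x y : psi (x + y) = psi x * psi y.
Proof.
by rewrite -(intr_ord x) -(intr_ord y) -intrD !psi_int intrD mulrDl eD.
Qed.

Lemma psi0 : psi 0 = 1.
Proof. by rewrite -(mulr0z 1) psi_int mul0r e0. Qed.

Lemma psiN x : psi (- x) = (psi x)^*.
Proof. by rewrite -(intr_ord x) -intrN !psi_int intrN mulNr eN. Qed.

Lemma psiB x y : psi (x - y) = psi x * (psi y)^*.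
Proof. by rewrite psiD psiN. Qed.

Lemma nrm_psi x : nrm (psi x) = 1. Proof. exact: nrm_e. Qed.

Lemma psiJ x : psi x * (psi x)^* = 1. Proof. exact: eJ. Qed.

Lemma circ_ge0 x : 0 <= circ x. Proof. exact: nint_ge0. Qed.

Lemma circD x y : circ (x + y) <= circ x + circ y.
Proof.
by rewrite -(intr_ord x) -(intr_ord y) -intrD !circ_int intrD mulrDl nintD.
Qed.

Lemma circN x : circ (- x) = circ x.
Proof. by rewrite -(intr_ord x) -intrN !circ_int intrN mulNr nintN. Qed.

Lemma circB x y : circ (x - y) <= circ x + circ y.
Proof. by rewrite -(circN y) circD. Qed.

Lemma circ0 : circ 0 = 0.
Proof. by rewrite -(mulr0z 1) circ_int mul0r /nint sfr_id ?normr0 //; lra. Qed.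

Lemma circ_mulz (a : int) x : circ (a%:~R * x) <= `|a|%:~R * circ x.
Proof.
by rewrite -(intr_ord x) -intrM !circ_int intrM -mulrA nint_mulz.
Qed.

Lemma circ_eq0 x : circ x = 0 -> x = 0.
Proof.
rewrite /circ => /normr0_eq0; have [k ->] := sfr_int ((x : nat)%:R / M).
move/eqP; rewrite subr_eq0 => /eqP H.
have {}H : ((x : nat) : int) = k * m.+2.
  by apply: (@intr_inj R); rewrite intrM -H -!pmulrn divfK ?modulus_neq0.
have xM := ltn_ord x.
apply/val_inj => /=.
have : k <= -1 \/ k = 0 \/ 1 <= k by lia.
by case=> [|[]] ?; nia.
Qed.

Lemma psi_eq1 x : psi x = 1 -> x = 0.
Proof.
move=> H; apply: circ_eq0; apply/eqP; rewrite eq_le circ_ge0 andbT.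
have := nint_le_nrm_eB1 ((x : nat)%:R / M).
by rewrite -/(psi x) H subrr nrm0 -/(circ x); lra.
Qed.

Lemma sum_psi (r : G) : \sum_x psi (x * r) = if r == 0 then m.+2%:R else 0.
Proof.
case: eqP => [->|r0].
  under eq_bigr do rewrite mulr0 psi0.
  by rewrite sumr_const card_ord.
have : (\sum_x psi (x * r)) * (psi r - 1) = 0.
  rewrite mulrBr mulr1 mulr_suml (reindex_inj (addIr (- 1))) /=.
  under eq_bigr do rewrite -psiD mulrDl mulN1r subrK.
  by rewrite subrr.
move/eqP; rewrite mulf_eq0 => /orP[/eqP //|].
by rewrite subr_eq0 => /eqP /psi_eq1.
Qed.

Definition fourier (g : G -> C) (r : G) : C := \sum_x g x * psi (- (r * x)).

Lemma parseval (g : G -> C) :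
  \sum_r nrm (fourier g r) ^+ 2 = M * \sum_x nrm (g x) ^+ 2.
Proof.
apply: (fmorph_inj (real_complex R)) => /=.
rewrite rmorph_sum rmorphM rmorph_sum rmorph_nat /=.
under eq_bigr do rewrite nrm_sum_sqrE.
rewrite exchange_big mulr_sumr /=; apply: eq_bigr => x _.
rewrite exchange_big /= (bigD1 x) //= [X in _ + X]big1 ?addr0; last first.
  move=> y yx.
  transitivity (g x * (g y)^* * \sum_r psi (r * (y - x))).
    rewrite mulr_sumr; apply: eq_bigr => r _.
    by rewrite rmorphM /= -psiN opprK mulrACA -psiD mulrBr addrC.
  by rewrite sum_psi subr_eq0 (negbTE yx) mulr0.
under eq_bigr do rewrite rmorphM /= mulrACA psiJ mulr1 mulCJ_nrm.
by rewrite sumr_const card_ord mulr_natl.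
Qed.

Lemma sum_fourier3 (g a b : G -> C) :
  \sum_r fourier g r * fourier a (- r) * fourier b (- r) =
  m.+2%:R * \sum_x \sum_y g (x + y) * a x * b y.
Proof.
transitivity (\sum_x \sum_y \sum_z g z * a x * b y * \sum_r psi (r * (x + y - z))).
  under eq_bigr => r _ do rewrite /fourier -mulrA mulr_suml.
  rewrite exchange_big /=.
  under eq_bigr => z _ do under eq_bigr => r _ do rewrite mulr_suml mulr_sumr.
  under eq_bigr => z _ do rewrite exchange_big /=.
  rewrite exchange_big /=; apply: eq_bigr => x _.
  under eq_bigr => z _ do under eq_bigr => r _ do rewrite mulr_sumr mulr_sumr.
  under eq_bigr => z _ do rewrite exchange_big /=.
  rewrite exchange_big /=; apply: eq_bigr => y _; apply: eq_bigr => z _.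
  rewrite mulr_sumr; apply: eq_bigr => r _.
  rewrite !mulNr !opprK mulrBr mulrDr psiB psiD psiN; ring.
rewrite mulr_sumr; apply: eq_bigr => x _; rewrite mulr_sumr; apply: eq_bigr => y _.
rewrite (bigD1 (x + y)) //= [X in _ + X]big1 ?addr0; last first.
  by move=> z zxy; rewrite sum_psi subr_eq0 eq_sym (negbTE zxy) mulr0.
by rewrite sum_psi subrr eqxx mulrC.
Qed.

(** The sup norm is taken on the transform of [g], Cauchy-Schwarz and Parseval on the other two. It
    serves in both directions: to bound the U2 average of a derivative, and, as
    [trilinear_fourier_large], to produce the final frequency. *)
Lemma trilinear_fourier_bound (g a b : G -> C) (B : R) :
  (forall r, nrm (fourier g r) <= B) ->
  nrm (\sum_x \sum_y g (x + y) * a x * b y) ^+ 2 <=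
  B ^+ 2 * (\sum_x nrm (a x) ^+ 2) * (\sum_y nrm (b y) ^+ 2).
Proof.
move=> HB; have B0 : 0 <= B by apply: le_trans (HB 0); apply: nrm_ge0.
have Mp := modulus_gt0.
have P (f : G -> C) : \sum_r nrm (fourier f (- r)) ^+ 2 = M * \sum_x nrm (f x) ^+ 2.
  by rewrite -parseval [RHS](reindex_inj oppr_inj).
rewrite -(ler_pM2l (exprn_gt0 2 Mp)).
rewrite -{1}(nrm_nat m.+2) -nrmX -nrmX -nrmM -exprMn -sum_fourier3 nrmX.
apply: le_trans (_ : (\sum_r B * (nrm (fourier a (- r)) * nrm (fourier b (- r)))) ^+ 2 <= _).
  rewrite lerXn2r ?nnegrE ?nrm_ge0 ?sumr_ge0 // => [r _|].
    by rewrite !mulr_ge0 ?nrm_ge0.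
  apply: le_trans (ler_nrm_sum _ _ _ _) _; apply: ler_sum => r _.
  by rewrite !nrmM -mulrA ler_wpM2r // mulr_ge0 ?nrm_ge0.
rewrite -mulr_sumr exprMn.
set Z := \sum_i nrm _ * _.
set X := \sum_x nrm (a x) ^+ 2; set Y := \sum_y nrm (b y) ^+ 2.
suff H : Z ^+ 2 <= (M * X) * (M * Y).
  have -> : M ^+ 2 * (B ^+ 2 * X * Y) = B ^+ 2 * ((M * X) * (M * Y)) by ring.
  by rewrite ler_wpM2l // exprn_ge0.
by apply: le_trans (cauchy_schwarz _ _ _ _) _; rewrite !P.
Qed.

Lemma trilinear_fourier_large (g a b : G -> C) (B : R) : 0 <= B ->
  B ^+ 2 * (\sum_x nrm (a x) ^+ 2) * (\sum_y nrm (b y) ^+ 2) <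
    nrm (\sum_x \sum_y g (x + y) * a x * b y) ^+ 2 ->
  exists r, B < nrm (fourier g r).
Proof.
move=> B0 H; apply/existsP; apply: contraLR H => /existsPn H.
rewrite -leNgt; apply: trilinear_fourier_bound => r.
by rewrite leNgt.
Qed.
End Characters.

(** * From the U3 norm to correlations of derivatives *)

Section Derivatives.
Variable m : nat.
Notation G := 'I_m.+2.
Notation M := (m.+2%:R : R).

Definition deriv (h : G) (F : G -> C) (x : G) : C := F (x + h) * (F x)^*.

Lemma nrm_deriv h F : (forall x, nrm (F x) <= 1) -> forall x, nrm (deriv h F x) <= 1.
Proof. by move=> F1 x; rewrite nrmM nrmJ mulr_ile1 ?nrm_ge0. Qed.

Lemma sum_nrm_sqr_le (F : G -> C) : (forall x, nrm (F x) <= 1) ->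
  \sum_x nrm (F x) ^+ 2 <= M.
Proof.
move=> F1; rewrite -[X in _ <= X%:R](card_ord m.+2) -sumr_const.
by apply: ler_sum => x _; rewrite exprn_ile1 ?nrm_ge0.
Qed.

Lemma nrm_fourier_le (F : G -> C) r : (forall x, nrm (F x) <= 1) ->
  nrm (fourier m F r) <= M.
Proof.
move=> F1; rewrite -[X in _ <= X%:R](card_ord m.+2).
by apply: nrm_sum_le1 => x; rewrite nrmM nrm_psi mulr1.
Qed.

(** For fixed [x] the sum pairs [g (x + (h1 + h2))] with functions of [h1] alone and of [h2] alone,
    so it is trilinear; translating [g] by [x] changes its Fourier coefficients only by unimodular
    factors. *)
Lemma u2_le_fourier (g : G -> C) (B : R) : (forall x, nrm (g x) <= 1) ->
  (forall r, nrm (fourier m g r) <= B) ->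
  nrm (\sum_x \sum_h1 \sum_h2 deriv h1 (deriv h2 g) x) <= M ^+ 2 * B.
Proof.
move=> g1 gB; have Mp := modulus_gt0 m.
have B0 : 0 <= B by apply: le_trans (gB 0); apply: nrm_ge0.
apply: le_trans (ler_nrm_sum _ _ _ _) _.
have -> : M ^+ 2 * B = \sum_(x : G) (M * B) by rewrite sumr_const card_ord -mulr_natl; ring.
apply: ler_sum => x _.
rewrite -(@ler_pXn2r _ 2) ?nnegrE ?nrm_ge0 ?mulr_ge0 ?(ltW Mp) //.
have -> : \sum_h1 \sum_h2 deriv h1 (deriv h2 g) x =
   \sum_h1 \sum_h2 g (x + (h1 + h2)) * (g (x + h1))^* * ((g (x + h2))^* * g x).
  apply: eq_bigr => h1 _; apply: eq_bigr => h2 _.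
  by rewrite /deriv rmorphM /= conjCK !addrA; ring.
apply: le_trans (@trilinear_fourier_bound m (fun z => g (x + z)) (fun h => (g (x + h))^*)
   (fun h => (g (x + h))^* * g x) B _) _.
  move=> r; apply: le_trans (gB r).
  rewrite /fourier [in leRHS](reindex_inj (addrI x)) /=.
  rewrite -[leLHS]mul1r -(nrm_psi m (- (r * x))) -nrmM mulr_sumr.
  by apply: le_of_eq; congr nrm; apply: eq_bigr => z _; rewrite mulrDr opprD psiD; ring.
have -> : (M * B) ^+ 2 = B ^+ 2 * M * M by ring.
by apply: ler_pM; rewrite ?mulr_ge0 ?exprn_ge0 ?sumr_ge0 // ?ler_wpM2l ?exprn_ge0 //;
  try (by move=> *; apply/exprn_ge0/nrm_ge0); apply: sum_nrm_sqr_le => h;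
  rewrite ?nrmM !nrmJ // mulr_ile1 ?nrm_ge0.
Qed.

Lemma max_fourier (g : G -> C) :
  exists r, forall s, nrm (fourier m g s) <= nrm (fourier m g r).
Proof.
by case: (Order.TotalTheory.arg_maxP (fun r => nrm (fourier m g r)) (erefl (xpredT (0 : G)))) => r _ H;
   exists r => s; apply: H.
Qed.

(** The indices with [w h] below the threshold contribute at most half of the total, and the others
    at most [M] each. *)
Lemma large_subset_of_sum (w : G -> R) (c : R) :
  (forall h, w h <= M) -> 0 <= c -> c * M ^+ 2 <= \sum_h w h ->
  (c / 2) * M <= #|[set h | c / 2 * M <= w h]|%:R.
Proof.
move=> wM c0 H; have Mp := modulus_gt0 m.
set H' := [set _ | _].
have : \sum_h w h <= #|H'|%:R * M + M * (c / 2 * M).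
  rewrite (bigID (mem H')) /= lerD //.
    by rewrite mulr_natl -sumr_const; apply: ler_sum => h _.
  apply: le_trans (_ : \sum_(h | h \notin H') (c / 2 * M) <= _).
    by apply: ler_sum => h; rewrite inE -ltNge => /ltW.
  rewrite sumr_const -[_ *+ #|_|]mulr_natl ler_wpM2r ?mulr_ge0 ?invr_ge0 ?(ltW Mp) //.
  by rewrite ler_nat -[X in (_ <= X)%N](card_ord m.+2) max_card.
move: (#|H'|%:R : R) (\sum_h w h) H => a S H H2.
have : c / 2 * M * M <= a * M by lra.
by rewrite ler_pM2r.
Qed.

Lemma u3_large_derivatives (F : G -> C) (c : R) : 0 <= c ->
  (forall x, nrm (F x) <= 1) ->
  c * M ^+ 4 <= nrm (\sum_x \sum_h1 \sum_h2 \sum_h3 deriv h1 (deriv h2 (deriv h3 F)) x) ->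
  exists (H : {set G}) (xi : G -> G), c / 2 * M <= #|H|%:R /\
    forall h, h \in H -> c / 2 * M <= nrm (fourier m (deriv h F) (xi h)).
Proof.
move=> c0 F1 HT; have Mp := modulus_gt0 m.
have [xi Hxi] := fin_all_exists (fun h => max_fourier (deriv h F)).
exists [set h | c / 2 * M <= nrm (fourier m (deriv h F) (xi h))], xi.
split; last by move=> h; rewrite inE.
apply: large_subset_of_sum => // [h|]; first exact/nrm_fourier_le/nrm_deriv.
rewrite -(ler_pM2r (exprn_gt0 2 Mp)) -mulrA -exprD; apply: le_trans HT _.
have -> : \sum_x \sum_h1 \sum_h2 \sum_h3 deriv h1 (deriv h2 (deriv h3 F)) x =
  \sum_h3 \sum_x \sum_h1 \sum_h2 deriv h1 (deriv h2 (deriv h3 F)) x.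
  rewrite [RHS]exchange_big; apply: eq_bigr => x _.
  rewrite [RHS]exchange_big; apply: eq_bigr => h1 _.
  by rewrite [RHS]exchange_big.
apply: le_trans (ler_nrm_sum _ _ _ _) _; rewrite mulr_suml.
apply: ler_sum => h _; rewrite mulrC; apply: u2_le_fourier => //.
exact: nrm_deriv.
Qed.

(** With [y = x + h] the functions [F1] and [F2] depend on one variable each, so
    [box_cauchy_schwarz] removes them. The remaining phase is linear in [x], and summing over [x]
    leaves exactly the additive quadruples of [xi]. The residual phase is kept, since it later
    carries the symmetry of [phi]. *)
Lemma quadruple_sum_large (F1 F2 c : G -> C) (xi : G -> G) (eta : R) :
  (forall x, nrm (F1 x) <= 1) -> (forall x, nrm (F2 x) <= 1) -> 0 <= eta ->
  eta * M ^+ 2 <= nrm (\sum_x \sum_h F1 (x + h) * F2 x * c h * psi m (- (xi h * x))) ->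
  eta ^+ 4 * M ^+ 3 <= nrm (\sum_h1 \sum_h2 \sum_h3
    (xi h1 + xi (h2 + h3 - h1) == xi h2 + xi h3)%:R *
     (c h1 * (c h2)^* * (c h3)^* * c (h2 + h3 - h1) *
     psi m (- ((xi (h2 + h3 - h1) - xi h3) * (h1 - h3))))).
Proof.
move=> F11 F21 eta0 HS; have Mp := modulus_gt0 m.
pose K x y := c (y - x) * psi m (- (xi (y - x) * x)).
have ES : \sum_x \sum_h F1 (x + h) * F2 x * c h * psi m (- (xi h * x)) =
    \sum_x \sum_y F2 x * F1 y * K x y.
  apply: eq_bigr => x _; rewrite [RHS](reindex_inj (addrI x)) /=.
  by apply: eq_bigr => h _; rewrite /K addrAC subrr add0r; ring.
have := @box_cauchy_schwarz G G xpredT xpredT K F1 F2 F11 F21.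
rewrite -ES !card_ord.
set S := nrm _ in HS *; set Q := (X in _ * X) => SQ.
have : eta ^+ 4 * M ^+ 4 <= Q.
  have : (eta * M ^+ 2) ^+ 4 <= S ^+ 4.
    by rewrite lerXn2r ?nnegrE ?nrm_ge0 // mulr_ge0 // exprn_ge0 // ltW.
  move=> /le_trans /(_ SQ); rewrite exprMn -exprM -exprD.
  rewrite (_ : M ^+ (2 * 4) = M ^+ 4 * M ^+ 4); last by rewrite -exprD.
  by rewrite mulrCA ler_pM2l // exprn_gt0.
suff -> : Q = M * nrm (\sum_h1 \sum_h2 \sum_h3
    (xi h1 + xi (h2 + h3 - h1) == xi h2 + xi h3)%:R *
     (c h1 * (c h2)^* * (c h3)^* * c (h2 + h3 - h1) *
     psi m (- ((xi (h2 + h3 - h1) - xi h3) * (h1 - h3))))).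
  by rewrite [M ^+ 4]exprS mulrCA ler_pM2l.
rewrite /Q -nrm_nat -nrmM; congr nrm.
transitivity (\sum_x \sum_h1 \sum_h2 \sum_h3
     c h1 * (c h2)^* * (c h3)^* * c (h2 + h3 - h1) *
     psi m (- ((xi (h2 + h3 - h1) - xi h3) * (h1 - h3))) *
     psi m (x * (xi h2 + xi h3 - (xi h1 + xi (h2 + h3 - h1))))).
  apply: eq_bigr => x _.
  rewrite exchange_big /= (reindex_inj (addrI x)) /=; apply: eq_bigr => h1 _.
  rewrite exchange_big /= (reindex_inj (addrI x)) /=; apply: eq_bigr => h2 _.
  (* Here [h1 = y - x], [h2 = y' - x] and [h3 = y - x']; hence [x' = x + h1 - h3] and
     [y' - x' = h2 + h3 - h1]. *)
  have inj3 : injective (fun h3 => x + h1 - h3 : G) by move=> a b /addrI /oppr_inj.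
  rewrite (reindex_inj inj3) /=; apply: eq_bigr => h3 _.
  rewrite /K.
  have -> : x + h1 - x = h1 by ring.
  have -> : x + h2 - x = h2 by ring.
  have -> : x + h1 - (x + h1 - h3) = h3 by ring.
  have -> : x + h2 - (x + h1 - h3) = h2 + h3 - h1 by ring.
  rewrite !rmorphM /= -!psiN !opprK.
  set h4 := h2 + h3 - h1.
  transitivity (c h1 * (c h2)^* * (c h3)^* * c h4 *
    (psi m (- (xi h1 * x)) * psi m (xi h2 * x) * psi m (xi h3 * (x + h1 - h3)) *
     psi m (- (xi h4 * (x + h1 - h3))))); first by ring.
  rewrite -!psiD -[RHS]mulrA -psiD; congr (_ * psi m _); ring.
rewrite exchange_big mulr_sumr; apply: eq_bigr => h1 _ /=.
rewrite exchange_big mulr_sumr; apply: eq_bigr => h2 _ /=.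
rewrite exchange_big mulr_sumr; apply: eq_bigr => h3 _ /=.
rewrite -mulr_sumr sum_psi subr_eq0 eq_sym.
by case: eqP => _; rewrite ?mul1r ?mul0r ?mulr0 // mulrC.
Qed.
End Derivatives.

(** * The Balog-Szemeredi theorem *)

Section Counting.

Lemma card_sumE (T : finType) (P : pred T) :
  #|[set x | P x]|%:R = \sum_x (P x)%:R :> R.
Proof.
rewrite -sum1_card natr_sum big_mkcond /=; apply: eq_bigr => x _.
by rewrite inE; case: (P x).
Qed.

Lemma card_setE (T : finType) (A : {set T}) :
  #|A|%:R = \sum_x (x \in A)%:R :> R.
Proof. by rewrite -card_sumE; congr (_%:R); apply: eq_card => x; rewrite inE. Qed.

Lemma sum_in (T : finType) (A : {set T}) (F : T -> R) :
  \sum_(x in A) F x = \sum_x (x \in A)%:R * F x.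
Proof. by rewrite big_mkcond; apply: eq_bigr => x _; case: (x \in A); rewrite ?mul1r ?mul0r. Qed.

Lemma sum_constR (T : finType) (A : {set T}) (t : R) :
  \sum_(x in A) t = #|A|%:R * t.
Proof. by rewrite sumr_const mulr_natl. Qed.

Lemma sum_split_le (T : finType) (A : {set T}) (P : pred T) (w : T -> R) (U t : R) :
  (forall x, x \in A -> P x -> w x <= U) ->
  (forall x, x \in A -> ~~ P x -> w x <= t) -> 0 <= t ->
  \sum_(x in A) w x <= #|[set x in A | P x]|%:R * U + #|A|%:R * t.
Proof.
move=> HU Ht t0; rewrite (bigID P) /= lerD //.
  rewrite mulr_natl -sumr_const [leRHS](eq_bigl (fun x => (x \in A) && P x)).
    by apply: ler_sum => x /andP[]; apply: HU.
  by move=> x; rewrite inE.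
apply: le_trans (_ : \sum_(x in A | ~~ P x) t <= _).
  by apply: ler_sum => x /andP[]; apply: Ht.
rewrite sumr_const -[_ *+ #|_|]mulr_natl ler_wpM2r // ler_nat.
by apply: subset_leq_card; apply/subsetP => x /andP[].
Qed.

End Counting.

Section Graph.
Variables (T : finType) (A : {set T}) (adj : rel T) (M c : R).
Hypotheses (M0 : 0 < M) (c0 : 0 < c) (AM : #|A|%:R <= M).
Hypothesis edges : c * M ^+ 2 <= \sum_(x in A) \sum_(y in A) (adj x y)%:R.

Definition codeg (x y : T) : R := \sum_(v in A) (adj v x && adj v y)%:R.

(* Dependent random choice: the neighbourhood of a well-chosen vertex contains
   few pairs with small codegree. *)
Lemma good_neighbourhood : exists A' : {set T},
  [/\ A' \subset A, c / 2 * M <= #|A'|%:R &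
   \sum_(x in A') \sum_(y in A') ind (codeg x y < c ^+ 2 / 16 * M) <= 8^-1 * #|A'|%:R ^+ 2].
Proof.
pose N v := [set x in A | adj v x].
pose bad x y : R := ind (codeg x y < c ^+ 2 / 16 * M).
pose b v := \sum_(x in N v) \sum_(y in N v) bad x y.
have cM : 0 < c * M by rewrite mulr_gt0.
have sumN : \sum_(v in A) #|N v|%:R ^+ 2 >= c ^+ 2 * M ^+ 3.
  have := sum_sqr_le _ (mem A) (fun v => #|N v|%:R : R).
  have -> : \sum_(v in A) #|N v|%:R = \sum_(x in A) \sum_(y in A) (adj x y)%:R :> R.
    apply: eq_bigr => v _; rewrite card_sumE sum_in; apply: eq_bigr => y _.
    by case: (y \in A); rewrite ?mul1r ?mul0r.
  set S := \sum_(v in A) _ ^+ 2; set E := \sum_(x in A) \sum_(y in A) _.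
  have S0 : 0 <= S by apply: sumr_ge0 => *; apply: exprn_ge0.
  move=> H; have : (c * M ^+ 2) ^+ 2 <= M * S.
    apply: le_trans (_ : E ^+ 2 <= _).
      by rewrite lerXn2r ?nnegrE ?mulr_ge0 ?exprn_ge0 ?(ltW c0) ?(ltW M0) //; apply: le_trans edges;
         rewrite mulr_ge0 ?exprn_ge0 ?ltW.
    by apply: le_trans H _; rewrite ler_wpM2r.
  have -> : (c * M ^+ 2) ^+ 2 = M * (c ^+ 2 * M ^+ 3) by ring.
  by rewrite ler_pM2l.
have sumb : \sum_(v in A) b v <= c ^+ 2 / 16 * M ^+ 3.
  have -> : \sum_(v in A) b v = \sum_(x in A) \sum_(y in A) bad x y * codeg x y.
    transitivity (\sum_(v in A) \sum_(x in A) \sum_(y in A) (adj v x && adj v y)%:R * bad x y).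
      apply: eq_bigr => v _; rewrite /b sum_in [RHS]sum_in; apply: eq_bigr => x _.
      rewrite inE; case: (x \in A); rewrite ?mul0r ?mul1r //.
      case: (adj v x); last by rewrite mul0r big1 // => y _; rewrite mul0r.
      rewrite mul1r sum_in [RHS]sum_in; apply: eq_bigr => y _.
      by rewrite inE; case: (y \in A); case: (adj v y); rewrite ?mul0r ?mul1r.
    rewrite exchange_big; apply: eq_bigr => x _.
    rewrite exchange_big; apply: eq_bigr => y _ /=.
    by rewrite -mulr_suml mulrC.
  have cpos : 0 <= c ^+ 2 / 16 * M by rewrite mulr_ge0 ?divr_ge0 ?exprn_ge0 ?ltW.
  apply: le_trans (_ : \sum_(x in A) \sum_(y in A) (c ^+ 2 / 16 * M) <= _).
    apply: ler_sum => x _; apply: ler_sum => y _; rewrite /bad.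
    by case: ltP => H; rewrite ?mul1r ?mul0r // ltW.
  rewrite !sum_constR.
  have -> : c ^+ 2 / 16 * M ^+ 3 = M * (M * (c ^+ 2 / 16 * M)) by ring.
  by apply: ler_pM => //; [exact: mulr_ge0 | exact: ler_wpM2r].
(* Averaging over [v]: the squares sum to at least c^2 M^3, while both terms on the left sum to at
   most c^2 M^3 / 2. *)
have [v vA Hv] : exists2 v, v \in A & c ^+ 2 / 2 * M ^+ 2 + 8 * b v <= #|N v|%:R ^+ 2.
  apply/exists_inP; apply: contraT => /exists_inPn H.
  have [A0|[v vA]] := set_0Vmem A.
    by move: sumN; rewrite A0 big_set0 leNgt mulr_gt0 // exprn_gt0.
  have : \sum_(v in A) #|N v|%:R ^+ 2 < \sum_(v in A) (c ^+ 2 / 2 * M ^+ 2 + 8 * b v).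
    rewrite (bigD1 v) //= [ltRHS](bigD1 v) //= ltr_leD //.
      by have := H _ vA; rewrite -ltNge.
    by apply: ler_sum => w /andP[/H]; rewrite -ltNge => /ltW.
  rewrite big_split /= sum_constR -mulr_sumr => H3.
  have : #|A|%:R * (c ^+ 2 / 2 * M ^+ 2) <= M * (c ^+ 2 / 2 * M ^+ 2).
    by rewrite ler_wpM2r // mulr_ge0 ?divr_ge0 ?exprn_ge0 ?ltW.
  have -> : M * (c ^+ 2 / 2 * M ^+ 2) = c ^+ 2 * M ^+ 3 / 2 by ring.
  move: sumN sumb H3; have -> : c ^+ 2 / 16 * M ^+ 3 = c ^+ 2 * M ^+ 3 / 16 by ring.
  have : 0 < c ^+ 2 * M ^+ 3 by rewrite mulr_gt0 // exprn_gt0.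
  by lra.
exists (N v); split; first by apply/subsetP => x; rewrite inE => /andP[].
- rewrite -(@ler_pXn2r _ 2) ?nnegrE ?mulr_ge0 ?invr_ge0 ?(ltW M0) ?(ltW c0) //.
  apply: le_trans Hv; have : 0 <= b v by apply: sumr_ge0 => x _; apply: sumr_ge0 => y _; apply: ler0n.
  have : 0 < (c * M) ^+ 2 by apply: exprn_gt0.
  rewrite !expr2; nra.
- have : 0 <= c ^+ 2 / 2 * M ^+ 2 by rewrite mulr_ge0 ?divr_ge0 ?exprn_ge0 ?ltW.
  move: Hv; rewrite -/(b v); lra.
Qed.

(** Vertices with more than a quarter of [A'] as bad partners are discarded; since bad pairs make up
    at most an eighth, at least half of [A'] remains. Any two survivors then share half of [A'] as
    common good partners, which gives many paths of length four. *)
Lemma many_short_paths : exists A'' : {set T},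
  [/\ A'' \subset A, c / 4 * M <= #|A''|%:R &
   forall x y, x \in A'' -> y \in A'' ->
   c / 4 * M <= \sum_z ind ((c ^+ 2 / 16 * M <= codeg x z) && (c ^+ 2 / 16 * M <= codeg y z))].
Proof.
have [A' [A'A A'M bad]] := good_neighbourhood.
pose bd x : R := \sum_(y in A') ind (codeg x y < c ^+ 2 / 16 * M).
exists [set x in A' | bd x <= 4^-1 * #|A'|%:R].
set A'' := [set _ in _ | _].
have A'0 : 0 < #|A'|%:R :> R by apply: lt_le_trans A'M; rewrite mulr_gt0 // divr_gt0.
have bd0 x : 0 <= bd x by apply: sumr_ge0 => *; case: (_ < _).
split.
- by apply: subset_trans A'A; apply/subsetP => x; rewrite inE => /andP[].
- suff : #|A'|%:R <= 2 * #|A''|%:R :> R by move: A'M; lra.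
  have EA : #|A'|%:R = #|A''|%:R + #|A' :\: A''|%:R :> R.
    rewrite -natrD -(cardsID A'' A') (setIidPr _) //.
    by apply/subsetP => x; rewrite inE => /andP[].
  have : #|A' :\: A''|%:R * (4^-1 * #|A'|%:R) <= \sum_(x in A') bd x.
    rewrite mulr_natl -sumr_const [leRHS](big_setID (A' :\: A'')) /=.
    rewrite (setIidPr _) ?subsetDl // -[leLHS]addr0 lerD ?sumr_ge0 //.
    apply: ler_sum => x; rewrite !inE => /andP[]; rewrite negb_and => /orP[/negP //|].
    by rewrite -ltNge => /ltW.
  move=> /le_trans /(_ bad); rewrite expr2 !mulrA ler_pM2r //.
  move: EA; lra.
move=> x y; rewrite !inE => /andP[xA xb] /andP[yA yb].
have : #|A'|%:R <= bd x + bd y +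
    \sum_z ind ((c ^+ 2 / 16 * M <= codeg x z) && (c ^+ 2 / 16 * M <= codeg y z)).
  rewrite card_setE /bd !sum_in -!big_split /=; apply: ler_sum => z _.
  rewrite !ltNge; case: (z \in A'); case: (_ <= codeg x z); case: (_ <= codeg y z) => /=;
  rewrite ?mul0r ?mul1r; lra.
move: xb yb A'M; lra.
Qed.
End Graph.

(** * Sumsets and popular differences in a finite abelian group *)

Section BSG.
Variable Z : finZmodType.
Implicit Types A B S X Y W : {set Z}.

Definition sumset X Y : {set Z} := [set x + y | x in X, y in Y].
Definition diffset X : {set Z} := [set x - y | x in X, y in X].
Fixpoint nfold S (n : nat) : {set Z} :=
  if n is n'.+1 then sumset S (nfold S n') else [set 0].
Definition rdiff A (d : Z) : R := \sum_a ind ((a \in A) && (a + d \in A)).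

Lemma mem_sumset X Y x y : x \in X -> y \in Y -> x + y \in sumset X Y.
Proof. by move=> xX yY; apply/imset2P; exists x y. Qed.

Lemma mem_diffset X x y : x \in X -> y \in X -> x - y \in diffset X.
Proof. by move=> xX yY; apply/imset2P; exists x y. Qed.

(** Double counting: each [w] has at least [t] representations as an element of [X] plus one of [Y],
    and there are only |X| |Y| pairs. *)
Lemma card_popular_le X Y W (t : R) :
  (forall w, w \in W -> t <= \sum_x ind ((x \in X) && (w - x \in Y))) ->
  t * #|W|%:R <= #|X|%:R * #|Y|%:R.
Proof.
move=> H; rewrite mulrC -sum_constR.
apply: le_trans (_ : \sum_w \sum_x ind ((x \in X) && (w - x \in Y)) <= _).
  apply: le_trans (ler_sum _ (fun w wW => H w wW)) _.
  rewrite [leRHS](bigID (mem W)) /= lerDl.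
  by apply: sumr_ge0 => w _; apply: sumr_ge0.
rewrite exchange_big /= mulrC [X in _ * X]card_setE mulr_sumr.
apply: ler_sum => x _; case: (x \in X) => /=; last by rewrite big1 ?mulr_ge0.
rewrite mulr1 card_setE (reindex_inj (addIr x)) /=.
by apply: ler_sum => w _; rewrite addrK.
Qed.

Lemma rdiff_ge0 A d : 0 <= rdiff A d.
Proof. exact: sumr_ge0. Qed.

Lemma rdiffN A d : rdiff A (- d) = rdiff A d.
Proof.
rewrite /rdiff (reindex_inj (addIr d)) /=; apply: eq_bigr => a _.
by rewrite addrK andbC.
Qed.

Lemma rdiff_le A d : rdiff A d <= #|A|%:R.
Proof. by rewrite card_setE; apply: ler_sum => a _; case: (a \in A); case: (_ \in A). Qed.

Lemma sum_rdiff A : \sum_d rdiff A d = #|A|%:R ^+ 2.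
Proof.
rewrite /rdiff exchange_big /= expr2 [in X in X * _]card_setE mulr_suml.
apply: eq_bigr => a _; case: (a \in A) => /=; last by rewrite big1 ?mul0r.
rewrite mul1r card_setE (reindex_inj (addrI (- a))) /=.
by apply: eq_bigr => w _; rewrite addrA subrr add0r.
Qed.

(* The popular differences of a set with few differences can be added any
   number of times at a bounded cost: writing a popular s as b - a in many ways
   gives many representations of (b0 - b1) + s + t as (b0 - a) + (b - b1 + t). *)
Lemma nfold_popular_bound B (S : {set Z}) (t K M : R) (n : nat) :
  0 < t -> 0 <= M ->
  (forall s, s \in S -> t * M <= rdiff B s) -> #|diffset B|%:R <= K * M ->
  t ^+ n * M ^+ n * #|sumset (diffset B) (nfold S n)|%:R <= K ^+ n.+1 * M ^+ n.+1.
Proof.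
move=> t0 M0 HS HK; elim: n => [|n IH].
  rewrite !expr0 !mul1r !expr1; apply: le_trans HK; rewrite ler_nat.
  apply: subset_leq_card; apply/subsetP => x /imset2P[y z yD].
  by rewrite inE => /eqP -> ->; rewrite addr0.
have step : t * M * #|sumset (diffset B) (nfold S n.+1)|%:R <=
    #|diffset B|%:R * #|sumset (diffset B) (nfold S n)|%:R.
  apply: card_popular_le => w /imset2P[d u /imset2P[b0 b1 b0B b1B ->]].
  move=> /imset2P[s v sS vn ->] ->.
  apply: le_trans (HS s sS) _; rewrite /rdiff.
  have inj : injective (fun a => b0 - a) by move=> x y /addrI /oppr_inj.
  rewrite [leRHS](reindex_inj inj) /=; apply: ler_sum => a _.
  case: (boolP (a \in B)) => //= aB; case: (boolP (a + s \in B)) => //= asB.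
  rewrite mem_diffset // (_ : _ - _ = (a + s - b1) + v) ?mem_sumset ?mem_diffset //.
  by rewrite opprB addrC !addrA subrK; congr (_ + _); apply: addrAC.
have K0 : 0 <= K * M by apply: le_trans HK.
rewrite exprS [M ^+ n.+1]exprS.
have -> : t * t ^+ n * (M * M ^+ n) * #|sumset (diffset B) (nfold S n.+1)|%:R =
  (t ^+ n * M ^+ n) * (t * M * #|sumset (diffset B) (nfold S n.+1)|%:R) by ring.
apply: le_trans (_ : (t ^+ n * M ^+ n) * (#|diffset B|%:R * #|sumset (diffset B) (nfold S n)|%:R) <= _).
  by rewrite ler_wpM2l // mulr_ge0 ?exprn_ge0 // ltW.
rewrite mulrCA exprS [M ^+ n.+2]exprS.
have -> : K * K ^+ n.+1 * (M * M ^+ n.+1) = (K * M) * (K ^+ n.+1 * M ^+ n.+1) by ring.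
by apply: ler_pM => //; rewrite !mulr_ge0 ?exprn_ge0 // ltW.
Qed.

Lemma popular_card_le A (t M : R) : 0 <= M -> #|A|%:R <= M ->
  t * M * #|[set d | t * M <= rdiff A d]|%:R <= M ^+ 2.
Proof.
move=> M0 AM; apply: le_trans (_ : #|A|%:R ^+ 2 <= _); last first.
  by rewrite lerXn2r ?nnegrE.
rewrite -sum_rdiff mulrC -sum_constR.
apply: le_trans (_ : \sum_(d in [set d | t * M <= rdiff A d]) rdiff A d <= _).
  by apply: ler_sum => d; rewrite inE.
by rewrite [leRHS](bigID (mem [set d | t * M <= rdiff A d])) /= lerDl sumr_ge0 // => d _; apply: rdiff_ge0.
Qed.

(** There are at least c^2 M^2 pairs. The unpopular differences, at most [K * M] in number, account
    for at most K t M^2 <= c^2 M^2 / 2 of them, and each popular one for at most [M]. *)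
Lemma popular_card_ge A (c t K M : R) : 0 < M -> 0 <= t -> #|A|%:R <= M -> 0 <= c ->
  c * M <= #|A|%:R -> #|diffset A|%:R <= K * M -> K * t <= c ^+ 2 / 2 ->
  c ^+ 2 / 2 * M <= #|[set d | t * M <= rdiff A d]|%:R.
Proof.
move=> M0 t0 AM c0 cA AK Kt.
set S := [set d | _].
have H : #|A|%:R ^+ 2 <= #|S|%:R * M + #|diffset A|%:R * (t * M).
  rewrite -sum_rdiff (bigID (mem (diffset A))) /= [X in _ + X]big1 ?addr0; last first.
    move=> d /negP dA; apply/eqP/negPn/negP => rd; apply: dA.
    have /existsP[a /andP[aA adA]] : [exists a, (a \in A) && (a + d \in A)].
      apply: contraR rd => /existsPn rd; apply/eqP/big1 => a _.
      by rewrite (negbTE (rd a)).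
    by apply/imset2P; exists (a + d) a => //; rewrite addrC addKr.
  apply: le_trans (sum_split_le _ (diffset A) (fun d => d \in S) (rdiff A) M (t * M) _ _ _) _.
  - by move=> d _ _; apply: le_trans (rdiff_le _ _) _.
  - by move=> d _; rewrite inE -ltNge => /ltW.
  - by rewrite mulr_ge0 // ltW.
  rewrite lerD2r ler_wpM2r ?(ltW M0) // ler_nat subset_leq_card //.
  by apply/subsetP => d; rewrite inE => /andP[].
have : (c * M) ^+ 2 <= #|A|%:R ^+ 2 by rewrite lerXn2r ?nnegrE ?mulr_ge0 ?(ltW M0).
move=> /le_trans /(_ H).
have : #|diffset A|%:R * (t * M) <= K * M * (t * M) by rewrite ler_wpM2r // mulr_ge0 // ltW.
have : K * t * (M * M) <= c ^+ 2 / 2 * (M * M) by rewrite ler_wpM2r // mulr_ge0 // ltW.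
move=> h1 h2 h3; suff : c ^+ 2 / 2 * M * M <= #|S|%:R * M by rewrite ler_pM2r.
move: h1 h2 h3; rewrite !expr2; lra.
Qed.

(** Join [x] and [y] when [y - x] is a popular difference. A common neighbour [v] writes [x - z] as
    a sum of two popular differences, and a common good partner [z] writes [x - y] through [x - z]
    and [y - z]. Two uses of [card_popular_le] give |D2| <= 256 / c^4 M, then (256 / c^4)^2 * 8 / c
    = 2^19 / c^9. *)
Lemma balog_szemeredi_diffset A (c M : R) : 0 < c -> 0 < M -> #|A|%:R <= M ->
  c * M ^+ 3 <= \sum_(x in A) \sum_(y in A) rdiff A (y - x) ->
  exists A' : {set Z}, [/\ A' \subset A, c / 8 * M <= #|A'|%:R &
    #|diffset A'|%:R <= 2 ^+ 19 / c ^+ 9 * M].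
Proof.
move=> c0 M0 AM HE.
pose D := [set d | c / 2 * M <= rdiff A d].
pose adj x y := y - x \in D.
have c2 : 0 < c / 2 by rewrite divr_gt0.
have edges : c / 2 * M ^+ 2 <= \sum_(x in A) \sum_(y in A) (adj x y)%:R.
  have : \sum_(x in A) \sum_(y in A) rdiff A (y - x) <=
     \sum_(x in A) \sum_(y in A) ((adj x y)%:R * M + c / 2 * M).
    apply: ler_sum => x _; apply: ler_sum => y _; rewrite /adj inE.
    case: (lerP (c / 2 * M) (rdiff A (y - x))) => [_|/ltW H].
      by rewrite mul1r; have := rdiff_le A (y - x); have := mulr_gt0 c2 M0; move: AM; lra.
    by rewrite mul0r add0r.
  move=> /(le_trans HE).
  under eq_bigr => x _ do rewrite big_split /= -mulr_suml sum_constR.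
  rewrite big_split /= -mulr_suml sum_constR.
  have : #|A|%:R * (#|A|%:R * (c / 2 * M)) <= M * (M * (c / 2 * M)).
    have h : 0 <= c / 2 * M by rewrite mulr_ge0 // ltW.
    by apply: ler_pM => //; [exact: mulr_ge0 | exact: ler_wpM2r].
  move=> H1 H2; rewrite -(ler_pM2r M0).
  by move: H1 H2; rewrite !exprS expr0; lra.
have DM : #|D|%:R <= 2 / c * M.
  have := popular_card_le A (c / 2) M (ltW M0) AM; rewrite -/D.
  have cM : 0 < c / 2 * M by rewrite mulr_gt0.
  by rewrite -ler_pdivlMl // => /le_trans; apply; apply: le_of_eq; field; rewrite ?gt_eqF.
have DN d : (- d \in D) = (d \in D) by rewrite !inE rdiffN.
have [A' [A'A A'M path]] := many_short_paths Z A adj M (c / 2) M0 c2 AM edges.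
exists A'; split => //; first by move: A'M; rewrite (_ : c / 2 / 4 = c / 8) //; field.
set g := (c / 2) ^+ 2 / 16 in path.
have g0 : 0 < g by rewrite divr_gt0 // exprn_gt0.
pose D2 := [set d | g * M <= \sum_p ind ((p \in D) && (d - p \in D))].
have D2M : g * M * #|D2|%:R <= #|D|%:R * #|D|%:R.
  by apply: card_popular_le => w; rewrite inE.
have codegD2 x z : g * M <= codeg Z A adj x z -> x - z \in D2.
  move=> H; rewrite inE; apply: le_trans H _.
  rewrite /codeg sum_in.
  have inj : injective (fun v => x - v) by move=> a b /addrI /oppr_inj.
  rewrite [leRHS](reindex_inj inj) /=; apply: ler_sum => v _.
  have -> : x - z - (x - v) = v - z by rewrite opprB [LHS]addrC addrA subrK.
  rewrite -(DN (v - z)) !opprB -/(adj v x) -/(adj v z).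
  by case: (v \in A); rewrite ?mul1r ?mul0r.
have D2N d : (- d \in D2) = (d \in D2).
  rewrite !inE; congr (_ <= _); rewrite (reindex_inj oppr_inj) /=.
  by apply: eq_bigr => p _; rewrite DN opprK -(DN (d - p)) opprB addrC.
have A'D : c / 2 / 4 * M * #|diffset A'|%:R <= #|D2|%:R * #|D2|%:R.
  apply: card_popular_le => w /imset2P[x y xA yA ->].
  apply: le_trans (path x y xA yA) _.
  have inj : injective (fun v => x - v) by move=> a b /addrI /oppr_inj.
  rewrite [leRHS](reindex_inj inj) /=; apply: ler_sum => z _.
  have -> : x - y - (x - z) = - (y - z) by rewrite !opprB [LHS]addrC addrA subrK.
  rewrite D2N; case: (boolP (g * M <= codeg _ _ _ x z)) => //= h1.
  by case: (boolP (g * M <= codeg _ _ _ y z)) => //= h2; rewrite !codegD2.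
have D2M' : #|D2|%:R <= 256 / c ^+ 4 * M.
  have gM : 0 < g * M by rewrite mulr_gt0.
  move: D2M; rewrite -ler_pdivlMl // => /le_trans; apply.
  apply: le_trans (_ : (g * M)^-1 * ((2 / c * M) * (2 / c * M)) <= _).
    by rewrite ler_wpM2l ?invr_ge0 ?(ltW gM) // ler_pM.
  by apply: le_of_eq; rewrite /g; field; rewrite ?gt_eqF.
have cM : 0 < c / 2 / 4 * M by rewrite mulr_gt0 // divr_gt0.
move: A'D; rewrite -ler_pdivlMl // => /le_trans; apply.
apply: le_trans (_ : (c / 2 / 4 * M)^-1 * ((256 / c ^+ 4 * M) * (256 / c ^+ 4 * M)) <= _).
  by rewrite ler_wpM2l ?invr_ge0 ?(ltW cM) // ler_pM.
by apply: le_of_eq; field; rewrite ?gt_eqF.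
Qed.
End BSG.

(** The set [S] of popular differences of [A'] stands in for [A'] in iterated sums: its n-fold sums
    are bounded for every [n] by direct counting, in place of a Plunnecke inequality. *)
Theorem balog_szemeredi_popular (c : R) : 0 < c ->
  exists c1 : R, exists K : nat -> R, 0 < c1 /\
  forall (Z : finZmodType) (A : {set Z}) (M : R), 0 < M -> #|A|%:R <= M ->
    c * M ^+ 3 <= \sum_(x in A) \sum_(y in A) rdiff Z A (y - x) ->
  exists A' S : {set Z}, [/\ A' \subset A, c1 * M <= #|A'|%:R, c1 * M <= #|S|%:R,
    (forall s, s \in S -> - s \in S) &
    forall n, #|sumset Z (diffset Z A') (nfold Z S n)|%:R <= K n * M].
Proof.
move=> c0; pose K1 : R := 2 ^+ 19 / c ^+ 9.
have K10 : 0 < K1 by rewrite divr_gt0 // exprn_gt0.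
have c80 : 0 < c / 8 by rewrite divr_gt0.
(* Chosen so that K1 t = (c/8)^2 / 2, the threshold in [popular_card_ge]. *)
pose t := (c / 8) ^+ 2 / 2 / K1.
have t0 : 0 < t by rewrite !divr_gt0 // exprn_gt0.
exists (Num.min (c / 8) ((c / 8) ^+ 2 / 2)), (fun n => K1 ^+ n.+1 / t ^+ n).
split; first by rewrite lt_min c80 divr_gt0 // exprn_gt0.
move=> Z A M M0 AM HE.
have [A' [A'A A'M A'K]] := balog_szemeredi_diffset Z A c M c0 M0 AM HE.
have A'M2 : #|A'|%:R <= M by apply: le_trans AM; rewrite ler_nat subset_leq_card.
exists A', [set d | t * M <= rdiff Z A' d]; split => //.
- by apply: le_trans A'M; rewrite ler_wpM2r ?(ltW M0) // ge_min lexx.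
- apply: le_trans (popular_card_ge Z A' (c / 8) t K1 M M0 (ltW t0) A'M2 (ltW c80) A'M A'K _).
    by rewrite ler_wpM2r ?(ltW M0) // ge_min lexx orbT.
  by rewrite /t mulrC divfK ?gt_eqF.
- by move=> s; rewrite !inE rdiffN.
move=> n; have tM : 0 < t ^+ n * M ^+ n by rewrite mulr_gt0 // exprn_gt0.
have := nfold_popular_bound Z A' [set d | t * M <= rdiff Z A' d] t K1 M n t0 (ltW M0) _ A'K.
rewrite -ler_pdivlMl // => /(_ _) /le_trans; apply; first by move=> s; rewrite inE.
by apply: le_of_eq; rewrite [M ^+ n.+1]exprS; field; rewrite !gt_eqF ?exprn_gt0.
Qed.

(** * Linear structure of the derivative frequencies *)

Lemma pigeonhole_fibre (X Y : finType) (f : X -> Y) (A : {set X}) (x0 : X) :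
  x0 \in A ->
  exists2 y, [set x in A | f x == y] != set0 &
    (#|A| <= #|Y| * #|[set x in A | f x == y]|)%N.
Proof.
move=> x0A; pose n y := #|[set x in A | f x == y]|.
have [y _ Hy] := arg_maxnP n (erefl (xpredT (f x0))).
exists y.
  rewrite -card_gt0; apply: leq_trans (Hy (f x0) isT).
  by rewrite card_gt0; apply/set0Pn; exists x0; rewrite inE x0A eqxx.
rewrite -sum1_card (partition_big f xpredT) //= -sum_nat_const.
apply: leq_sum => z _; apply: leq_trans (Hy z isT).
rewrite /n -sum1_card; apply: eq_leq; apply: eq_bigl => x.
by rewrite inE.
Qed.

Section Cells.
Variable m : nat.
Notation G := 'I_m.+2.
Notation M := (m.+2%:R : R).

Lemma ord_dist_cell (J : nat) (x y : G) : (0 < J)%N ->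
  (x * J %/ m.+2 = y * J %/ m.+2)%N -> circ m (x - y) <= J%:R^-1.
Proof.
move=> J0; wlog xy : x y / (y <= x)%N.
  move=> H E; case: (leqP y x) => [yx|/ltnW xy]; first exact: H.
  by rewrite -circN opprB; apply: H.
move=> E; rewrite -(intr_ord m x) -(intr_ord m y) -intrB circ_int.
apply: le_trans (nint_le_norm _) _; have Mp := modulus_gt0 m.
have Jp : 0 < J%:R :> R by rewrite ltr0n.
rewrite subzn // -pmulrn ger0_norm ?divr_ge0 //.
rewrite ler_pdivrMr // mulrC ler_pdivlMr // -natrM ler_nat.
rewrite mulnBl; have := divn_eq (x * J) m.+2; have := divn_eq (y * J) m.+2.
rewrite E; have := ltn_pmod (x * J) (isT : (0 < m.+2)%N); lia.
Qed.

(** For each [i] the value [g i x] lies in one of [J] arcs; the most popular pattern of arcs is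
    kept. *)
Lemma cell_refine (X I : finType) (A : {set X}) (g : I -> X -> G) (J : nat) x0 :
  (0 < J)%N -> x0 \in A ->
  exists A' : {set X}, [/\ A' \subset A, A' != set0, (#|A| <= J ^ #|I| * #|A'|)%N &
    forall x y i, x \in A' -> y \in A' -> circ m (g i x - g i y) <= J%:R^-1].
Proof.
case: J => // J _ x0A.
have lt (x : G) : (x * J.+1 %/ m.+2 < J.+1)%N.
  by rewrite ltn_divLR // mulnC ltn_pmul2l.
pose f (x : X) : {ffun I -> 'I_J.+1} := [ffun i => Ordinal (lt (g i x))].
have [y y0 Hy] := pigeonhole_fibre X _ f A x0 x0A.
exists [set x in A | f x == y]; split => //.
- by apply/subsetP => x; rewrite inE => /andP[].
- by rewrite card_ffun card_ord in Hy.
move=> x z i; rewrite !inE => /andP[_ /eqP xy] /andP[_ /eqP zy].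
apply: ord_dist_cell => //.
by have := congr1 (fun h : {ffun I -> 'I_J.+1} => val (h i)) (etrans xy (esym zy)); rewrite !ffunE.
Qed.

Lemma circ_double (x : G) : circ m x <= 4^-1 -> circ m (2%:R * x) = 2 * circ m x.
Proof.
move=> H; rewrite -(intr_ord m x) (_ : 2%:R = 2%:~R) // -intrM !circ_int intrM -mulrA.
move: H; rewrite /circ; move: ((x : nat)%:R / M) => y.
have [k Hk] := sfr_int y => H.
have -> : 2%:~R * y = 2 * sfr y + (2 * k)%:~R by rewrite Hk intrM; ring.
rewrite nintDz nint_small normrM ger0_norm //.
by move: H; rewrite /nint; lra.
Qed.

(** As long as the distance stays below 1/4, doubling doubles it exactly, which cannot continue
    forever. *)
Lemma exists_far_multiple (a : G) : a != 0 -> exists t : G, 4^-1 <= circ m (t * a).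
Proof.
move=> a0; apply/existsP; apply: contraT => /existsPn H.
have {}H t : circ m (t * a) <= 4^-1 by apply: ltW; rewrite ltNge H.
have E n : circ m (2%:R ^+ n * a) = 2 ^+ n * circ m a.
  elim: n => [|n IH]; first by rewrite !mul1r.
  by rewrite !exprS -mulrA circ_double // IH mulrA.
have ga : 0 < circ m a.
  by rewrite lt_def circ_ge0 andbT; apply: contra a0 => /eqP /circ_eq0 ->.
have := H (2%:R ^+ Num.bound (circ m a)^-1); rewrite E.
have : 1 <= 2 ^+ Num.bound (circ m a)^-1 * circ m a.
  rewrite -ler_pdivrMr // mul1r; apply: le_trans (ltW (archi_boundP _)) _.
    by rewrite invr_ge0 ltW.
  by rewrite -natrX ler_nat ltnW // ltn_expl.
move: (2 ^+ _ * _) => u; lra.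
Qed.

(** The number of representations of [x] is, up to the factor [M], the sum of
    [w r ^+ 2 * psi (r * x)]. Frequency 0 contributes |P|^4, the other large frequencies have
    nonnegative real part by the width 1/4, and the small ones cannot cancel the main term. *)
Lemma bogolyubov (P : {set G}) (alpha : R) : 0 < alpha -> alpha * M <= #|P|%:R ->
  exists2 spec : {set G}, #|spec|%:R <= 2 / alpha ^+ 2 &
   forall x, (forall s, s \in spec -> circ m (s * x) <= 4^-1) ->
   exists p : G * G * G * G, [/\ p.1.1.1 \in P, p.1.1.2 \in P, p.1.2 \in P, p.2 \in P &
     x = p.1.1.1 + p.1.1.2 - p.1.2 - p.2].
Proof.
move=> al0 Pal; have Mp := modulus_gt0 m.
have P0 : 0 < #|P|%:R :> R by apply: lt_le_trans Pal; apply: mulr_gt0.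
pose f := fourier m (fun x => (x \in P)%:R).
pose w r := nrm (f r) ^+ 2.
have fE r : f r = \sum_(p in P) psi m (- (r * p)).
  by rewrite /f /fourier [RHS]big_mkcond; apply: eq_bigr => x _; case: (x \in P);
     rewrite ?mul1r ?mul0r.
have w0 r : 0 <= w r by apply/exprn_ge0/nrm_ge0.
have sumw : \sum_r w r = M * #|P|%:R.
  rewrite /w parseval card_setE; congr (_ * _); apply: eq_bigr => x _.
  by rewrite nrm_nat; case: (x \in P); rewrite ?expr1n ?expr0n.
(* With this threshold the small frequencies contribute at most t M |P| = |P|^4 / 2, and the large
   ones number at most M |P| / t = 2 (M / |P|)^2. *)
pose t : R := #|P|%:R ^+ 3 / (2 * M).
have t0 : 0 < t by rewrite divr_gt0 ?exprn_gt0 ?mulr_gt0.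
have wzero : w 0 = #|P|%:R ^+ 2.
  by rewrite /w fE; under eq_bigr do rewrite mul0r oppr0 psi0; rewrite sumr_const nrm_nat.
exists [set r | t <= w r].
  have : #|[set r | t <= w r]|%:R * t <= M * #|P|%:R.
    rewrite -sum_constR -sumw [leRHS](bigID (mem [set r | t <= w r])) /=.
    rewrite -[leLHS]addr0 lerD ?sumr_ge0 //; apply: ler_sum => r; by rewrite inE.
  rewrite -ler_pdivlMr // => /le_trans; apply.
  have -> : M * #|P|%:R / t = 2 * (M / #|P|%:R) ^+ 2.
    rewrite /t; move: (#|P|%:R : R) (m.+2%:R : R) P0 Mp => p q p0 q0.
    by field; rewrite !gt_eqF.
  have -> : 2 / alpha ^+ 2 = 2 * (alpha^-1) ^+ 2 by rewrite exprVn.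
  rewrite ler_pM2l // lerXn2r ?nnegrE ?divr_ge0 ?invr_ge0 ?(ltW al0) //.
  by rewrite ler_pdivrMr // mulrC ler_pdivlMr // mulrC.
move=> x Hx.
have /existsP[p /and5P[h1 h2 h3 h4 /eqP h5]] : [exists p : G * G * G * G, [&& p.1.1.1 \in P, p.1.1.2 \in P,
   p.1.2 \in P, p.2 \in P & x == p.1.1.1 + p.1.1.2 - p.1.2 - p.2]]; last by exists p.
apply: contraT => /existsPn H.
have Z : \sum_r ((w r ^+ 2)%:C)%C * psi m (r * x) = 0.
  transitivity (\sum_r \sum_(a in P) \sum_(b in P) \sum_(c in P) \sum_(d in P)
     psi m (r * (x - (a + b - c - d)))).
    apply: eq_bigr => r _.
    have -> : ((w r ^+ 2)%:C)%C = f r * f r * (f r)^* * (f r)^*.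
      by rewrite /w -exprM rmorphXn /= (exprM _ 2 2) -rmorphXn /= -mulCJ_nrm; ring.
    have fJ : (f r)^* = \sum_(p in P) psi m (r * p).
      by rewrite fE rmorph_sum; apply: eq_bigr => p _ /=; rewrite -psiN opprK.
    rewrite fJ fE -!mulrA mulr_suml; apply: eq_bigr => a _.
    rewrite mulr_suml mulr_sumr; apply: eq_bigr => b _.
    rewrite mulr_suml !mulr_sumr; apply: eq_bigr => c _.
    rewrite mulr_suml !mulr_sumr; apply: eq_bigr => d _.
    by rewrite -!psiD; congr psi; ring.
  rewrite exchange_big big1 // => a aP; rewrite exchange_big big1 // => b bP.
  rewrite exchange_big big1 // => c cP; rewrite exchange_big big1 // => d dP.
  rewrite sum_psi subr_eq0.
  by have := H (a, b, c, d); rewrite /= aP bP cP dP /= => /negbTE ->.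
have : complex.Re (\sum_r ((w r ^+ 2)%:C)%C * psi m (r * x)) = 0 by rewrite Z.
have [rp Hrp] : exists rp : G -> R, forall r, rp r = complex.Re (psi m (r * x)) by eexists.
have ReE r : complex.Re (((w r ^+ 2)%:C)%C * psi m (r * x)) = w r ^+ 2 * rp r.
  by rewrite Hrp; case: (psi _ _) => u v /=; rewrite mul0r subr0.
rewrite Re_sum; under eq_bigr => r _ do rewrite ReE.
have Mnz : M != 0 by rewrite gt_eqF.
have big : \sum_r (if t <= w r then 0 else w r ^+ 2) <= t * (M * #|P|%:R).
  rewrite -sumw mulr_sumr; apply: ler_sum => r _.
  case: (lerP t (w r)) => h; first by rewrite mulr_ge0 ?(ltW t0).
  by rewrite expr2 ler_wpM2r // ltW.
have lb r : - (if t <= w r then 0 else w r ^+ 2) <= w r ^+ 2 * rp r.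
  have : -1 <= rp r by rewrite Hrp /psi /e /=; apply: cos_geN1.
  case: (lerP t (w r)) => h h2.
    rewrite oppr0; apply: mulr_ge0; first exact: exprn_ge0.
    rewrite Hrp /psi; apply: Re_e_ge0; by rewrite -/(circ m (r * x)) div1r; apply: Hx; rewrite inE.
  by rewrite -mulrN1 ler_wpM2l // exprn_ge0.
have E0 : rp 0 = 1 by rewrite Hrp mul0r psi0.
rewrite (bigD1 0) //= E0 mulr1 => E.
have t_w0 : t <= w 0.
  rewrite wzero /t ler_pdivrMr ?mulr_gt0 // exprSr ler_pM2l ?exprn_gt0 //.
  have : #|P|%:R <= M by rewrite ler_nat -[X in (_ <= X)%N](card_ord m.+2) max_card.
  by move: Mp; lra.
have : - (t * (M * #|P|%:R)) <= \sum_(i < m.+2 | i != 0) w i ^+ 2 * rp i.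
  apply: le_trans (_ : - \sum_(i < m.+2 | i != 0) (if t <= w i then 0 else w i ^+ 2) <= _).
    rewrite lerN2; apply: le_trans big; rewrite [leRHS](bigD1 0) //= t_w0 add0r //.
  by rewrite -sumrN; apply: ler_sum.
have -> : t * (M * #|P|%:R) = #|P|%:R ^+ 4 / 2.
  by rewrite /t; move: (#|P|%:R : R) (m.+2%:R : R) Mnz => p q q0; field.
move: E; rewrite wzero -exprM.
have : 0 < #|P|%:R ^+ 4 :> R by apply: exprn_gt0.
by set u := _ ^+ 4; set v := \sum_(i < _ | _) _; change (#|P|%:R ^+ (2 * 2)) with u; lra.
Qed.
End Cells.

HB.instance Definition _ (U V : finZmodType) := GRing.Zmodule.on (U * V)%type.

Lemma card_le_inj (X Y : finType) (f : X -> Y) (A : {set X}) (B : {set Y}) :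
  {in A &, injective f} -> (forall x, x \in A -> f x \in B) -> (#|A| <= #|B|)%N.
Proof.
move=> inj AB; rewrite -(card_in_imset inj); apply: subset_leq_card.
by apply/subsetP => y /imsetP[x xA ->]; apply: AB.
Qed.

(** * From additive energy of a graph to a map additive on a Bohr set *)

Section LocallyLinear.
Variable m : nat.
Notation G := 'I_m.+2.
Notation M := (m.+2%:R : R).
Notation Z := ('I_m.+2 * 'I_m.+2)%type.

Lemma mem_nfold_sum (S : {set Z}) (l : seq Z) :
  (forall x, x \in l -> x \in S) -> \sum_(x <- l) x \in nfold Z S (size l).
Proof.
elim: l => [|x l IH] H; first by rewrite big_nil inE.
rewrite big_cons /=; apply: mem_sumset; first by apply: H; rewrite inE eqxx.
by apply: IH => y yl; apply: H; rewrite inE yl orbT.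
Qed.

Lemma fst_sum (l : seq Z) : (\sum_(x <- l) x).1 = \sum_(x <- l) x.1.
Proof. by elim: l => [|x l IH]; rewrite ?big_nil ?big_cons //= -IH. Qed.

Lemma snd_sum (l : seq Z) : (\sum_(x <- l) x).2 = \sum_(x <- l) x.2.
Proof. by elim: l => [|x l IH]; rewrite ?big_nil ?big_cons //= -IH. Qed.

(** Moving a point of the graph [A] vertically does not change its first coordinate, which
    determines the point; so pairs of a point and a fibre element inject into the sumset, and a
    small sumset forces a small fibre. *)
Lemma vertical_fibre_card (A S : {set Z}) (n : nat) (p0 : Z) : p0 \in A ->
  (forall p q, p \in A -> q \in A -> p.1 = q.1 -> p = q) ->
  (#|[set a : G | ((0%R, a) : Z) \in nfold Z S n]| * #|A| <=
   #|sumset Z (diffset Z A) (nfold Z S n)|)%N.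
Proof.
move=> p0A graph; rewrite -cardsX.
apply: (card_le_inj _ _ (fun x : G * Z => (x.2 - p0) + (0, x.1))) => [|[a p]].
  move=> [a p] [b q]; rewrite !inE /= => /andP[_ pA] /andP[_ qA] E.
  have pq : p = q.
    apply: graph => //; have := congr1 fst E; rewrite /= !addr0.
    exact: addIr.
  move: E; rewrite pq => /addrI [->] //.
rewrite !inE /= => /andP[aS pA].
by apply: mem_sumset => //; apply: mem_diffset.
Qed.

Lemma circ_sum_zip (S : {set Z}) (t : G) (eps : R) (us vs : seq Z) :
  (forall x y, x \in S -> y \in S -> circ m (t * x.2 - t * y.2) <= eps) ->
  size us = size vs -> (forall x, x \in us -> x \in S) -> (forall x, x \in vs -> x \in S) ->
  circ m (t * (\sum_(x <- us) x.2 - \sum_(x <- vs) x.2)) <= (size us)%:R * eps.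
Proof.
move=> H; elim: us vs => [|u us IH] [|v vs] //=.
  by move=> _ _ _; rewrite !big_nil subrr mulr0 circ0 mul0r.
move=> [E] Hu Hv; rewrite !big_cons.
have -> : t * (u.2 + \sum_(j <- us) j.2 - (v.2 + \sum_(j <- vs) j.2)) =
   (t * u.2 - t * v.2) + t * (\sum_(j <- us) j.2 - \sum_(j <- vs) j.2) by ring.
apply: le_trans (circD _ _ _) _; rewrite -natr1 mulrDl mul1r addrC lerD //.
  apply: IH => // x xl; [apply: Hu | apply: Hv]; by rewrite inE xl orbT.
by apply: H; [apply: Hu | apply: Hv]; rewrite inE eqxx.
Qed.

(* Localizing [S] along one character per nonzero point of the vertical fibre
   leaves only the trivial point in the fibre. *)
Lemma kill_vertical_fibre (S : {set Z}) (n : nat) (s0 : Z) : s0 \in S ->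
  (forall s, s \in S -> - s \in S) ->
  #|[set a : G | ((0%R, a) : Z) \in nfold Z S 12]| = n ->
  exists S' : {set Z}, [/\ S' \subset S, S' != set0, (#|S| <= 25 ^ n * #|S'|)%N &
    forall us vs : seq Z, size us = 6 -> size vs = 6 ->
      (forall x, x \in us -> x \in S') -> (forall x, x \in vs -> x \in S') ->
      \sum_(x <- us) x.1 = \sum_(x <- vs) x.1 -> \sum_(x <- us) x.2 = \sum_(x <- vs) x.2].
Proof.
move=> s0S SN; set Phi := [set a | _] => cardPhi.
have ex (a : G) : exists t : G, a != 0 -> 4^-1 <= circ m (t * a).
  have [->|a0] := eqVneq a 0; first by exists 0.
  by have [t Ht] := exists_far_multiple m a a0; exists t.
have [t Ht] := fin_all_exists ex.
(* With 25 arcs a difference of two six-term sums moves by at most 6/25 < 1/4 along the character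
   that sends [a] to distance at least 1/4. *)
have [S' [S'S S'0 card cell]] := cell_refine m Z 'I_n S
   (fun i x => t (enum_val (cast_ord (esym cardPhi) i)) * x.2) 25 s0 isT s0S.
rewrite card_ord in card.
exists S'; split => // us vs sus svs Hu Hv E.
apply/eqP; rewrite -subr_eq0; apply: contraT => a0.
set a := _ - _ in a0.
have aPhi : a \in Phi.
  rewrite inE.
  have -> : ((0%R, a) : Z) = \sum_(x <- us ++ [seq - v | v <- vs]) x.
    rewrite big_cat big_map /= sumrN.
    by apply/eqP; rewrite xpair_eqE /= !fst_sum !snd_sum E subrr !eqxx.
  have -> : 12%N = size (us ++ [seq - v | v <- vs]) by rewrite size_cat size_map sus svs.
  apply: mem_nfold_sum => x; rewrite mem_cat => /orP[/Hu|/mapP[v /Hv vS ->]].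
    exact: (subsetP S'S).
  by apply: SN; apply: (subsetP S'S).
pose i := cast_ord cardPhi (enum_rank_in aPhi a).
have ti : t (enum_val (cast_ord (esym cardPhi) i)) = t a.
  by rewrite /i cast_ordK enum_rankK_in.
have cella x y : x \in S' -> y \in S' -> circ m (t a * x.2 - t a * y.2) <= 25^-1.
  by move=> xS yS; have := cell x y i xS yS; rewrite ti.
have := circ_sum_zip S' (t a) 25^-1 us vs cella _ Hu Hv.
rewrite sus svs -/a => /(_ erefl); have := Ht a a0; lra.
Qed.

Definition bohr (spec : {set G}) (rho : R) : {set G} :=
  [set x | [forall s in spec, circ m (s * x) <= rho]].

Lemma bohrP (spec : {set G}) (rho : R) x :
  reflect (forall s, s \in spec -> circ m (s * x) <= rho) (x \in bohr spec rho).
Proof. by rewrite inE; apply: (iffP forall_inP). Qed.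

Definition graph_of (H : {set G}) (xi : G -> G) : {set Z} := [set (h, xi h) | h in H].

Lemma graph_energy (H : {set G}) (xi : G -> G) :
  \sum_(x in graph_of H xi) \sum_(y in graph_of H xi)
     rdiff Z (graph_of H xi) (y - x) =
  \sum_h1 \sum_h2 \sum_h3 ind [&& h1 \in H, h2 \in H, h3 \in H, h2 + h3 - h1 \in H &
     xi h1 + xi (h2 + h3 - h1) == xi h2 + xi h3].
Proof.
have inj : {in H &, injective (fun h => (h, xi h) : Z)} by move=> a b _ _ [].
rewrite /graph_of (big_imset _ inj) /= sum_in; apply: eq_bigr => h1 _.
case: (h1 \in H) => /=; last first.
  by rewrite mul0r big1 // => h2 _; rewrite big1.
rewrite mul1r (big_imset _ inj) /= sum_in; apply: eq_bigr => h2 _.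
case: (h2 \in H) => /=; last by rewrite mul0r big1.
rewrite mul1r /rdiff.
transitivity (\sum_(p in [set ((h, xi h) : Z) | h in H])
   ind (p + ((h2, xi h2) - (h1, xi h1)) \in [set ((h, xi h) : Z) | h in H])).
  by rewrite sum_in; apply: eq_bigr => p _; case: (p \in _); rewrite ?mul1r ?mul0r.
rewrite (big_imset _ inj) /= sum_in; apply: eq_bigr => h3 _.
case: (h3 \in H) => /=; rewrite ?mul0r // mul1r; congr (_%:R); congr nat_of_bool.
have -> : (h3, xi h3) + ((h2, xi h2) - (h1, xi h1)) = (h2 + h3 - h1, xi h2 + xi h3 - xi h1) :> Z.
  by congr (_, _) => /=; ring.
apply/imsetP/andP => [[h hH [-> E]]|[hH /eqP E]].
  by split => //; rewrite -E; apply/eqP; ring.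
by exists (h2 + h3 - h1) => //; congr (_, _); rewrite -E; ring.
Qed.
End LocallyLinear.

(** [phi x] is the second coordinate of any combination s1 + s2 - s3 - s4 of points of the rigid set
    [S'] lying above [x]; Bogolyubov supplies one for each [x] of the Bohr set. The last clause
    holds for every subset [B], because the box on which it is applied depends on [spec]. *)
Theorem locally_linear_on_bohr (c : R) : 0 < c -> exists c1 : R, exists d : R, 0 < c1 /\
  forall (m : nat) (H : {set 'I_m.+2}) (xi : 'I_m.+2 -> 'I_m.+2),
  c * m.+2%:R ^+ 3 <= \sum_h1 \sum_h2 \sum_h3
    ind [&& h1 \in H, h2 \in H, h3 \in H, h2 + h3 - h1 \in H &
     xi h1 + xi (h2 + h3 - h1) == xi h2 + xi h3] ->
  exists (spec : {set 'I_m.+2}) (phi : 'I_m.+2 -> 'I_m.+2),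
  [/\ #|spec|%:R <= d,
    (forall x y, x \in bohr m spec 4^-1 -> y \in bohr m spec 4^-1 ->
       x + y \in bohr m spec 4^-1 -> phi (x + y) = phi x + phi y) &
    forall B : {set 'I_m.+2}, B \subset bohr m spec 4^-1 ->
     exists h0 xi0, c1 * #|B|%:R <=
       #|[set h in H | (h - h0 \in B) && (xi h == xi0 + phi (h - h0))]|%:R].
Proof.
move=> c0; have [c1 [K [c10 BSG]]] := balog_szemeredi_popular c c0.
(* Bounds the vertical fibre of the twelve-fold sums through [vertical_fibre_card]; the localization
   then costs a factor 25^n0. *)
pose n0 := Num.bound (K 12 / c1).
pose alpha : R := c1 / 25 ^+ n0.
have al0 : 0 < alpha by rewrite divr_gt0 // exprn_gt0.
pose K4 : R := Num.max (K 4) 1.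
have K40 : 0 < K4 by rewrite lt_max ltr01 orbT.
exists (c1 / K4), (2 / alpha ^+ 2); split; first by rewrite divr_gt0.
move=> m H xi; set M := m.+2%:R; rewrite -graph_energy; set A := graph_of m H xi => HE.
have Mp : 0 < M := modulus_gt0 m.
have AM : #|A|%:R <= M.
  by rewrite ler_nat (leq_trans (leq_imset_card _ _)) // -[X in (_ <= X)%N](card_ord m.+2) max_card.
have [A' [S [A'A A'M SM SN KS]]] := BSG _ A M Mp AM HE.
have graph p q : p \in A' -> q \in A' -> p.1 = q.1 -> p = q.
  by move=> /(subsetP A'A) /imsetP[a _ ->] /(subsetP A'A) /imsetP[b _ ->] /= ->.
have pos (X : {set 'I_m.+2 * 'I_m.+2}) : c1 * M <= #|X|%:R -> exists x, x \in X.
  move=> cX; apply/set0Pn; rewrite -card_gt0 -(ltr0n R).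
  by apply: lt_le_trans cX; apply: mulr_gt0.
have [p0 p0A] := pos _ A'M; have [s0 s0S] := pos _ SM.
have fibre : (#|[set a : 'I_m.+2 | ((0%R, a) : 'I_m.+2 * 'I_m.+2) \in nfold _ S 12]| <= n0)%N.
  rewrite -(ler_nat R); apply: le_trans (ltW (archi_boundP _)); last first.
    by rewrite divr_ge0 ?(ltW c10) //; move: (le_trans (ler0n R _) (KS 12)); rewrite pmulr_lge0.
  rewrite ler_pdivlMr // -(ler_pM2r Mp) -mulrA; apply: le_trans (KS 12).
  apply: le_trans (ler_wpM2l (ler0n R _) A'M) _.
  by rewrite -natrM ler_nat; apply: vertical_fibre_card p0A graph.
have [S' [S'S S'0 cardS' rig]] := kill_vertical_fibre m S _ s0 s0S SN erefl.
have {}cardS' : (#|S| <= 25 ^ n0 * #|S'|)%N.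
  by apply: leq_trans cardS' _; rewrite leq_mul2r leq_pexp2l ?orbT.
have rig1 x y : x \in S' -> y \in S' -> x.1 = y.1 -> x = y.
  move=> xS yS E; rewrite (surjective_pairing x) (surjective_pairing y) E; congr (_, _).
  (* Padding with five copies of [y] deduces the one-term statement from the six-term one. *)
  have := rig [:: x; y; y; y; y; y] [:: y; y; y; y; y; y] erefl erefl.
  rewrite !big_cons !big_nil E => /(_ _ _ erefl) H6.
  by apply: (addIr (y.2 + (y.2 + (y.2 + (y.2 + (y.2 + 0)))))); apply: H6 => z;
    rewrite !inE => /or4P[|||/or3P[]] /eqP ->.
pose P := [set s.1 | s in S'].
have PM : alpha * M <= #|P|%:R.
  rewrite /P card_in_imset; last by move=> x y; apply: rig1.
  rewrite /alpha mulrAC ler_pdivrMr ?exprn_gt0 //.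
  by apply: le_trans SM _; rewrite -natrX -natrM ler_nat mulnC.
have [spec specM Hspec] := bogolyubov m P alpha al0 PM.
have ex x : exists y, x \in bohr m spec 4^-1 -> exists s : _ * _ * _ * _,
    [/\ s.1.1.1 \in S', s.1.1.2 \in S', s.1.2 \in S', s.2 \in S' &
     (x, y) = s.1.1.1 + s.1.1.2 - s.1.2 - s.2].
  have [/bohrP xB|] := boolP (x \in bohr m spec 4^-1); last by exists 0.
  have [[[[a b] c'] d] [/= /imsetP[s1 s1S ->] /imsetP[s2 s2S ->]
    /imsetP[s3 s3S ->] /imsetP[s4 s4S ->] E]] := Hspec x xB.
  exists (s1.2 + s2.2 - s3.2 - s4.2) => _; exists (s1, s2, s3, s4); split => //=.
  by rewrite E.
have [phi Hphi] := fin_all_exists ex.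
exists spec, phi; split => //.
- move=> x y /Hphi[[[[x1 x2] x3] x4] [/= x1S x2S x3S x4S [Ex Fx]]].
  move=> /Hphi[[[[y1 y2] y3] y4] [/= y1S y2S y3S y4S [Ey Fy]]].
  move=> /Hphi[[[[z1 z2] z3] z4] [/= z1S z2S z3S z4S Exyz]].
  have Ez : x + y = z1.1 + z2.1 - z3.1 - z4.1 := congr1 fst Exyz.
  have Fz : phi (x + y) = z1.2 + z2.2 - z3.2 - z4.2 := congr1 snd Exyz.
  (* The twelve points representing [x], [y] and [x + y] split into two lists of six with equal
     first coordinate sums: this is why six and twelve occur in [kill_vertical_fibre]. *)
  have := rig [:: x1; x2; y1; y2; z3; z4] [:: x3; x4; y3; y4; z1; z2] erefl erefl.
  rewrite !big_cons !big_nil Fx Fy Fz => H6.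
  apply/eqP; rewrite -subr_eq0.
  have -> : z1.2 + z2.2 - z3.2 - z4.2 - (x1.2 + x2.2 - x3.2 - x4.2 + (y1.2 + y2.2 - y3.2 - y4.2)) =
   (x3.2 + (x4.2 + (y3.2 + (y4.2 + (z1.2 + (z2.2 + 0)))))) -
   (x1.2 + (x2.2 + (y1.2 + (y2.2 + (z3.2 + (z4.2 + 0)))))) by ring.
  rewrite subr_eq0 eq_sym; apply/eqP; apply: H6.
  + by move=> z; rewrite !inE => /or4P[|||/or3P[]] /eqP ->.
  + by move=> z; rewrite !inE => /or4P[|||/or3P[]] /eqP ->.
  apply/eqP; rewrite -subr_eq0.
  have -> : x1.1 + (x2.1 + (y1.1 + (y2.1 + (z3.1 + (z4.1 + 0))))) -
    (x3.1 + (x4.1 + (y3.1 + (y4.1 + (z1.1 + (z2.1 + 0)))))) =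
    (x1.1 + x2.1 - x3.1 - x4.1) + (y1.1 + y2.1 - y3.1 - y4.1) - (z1.1 + z2.1 - z3.1 - z4.1) by ring.
  by rewrite -Ex -Ey -Ez subrr.
move=> B BB.
have phiS x : x \in B -> - ((x, phi x) : 'I_m.+2 * 'I_m.+2) \in nfold _ S 4.
  move=> /(subsetP BB) /Hphi[[[[x1 x2] x3] x4] [/= x1S x2S x3S x4S ->]].
  have -> : - (x1 + x2 - x3 - x4) = \sum_(z <- [:: - x1; - x2; x3; x4]) z.
    by rewrite !big_cons big_nil; apply/eqP; rewrite xpair_eqE /=; apply/andP; split; apply/eqP; ring.
  by apply: mem_nfold_sum => z; rewrite !inE => /or4P[] /eqP ->; rewrite ?SN //; apply: (subsetP S'S).
have [->|/set0Pn[b0 b0B]] := eqVneq B set0.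
  by exists 0, 0; rewrite cards0 mulr0.
pose W := sumset _ (diffset _ A') (nfold _ S 4).
have WM : #|W|%:R <= K4 * M.
  by apply: le_trans (KS 4) _; rewrite ler_wpM2r ?(ltW Mp) // le_max lexx.
(* [f] maps into a sumset of size O(M). A popular value [w] provides many [b] in [B] for which
   [w + p0 + (b, phi b)] lies on the graph of [xi]. *)
pose f (u : ('I_m.+2 * 'I_m.+2) * 'I_m.+2) : 'I_m.+2 * 'I_m.+2 := u.1 - p0 - (u.2, phi u.2).
pose AB := setX A' B.
have fW u : u \in AB -> f u \in W.
  by rewrite inE => /andP[uA uB]; apply: mem_sumset; [apply: mem_diffset|apply: phiS].
have [w Hw] : exists w, #|AB|%:R <= #|W|%:R * #|[set u in AB | f u == w]|%:R :> R.
  pose nw w := #|[set u in AB | f u == w]|.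
  have [w _ Hmax] := arg_maxnP nw (erefl (xpredT p0)).
  exists w; rewrite -natrM ler_nat -sum1_card (partition_big f (mem W)) //= -sum_nat_const.
  apply: leq_sum => z _; apply: leq_trans (Hmax z isT).
  by rewrite /nw -sum1_card; apply: eq_leq; apply: eq_bigl => x; rewrite !inE.
exists (w.1 + p0.1), (w.2 + p0.2).
set T := [set h in H | _].
have nT : (#|[set u in AB | f u == w]| <= #|T|)%N.
  have fE u : u \in [set u in AB | f u == w] ->
      [/\ u.1 \in A, u.2 \in B & u.1 = w + p0 + (u.2, phi u.2)].
    rewrite !inE => /andP[/andP[/(subsetP A'A) uA uB] /eqP <-]; split => //.
    by rewrite /f [RHS]addrAC !subrK.
  apply: (card_le_inj _ _ (fun u : ('I_m.+2 * 'I_m.+2) * 'I_m.+2 => u.1.1))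
    => [u v /fE[uA uB Eu] /fE[vA vB Ev] /= E|u /fE[/imsetP[h hH E] uB Eu]].
    have E2 : u.2 = v.2 by move: E; rewrite Eu Ev /= => /addrI.
    by rewrite (surjective_pairing u) (surjective_pairing v) Eu Ev E2.
  have [Eu1 Eu2] : h = w.1 + p0.1 + u.2 /\ xi h = w.2 + p0.2 + phi u.2.
    by move: Eu; rewrite E => /(congr1 (fun p => (p.1, p.2))) [-> ->].
  rewrite inE E /= hH Eu2 Eu1 /= [_ + u.2]addrC addrK uB.
  by rewrite eqxx.
have : c1 * M * #|B|%:R <= K4 * M * #|T|%:R.
  apply: le_trans (_ : #|A'|%:R * #|B|%:R <= _); first by rewrite ler_wpM2r.
  rewrite -natrM -cardsX; apply: le_trans Hw _.
  by apply: ler_pM => //; rewrite ler_nat.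
rewrite mulrAC -[K4 * M * _]mulrAC ler_pM2r // => H1.
by rewrite mulrAC ler_pdivrMr // [leRHS]mulrC.
Qed.

(** * Coordinates on Bohr sets *)

Section Dot.
Variable d : nat.
Implicit Types u v w : 'rV[R]_d.

Definition dot u v : R := \sum_j u 0 j * v 0 j.
Definition nsq u : R := dot u u.

Lemma dotC u v : dot u v = dot v u.
Proof. by apply: eq_bigr => j _; rewrite mulrC. Qed.
Lemma dotDl u v w : dot (u + v) w = dot u w + dot v w.
Proof. by rewrite -big_split; apply: eq_bigr => j _; rewrite mxE mulrDl. Qed.
Lemma dotZl a u v : dot (a *: u) v = a * dot u v.
Proof. by rewrite mulr_sumr; apply: eq_bigr => j _; rewrite mxE mulrA. Qed.
Lemma dotNl u v : dot (- u) v = - dot u v.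
Proof. by rewrite -scaleN1r dotZl mulN1r. Qed.
Lemma dot0l v : dot 0 v = 0.
Proof. by rewrite -(scale0r 0) dotZl mul0r. Qed.
Lemma dotBl u v w : dot (u - v) w = dot u w - dot v w.
Proof. by rewrite dotDl dotNl. Qed.
Lemma dot_suml (I : finType) (F : I -> 'rV[R]_d) w :
  dot (\sum_i F i) w = \sum_i dot (F i) w.
Proof.
by apply: (big_ind2 (fun x y => dot x w = y)) => [|x1 y1 x2 y2 <- <-|//];
  rewrite ?dot0l ?dotDl.
Qed.
Lemma dotDr u v w : dot w (u + v) = dot w u + dot w v.
Proof. by rewrite dotC dotDl !(dotC _ w). Qed.
Lemma dotZr a u v : dot v (a *: u) = a * dot v u.
Proof. by rewrite dotC dotZl (dotC _ v). Qed.
Lemma dotBr u v w : dot w (u - v) = dot w u - dot w v.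
Proof. by rewrite dotC dotBl !(dotC _ w). Qed.
Lemma dot_sumr (I : finType) (F : I -> 'rV[R]_d) w :
  dot w (\sum_i F i) = \sum_i dot w (F i).
Proof. by rewrite dotC dot_suml; apply: eq_bigr => i _; rewrite dotC. Qed.

Lemma nsq_ge0 u : 0 <= nsq u.
Proof. by apply: sumr_ge0 => j _; rewrite -expr2 sqr_ge0. Qed.

Lemma nsq_eq0 u : nsq u = 0 -> u = 0.
Proof.
move=> /eqP; rewrite psumr_eq0; last by move=> j _; rewrite -expr2 sqr_ge0.
move=> /allP H; apply/rowP => j; rewrite mxE.
by have := H j (mem_index_enum _); rewrite /= mulf_eq0 orbb => /eqP.
Qed.

Lemma nsq_gt0 u : u != 0 -> 0 < nsq u.
Proof. by move=> u0; rewrite lt_def nsq_ge0 andbT; apply: contra u0 => /eqP /nsq_eq0 ->. Qed.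

Lemma nsqZ a u : nsq (a *: u) = a ^+ 2 * nsq u.
Proof. by rewrite /nsq dotZl dotZr mulrA. Qed.

Lemma nsqD_le u v : nsq (u + v) <= 2 * nsq u + 2 * nsq v.
Proof.
have := nsq_ge0 (u - v).
by rewrite /nsq dotBl !dotBr dotDl !dotDr (dotC v u); lra.
Qed.

Lemma nsq_sum_le (k : nat) (F : 'I_k -> 'rV[R]_d) :
  nsq (\sum_i F i) <= k%:R * \sum_i nsq (F i).
Proof.
rewrite /nsq /dot [in leRHS]exchange_big /= mulr_sumr; apply: ler_sum => j _.
rewrite summxE; have := sum_sqr_le _ xpredT (fun i => F i 0 j).
rewrite card_ord expr2 => /le_trans; apply.
by rewrite ler_wpM2l // ler_sum.
Qed.

Lemma sqr_coord_le u j : u 0 j ^+ 2 <= nsq u.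
Proof.
rewrite /nsq /dot (bigD1 j) //= -expr2 lerDl sumr_ge0 // => i _.
by rewrite -expr2 sqr_ge0.
Qed.
End Dot.
Arguments dot {d} u v.
Arguments nsq {d} u.

Section Projection.
Variable d : nat.
Variable v1 : 'rV[R]_d.
Hypothesis v1n0 : v1 != 0.
Implicit Types u v w : 'rV[R]_d.

Definition pcoef u : R := dot u v1 / nsq v1.
Definition perp u : 'rV[R]_d := u - pcoef u *: v1.

Let N0 : 0 < nsq v1. Proof. exact: nsq_gt0. Qed.

Lemma pcoefD u v : pcoef (u + v) = pcoef u + pcoef v.
Proof. by rewrite /pcoef dotDl mulrDl. Qed.
Lemma pcoefZ a u : pcoef (a *: u) = a * pcoef u.
Proof. by rewrite /pcoef dotZl mulrA. Qed.
Lemma pcoef_v1 : pcoef v1 = 1.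
Proof. by rewrite /pcoef divff // gt_eqF. Qed.
Lemma perpD u v : perp (u + v) = perp u + perp v.
Proof. by rewrite /perp pcoefD scalerDl opprD addrACA. Qed.
Lemma perpZ a u : perp (a *: u) = a *: perp u.
Proof. by rewrite /perp pcoefZ scalerBr scalerA. Qed.
Lemma perpN u : perp (- u) = - perp u.
Proof. by rewrite -scaleN1r perpZ scaleN1r. Qed.
Lemma perpB u v : perp (u - v) = perp u - perp v.
Proof. by rewrite perpD perpN. Qed.
Lemma perp_v1 : perp v1 = 0.
Proof. by rewrite /perp pcoef_v1 scale1r subrr. Qed.
Lemma perp0 : perp 0 = 0.
Proof. by rewrite /perp /pcoef dot0l mul0r scale0r subr0. Qed.
Lemma perp_sum (I : finType) (F : I -> 'rV[R]_d) : perp (\sum_i F i) = \sum_i perp (F i).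
Proof. by apply: (big_morph perp perpD perp0). Qed.

Lemma dot_perp_v1 u : dot (perp u) v1 = 0.
Proof. by rewrite /perp dotBl dotZl /pcoef -/(nsq v1) divfK ?subrr // gt_eqF. Qed.

Lemma dot_perp u v : dot (perp u) v = dot u (perp v).
Proof.
rewrite /perp dotBl dotZl dotBr dotZr /pcoef (dotC _ v1 v); ring.
Qed.

Lemma nsq_perp u : nsq u = nsq (perp u) + pcoef u ^+ 2 * nsq v1.
Proof.
have E : u = perp u + pcoef u *: v1 by rewrite /perp subrK.
have := dot_perp_v1 u; move: (perp u) (pcoef u) E => w c -> H.
rewrite /nsq dotDl !dotDr !dotZl !dotZr (dotC _ v1 w) H; ring.
Qed.

End Projection.

Definition subgroup {d} (L : 'rV[R]_d -> Prop) :=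
  L 0 /\ forall u v, L u -> L v -> L (u - v).

(** Finiteness of each ball is given as a covering list, the form in which [seq_argmin] can extract
    a shortest vector although membership in [L] is an arbitrary proposition. *)
Definition discrete {d} (L : 'rV[R]_d -> Prop) :=
  forall K : R, exists l : seq 'rV[R]_d, forall u, L u -> nsq u <= K -> u \in l.

Lemma subgroupN d (L : 'rV[R]_d -> Prop) u : subgroup L -> L u -> L (- u).
Proof. by move=> [L0 LB] Lu; rewrite -sub0r; apply: LB. Qed.

Lemma subgroupD d (L : 'rV[R]_d -> Prop) u v : subgroup L -> L u -> L v -> L (u + v).
Proof. by move=> HL Lu Lv; rewrite -(opprK v); apply: HL.2 => //; apply: subgroupN. Qed.

Lemma subgroup_int d (L : 'rV[R]_d -> Prop) u (k : int) : subgroup L -> L u -> L (k%:~R *: u).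
Proof.
move=> HL Lu.
have H (n : nat) : L (n%:R *: u).
  elim: n => [|n IH]; first by rewrite scale0r; case: HL.
  by rewrite -natr1 scalerDl scale1r; apply: subgroupD.
by case: k => n; [apply: H | rewrite NegzE intrN scaleNr; apply: subgroupN => //; apply: H].
Qed.

Lemma subgroup_sum d (L : 'rV[R]_d -> Prop) (k : nat) (F : 'I_k -> 'rV[R]_d) :
  subgroup L -> (forall i, L (F i)) -> L (\sum_i F i).
Proof.
move=> HL LF; apply: (big_ind L) => [|u v|//]; first by case: HL.
exact: subgroupD.
Qed.

Lemma seq_argmin (T : eqType) (P : T -> Prop) (f : T -> R) (l : seq T) :
  (exists2 x, x \in l & P x) ->
  exists2 x, P x & forall y, y \in l -> P y -> f x <= f y.
Proof.
elim: l => [[x]//|a l IH [x]].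
have [Pl|nPl] := EM (exists2 x, x \in l & P x).
  have [z Pz Hz] := IH Pl => _ _.
  have [[Pa fa]|na] := EM (P a /\ f a <= f z).
    exists a => // y; rewrite inE => /orP[/eqP -> //|yl Py].
    by apply: le_trans fa _; apply: Hz.
  exists z => // y; rewrite inE => /orP[/eqP -> Pa|]; last exact: Hz.
  by rewrite leNgt; apply/negP => /ltW fa; apply: na.
rewrite inE => /orP[/eqP -> Pa|xl Px]; last by case: nPl; exists x.
exists a => // y; rewrite inE => /orP[/eqP -> //|yl Py].
by case: nPl; exists y.
Qed.

Lemma shortest_vector d (L : 'rV[R]_d -> Prop) : discrete L ->
  (exists2 u, L u & u != 0) ->
  exists v, [/\ L v, v != 0 & forall u, L u -> u != 0 -> nsq v <= nsq u].
Proof.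
move=> dL [u Lu u0]; have [l Hl] := dL (nsq u).
have [|v [Lv v0] Hv] := @seq_argmin _ (fun u => L u /\ u != 0) (@nsq d) l.
  by exists u => //; apply: Hl.
exists v; split => // w Lw w0.
have [uw|/ltW wu] := lerP (nsq w) (nsq u); first by apply: Hv => //; apply: Hl.
by apply: le_trans wu; apply: Hv => //; apply: Hl.
Qed.

Lemma row_dot d (u v : 'rV[R]_d) : (u *m v^T == 0) = (dot u v == 0).
Proof.
have -> : u *m v^T = (dot u v)%:M.
  by apply/matrixP => i j; rewrite !ord1 !mxE eqxx mulr1n; apply: eq_bigr => k _; rewrite mxE.
apply/eqP/eqP => [/matrixP/(_ 0 0)|->]; first by rewrite !mxE mulr1n.
by rewrite raddf0.
Qed.

(* A Hermite-Korkine-Zolotarev basis, with its dual family [D]: take a shortest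
   vector, recurse in its orthogonal complement, and lift with rounding. *)
Lemma reduced_basis (r : nat) : exists2 Cr : R, 0 <= Cr &
  forall (d : nat) (W : 'M[R]_d) (L : 'rV[R]_d -> Prop),
  (\rank W <= r)%N -> (forall u, L u -> (u <= W)%MS) -> subgroup L -> discrete L ->
  exists k : nat, exists b D : 'I_k -> 'rV[R]_d,
  [/\ (k <= r)%N, forall i, L (b i), forall i j, dot (b i) (D j) = (i == j)%:R &
    forall u, L u -> exists n : 'I_k -> int, u = \sum_i (n i)%:~R *: b i /\
      forall i, (n i)%:~R ^+ 2 * nsq (b i) <= Cr * nsq u].
Proof.
elim: r => [|r [Cr Cr0 IH]].
  exists 0 => // d W L; rewrite leqn0 mxrank_eq0 => /eqP -> LW HL dL.
  exists 0%N, (fun _ => 0), (fun _ => 0); split => // [[]//|[]//|u Lu].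
  exists (fun=> 0); split; last by case.
  by rewrite big_ord0; apply/eqP; rewrite -submx0; apply: LW.
(* Lifting costs a factor 2 on the old coordinates. The new one is read off from [x] minus at most
   [r] lifted terms, which gives 2 + 4 r^2 Cr; the constant covers both. *)
exists (2 + (4 * r%:R ^+ 2 + 2) * Cr) => [|d W L rW LW HL dL].
  by rewrite addr_ge0 // mulr_ge0 // addr_ge0 // mulr_ge0 // exprn_ge0.
have [nz|z] := EM (exists2 u, L u & u != 0); last first.
  exists 0%N, (fun _ => 0), (fun _ => 0); split => // [[]//|[]//|u Lu].
  exists (fun=> 0); split; last by case.
  by rewrite big_ord0; apply: contrapT => /eqP u0; apply: z; exists u.
have [v1 [Lv1 v10 short]] := shortest_vector _ _ dL nz.
have N0 : 0 < nsq v1 by apply: nsq_gt0.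
pose p := perp d v1; pose pc := pcoef d v1.
pose L1 w := exists2 u, L u & w = p u.
have reduce u0 : L u0 -> exists u, [/\ L u, p u = p u0 & nsq u <= nsq (p u) + 4^-1 * nsq v1].
  move=> Lu0; pose s := Num.floor (pc u0 + 2^-1).
  exists (u0 - s%:~R *: v1); split; first by apply: HL.2 => //; apply: subgroup_int.
    by rewrite /p perpB ?perpZ perp_v1 // scaler0 subr0.
  rewrite (nsq_perp _ v1 v10) lerD2l ler_wpM2r ?(ltW N0) // -/pc.
  have -> : pc (u0 - s%:~R *: v1) = sfr (pc u0).
    by rewrite /pc pcoefD // -scaleN1r scalerA pcoefZ pcoef_v1 // mulr1 mulN1r.
  have := sfr_itv (pc u0); nra.
have HL1 : subgroup L1.
  split; first by exists 0; [case: HL|rewrite /p perp0].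
  move=> _ _ [u Lu ->] [v Lv ->]; exists (u - v); first exact: HL.2.
  by rewrite /p perpB.
have dL1 : discrete L1.
  move=> K; have [l Hl] := dL (K + 4^-1 * nsq v1); exists [seq p u | u <- l].
  move=> _ [u0 Lu0 ->]; have [u [Lu <- Hu]] := reduce u0 Lu0 => HK.
  by apply: map_f; apply: Hl => //; apply: le_trans Hu _; rewrite lerD2r.
pose W1 := (W :&: kermx (v1^T))%MS.
have LW1 w : L1 w -> (w <= W1)%MS.
  move=> [u Lu ->]; rewrite sub_capmx; apply/andP; split.
    rewrite /p /perp; apply: addmx_sub; first exact: LW.
    by rewrite -scaleNr; apply: scalemx_sub; apply: LW.
  by apply/sub_kermxP/eqP; rewrite row_dot /p dot_perp_v1.
have rW1 : (\rank W1 <= r)%N.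
  rewrite -ltnS; apply: leq_trans rW; apply: rank_ltmx.
  rewrite ltmxE capmxSl /=; apply/negP => /(submx_trans (LW _ Lv1)).
  rewrite sub_capmx => /andP[_ /sub_kermxP/eqP].
  by rewrite row_dot -/(nsq v1) gt_eqF.
have [k [w [D [kr Lw wD Hw]]]] := IH d W1 L1 rW1 LW1 HL1 dL1.
(* Minimality gives [nsq v1 <= nsq u] and reduction [nsq u <= nsq (w i) + nsq v1 / 4], so the ratio
   is at most 4/3. *)
have ex i : exists u, [/\ L u, p u = w i & nsq u <= 2 * nsq (w i)].
  have [u0 Lu0 wu0] := Lw i; have [u [Lu pu Hu]] := reduce u0 Lu0.
  exists u; split => //; first by rewrite pu.
  have wi0 : w i != 0.
    by apply/eqP => E; have := wD i i; rewrite E dot0l eqxx => /eqP; rewrite eq_sym oner_eq0.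
  have u_n0 : u != 0 by apply: contra wi0 => /eqP E; rewrite wu0 -pu E /p perp0.
  have := short _ Lu u_n0; have := nsq_ge0 _ (w i).
  by move: Hu; rewrite pu -wu0; lra.
have [u Hu] := fin_all_exists ex.
have pu i : p (u i) = w i by have [] := Hu i.
pose b (i : 'I_k.+1) := if unlift ord0 i is Some j then u j else v1.
(* The first term pairs to 1 with [v1] but to [pc (u i)] with [u i]; the correction cancels the
   latter and is orthogonal to [v1]. *)
pose D0 := (nsq v1)^-1 *: v1 - \sum_i pc (u i) *: p (D i).
pose D' (i : 'I_k.+1) := if unlift ord0 i is Some j then p (D j) else D0.
have b0 : b ord0 = v1 by rewrite /b unlift_none.
have bS j : b (lift ord0 j) = u j by rewrite /b liftK.
have uD i j : dot (u i) (p (D j)) = (i == j)%:R by rewrite /p -dot_perp -/p pu wD.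
have v1D j : dot v1 (p (D j)) = 0 by rewrite dotC dot_perp_v1.
exists k.+1, b, D'; split => //.
- by move=> i; rewrite /b; case: unliftP => [j _|_] //; have [] := Hu j.
- move=> i j; rewrite /b /D'; case: (unliftP ord0 i) => [i' ->|->]; case: (unliftP ord0 j) => [j' ->|->].
  + by rewrite uD (inj_eq lift_inj).
  + rewrite /D0 dotBr dotZr dot_sumr (bigD1 i') //= dotZr uD eqxx mulr1.
    rewrite big1 ?addr0; last by move=> l li; rewrite dotZr uD eq_sym (negbTE li) mulr0.
    by rewrite /pc /pcoef mulrC subrr.
  + by rewrite v1D.
  + rewrite /D0 dotBr dotZr dot_sumr big1 => [|l _]; last by rewrite dotZr v1D mulr0.
    by rewrite subr0 -/(nsq v1) eqxx mulVf // gt_eqF.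
move=> x Lx.
have [n [En Hn]] := Hw (p x) (ex_intro2 _ _ x Lx erefl).
pose y := x - \sum_i (n i)%:~R *: u i.
have Ly : L y.
  by apply: HL.2 => //; apply: subgroup_sum => // i; apply: subgroup_int => //; have [] := Hu i.
have py : p y = 0.
  rewrite /y /p perpB // perp_sum // -/p En; apply/eqP; rewrite subr_eq0; apply/eqP.
  by apply: eq_bigr => i _; rewrite -pu /p perpZ.
have [y' [Ly' py' Hy']] := reduce y Ly.
pose s := Num.floor (pc y + 2^-1).
have Ey : y = s%:~R *: v1.
  have yE : y = pc y *: v1 by move: py; rewrite /p /perp => /eqP; rewrite subr_eq0 => /eqP.
  (* [y] lies in [L] on the line of [v1]; a nonzero remainder modulo [v1] would be at most half as
     long as the shortest vector. *)
  apply/eqP; rewrite -subr_eq0; apply: contraT => ny.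
  have := short (y - s%:~R *: v1) (HL.2 _ _ Ly (subgroup_int _ _ _ s HL Lv1)) ny.
  rewrite {1}yE -scalerBl nsqZ -/(sfr (pc y)).
  have : sfr (pc y) ^+ 2 <= 4^-1 by have := sfr_itv (pc y); nra.
  by move=> /(ler_wpM2r (ltW N0)); move: N0; lra.
have nbd i : (n i)%:~R ^+ 2 * nsq (u i) <= 2 * Cr * nsq x.
  have [_ _ ui] := Hu i.
  apply: le_trans (_ : (n i)%:~R ^+ 2 * (2 * nsq (w i)) <= _).
    by rewrite ler_wpM2l // sqr_ge0.
  rewrite mulrCA -mulrA ler_wpM2l //; apply: le_trans (Hn i) _.
  by rewrite ler_wpM2l // (nsq_perp _ v1 v10 x) lerDl mulr_ge0 ?sqr_ge0 // ltW.
pose f (i : 'I_k.+1) := if unlift ord0 i is Some j then n j else s.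
have f0 : f ord0 = s by rewrite /f unlift_none.
have fS j : f (lift ord0 j) = n j by rewrite /f liftK.
exists f; split.
  rewrite big_ord_recl f0 b0 -Ey /y.
  rewrite -[LHS](subrK (\sum_i (n i)%:~R *: u i)); congr (_ + _).
  apply: eq_bigr => i _; symmetry.
  exact: (congr2 (fun (a : int) c => a%:~R *: c) (fS i) (bS i)).
move=> i; case: (unliftP ord0 i) => [j ->|->].
  rewrite fS bS; apply: le_trans (nbd j) _.
  have h : 0 <= 4 * r%:R ^+ 2 * Cr by rewrite !mulr_ge0 ?exprn_ge0.
  by rewrite ler_wpM2r ?nsq_ge0 //; move: h Cr0; lra.
rewrite f0 b0 -nsqZ -Ey /y -[X in nsq (_ + X)]sumrN.
apply: le_trans (nsqD_le _ _ _) _.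
rewrite [leRHS]mulrDl lerD2l.
apply: le_trans (_ : 2 * (r%:R * (r%:R * (2 * Cr * nsq x))) <= _); last first.
  have := mulr_ge0 Cr0 (nsq_ge0 _ x); lra.
rewrite ler_wpM2l //; apply: le_trans (nsq_sum_le _ _ _) _.
have kr' : k%:R <= r%:R :> R by rewrite ler_nat.
have S0 : 0 <= 2 * Cr * nsq x by rewrite !mulr_ge0 ?nsq_ge0.
apply: ler_pM => //; first by apply: sumr_ge0 => i' _; apply: nsq_ge0.
apply: le_trans (_ : \sum_(i' < k) (2 * Cr * nsq x) <= _).
  by apply: ler_sum => i' _; rewrite -scaleNr nsqZ sqrrN.
by rewrite sumr_const card_ord -[_ *+ k]mulr_natl ler_wpM2r.
Qed.

(** * Bohr sets as generalized arithmetic progressions *)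

Section BohrCoordinates.
Variables (m d : nat).
Notation G := 'I_m.+2.
Notation M := (m.+2%:R : R).
Variable s : 'I_d.+1 -> G.

Definition bvec (x : G) (j : 'I_d.+1) : R := sfr ((nat_of_ord (s j * x)%R)%:R / M).

Lemma bvec_circ x j : `|bvec x j| = circ m (s j * x). Proof. by []. Qed.

(** A proper progression between two Bohr sets: [bc_box] is properness, [bc_small] and [bc_bohr] are
    the two inclusions, the second at every scale [tau]. The generators are integers and not
    residues, because the quadratic form built from them is divided by [M] in the reals. *)
Record bohr_coordinates (rho rho' : R) := BohrCoordinates {
  bc_k : nat;
  bc_h : 'I_bc_k -> int;
  bc_L : 'I_bc_k -> R;
  bc_D : 'I_bc_k -> 'I_d.+1 -> R;
  bc_n : G -> 'I_bc_k -> int;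
  bc_rank : (bc_k <= d.+1)%N;
  bc_L_gt0 : forall i, 0 < bc_L i;
  bc_linear : forall x i, (bc_n x i)%:~R = \sum_j bc_D i j * bvec x j;
  bc_lift : forall x, M * bvec x ord0 = \sum_i (bc_n x i)%:~R * (bc_h i)%:~R;
  bc_box : forall z : 'I_bc_k -> int, (forall i, `|(z i)%:~R| <= bc_L i) ->
     forall i, bc_n (\sum_i (z i * bc_h i)%:~R) i = z i;
  bc_small : forall x, (forall i, `|(bc_n x i)%:~R| <= bc_L i) ->
     forall j, `|bvec x j| <= rho;
  bc_bohr : forall (tau : R) x, 0 <= tau -> (forall j, `|bvec x j| <= tau * rho') ->
     forall i, `|(bc_n x i)%:~R| <= tau * bc_L i
}.

Lemma lift_eqmod (x : G) (a : int) : x = a%:~R -> exists k : int,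
  (x : nat)%:R / M = a%:~R / M + k%:~R :> R.
Proof. by move=> ->; have [k ->] := lift_int m a; exists (- k); rewrite intrN. Qed.

(** The lattice generated by the integer vectors and the vector of the s_j / M; its short vectors
    come from the points of the Bohr set. *)
Definition blattice (u : 'rV[R]_d.+1) : Prop := exists h : int, forall j, exists k : int,
  u 0 j = (((s j : nat) : int) * h)%:~R / M + k%:~R.

Lemma blattice_bvec x : blattice (\row_j bvec x j).
Proof.
exists ((x : nat) : int) => j; rewrite mxE /bvec.
have [k1 ->] := sfr_int ((nat_of_ord (s j * x)%R)%:R / M).
have [|k2 ->] := lift_eqmod (s j * x) (((s j : nat) : int) * ((x : nat) : int)).
  by rewrite intrM !intr_ord.
by exists (k2 - k1); rewrite intrB addrA.
Qed.

Lemma blattice_subgroup : subgroup blattice.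
Proof.
split; first by exists 0 => j; exists 0; rewrite mxE mulr0 mul0r addr0.
move=> u v [h Hh] [h' Hh']; exists (h - h') => j.
have [k Hk] := Hh j; have [k' Hk'] := Hh' j.
by exists (k - k'); rewrite !mxE Hk Hk' mulrBr !intrB; ring.
Qed.

Lemma blattice_discrete : discrete blattice.
Proof.
move=> K; have Mp := modulus_gt0 m.
pose B := Num.bound (M * (`|K| + 1)).
exists [seq (\row_j ((((f j : nat) : int) - (B : int))%:~R / M)) | f : {ffun 'I_d.+1 -> 'I_(2 * B).+1}].
move=> u [h Hu] uK; apply/mapP.
have ex j : exists a : 'I_(2 * B).+1, u 0 j = ((((a : nat) : int) - (B : int))%:~R / M).
  have [k Hk] := Hu j; pose z := ((s j : nat) : int) * h + k * m.+2.
  have uz : u 0 j = z%:~R / M.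
    by rewrite Hk /z intrD mulrDl [(k * _)%:~R]intrM -pmulrn mulfK // gt_eqF.
  have zB : `|z| <= (B : int).
    rewrite -(ler_int R) intr_norm; apply: le_trans (_ : M * (`|K| + 1) <= _).
      have -> : z%:~R = M * u 0 j by rewrite uz mulrC divfK // gt_eqF.
      rewrite normrM (gtr0_norm Mp) ler_wpM2l ?(ltW Mp) //.
      have := sqr_coord_le _ u j; have := ler_norm K; rewrite -(real_normK (num_real (u 0 j))).
      have := normr_ge0 (u 0 j); move: uK; nra.
    by apply/ltW/archi_boundP; rewrite mulr_ge0 ?(ltW Mp) // addr_ge0.
  have H1 : (absz (z + (B : int))%R < (2 * B).+1)%N by move: zB; lia.
  exists (Ordinal H1); rewrite uz /=; congr (_%:~R / _); move: zB; lia.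
have [f Hf] := fin_all_exists ex.
exists [ffun j => f j]; first by rewrite mem_enum.
by apply/rowP => j; rewrite mxE ffunE.
Qed.

End BohrCoordinates.

(** The side lengths are rho / (d + 1) divided by the lengths of the reduced basis vectors, so that
    a combination within the box has length at most [rho]. Conversely the bound on coordinates in a
    reduced basis places a small Bohr set inside the box. [rho'] depends only on [d] and [rho], not
    on the modulus. *)
Theorem bohr_coordinates_exist (d : nat) (rho : R) : 0 < rho -> rho < 2^-1 ->
  exists2 rho' : R, 0 < rho' & forall (m : nat) (s : 'I_d.+1 -> 'I_m.+2), s ord0 = 1 ->
    inhabited (bohr_coordinates m d s rho rho').
Proof.
move=> rho0 rho_half; have [Cr Cr0 basis] := reduced_basis d.+1.
pose rho1 := rho / d.+1%:R; have d0 : 0 < d.+1%:R :> R by rewrite ltr0n.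
have rho10 : 0 < rho1 by rewrite divr_gt0.
have C10 : 0 < (Cr + 1) * d.+1%:R by rewrite mulr_gt0 // ltr_pwDr.
exists (rho1 / ((Cr + 1) * d.+1%:R)); first by rewrite divr_gt0.
move=> m s s0; have Mp := modulus_gt0 m.
have rk1 : (\rank (1%:M : 'M[R]_d.+1) <= d.+1)%N by rewrite mxrank1.
have sub1 u : blattice m d s u -> (u <= (1%:M : 'M[R]_d.+1))%MS by rewrite submx1.
have [k [b [D [kd Lb bD Hn]]]] :=
  basis _ _ _ rk1 sub1 (blattice_subgroup m d s) (blattice_discrete m d s).
have b_gt0 i : 0 < nsq (b i).
  apply: nsq_gt0; apply/eqP => E; have := bD i i.
  by rewrite E dot0l eqxx => /eqP; rewrite eq_sym oner_eq0.
pose nb i := Num.sqrt (nsq (b i)).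
have nb0 i : 0 < nb i by rewrite sqrtr_gt0.
have nbE i : nb i ^+ 2 = nsq (b i) by rewrite sqr_sqrtr // nsq_ge0.
have [n HnL] := fin_all_exists (fun x => Hn _ (blattice_bvec m d s x)).
have nE x : \row_j bvec m d s x j = \sum_i (n x i)%:~R *: b i by case: (HnL x).
have [h Hh] := fin_all_exists Lb.
(* As [s ord0 = 1], the leading entry of [b i] times the modulus is an integer congruent to [h i].
   Taking it as generator makes [bc_lift] an identity of reals instead of a congruence. *)
have exh i : exists c : int, m.+2%:R * b i 0 ord0 = c%:~R /\ (c%:~R : 'I_m.+2) = (h i)%:~R.
  have [c Hc] := Hh i ord0; rewrite s0 mul1r in Hc.
  exists (h i + c * m.+2); split.
    rewrite Hc mulrDr mulrC divfK ?gt_eqF // intrD intrM -!pmulrn; congr (_ + _); exact: mulrC.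
  rewrite intrD intrM -[X in _ * X]pmulrn.
  have -> : m.+2%:R = 0 :> 'I_m.+2 by rewrite Zp_nat; apply/val_inj; rewrite /= modnn.
  by rewrite mulr0 addr0.
have [hh Hhh] := fin_all_exists exh.
have dotn x i : (n x i)%:~R = dot (\row_j bvec m d s x j) (D i).
  rewrite nE dot_suml (bigD1 i) //= dotZl bD eqxx mulr1 big1 ?addr0 // => l li.
  by rewrite dotZl bD (negbTE li) mulr0.
pose L i := rho1 / nb i.
have L0 i : 0 < L i by rewrite divr_gt0.
have small (z : 'I_k -> int) : (forall i, `|(z i)%:~R| <= L i) ->
   forall j, `|(\sum_i (z i)%:~R *: b i) 0 j| <= rho.
  move=> zL j; rewrite -(@ler_pXn2r _ 2) ?nnegrE ?(ltW rho0) // real_normK ?num_real //.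
  apply: le_trans (sqr_coord_le _ _ _) _; apply: le_trans (nsq_sum_le _ _ _) _.
  have -> : rho ^+ 2 = d.+1%:R * (d.+1%:R * rho1 ^+ 2).
    by rewrite /rho1; move: (d.+1%:R : R) d0 => t t0; field; rewrite gt_eqF.
  have kd' : k%:R <= d.+1%:R :> R by rewrite ler_nat.
  apply: ler_pM => //; first by apply: sumr_ge0 => i _; apply: nsq_ge0.
  apply: le_trans (_ : \sum_(i < k) rho1 ^+ 2 <= _).
    apply: ler_sum => i _; rewrite nsqZ -nbE -exprMn -(real_normK (num_real (_ * _))).
    rewrite lerXn2r ?nnegrE ?(ltW rho10) // normrM (gtr0_norm (nb0 i)) -ler_pdivlMr //.
  by rewrite sumr_const card_ord -[_ *+ k]mulr_natl ler_wpM2r // exprn_ge0 // ltW.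
constructor.
apply: (@BohrCoordinates m d s _ _ k hh L (fun i j => D i 0 j) n) => //.
- move=> x i; rewrite dotn /dot; apply: eq_bigr => j _; by rewrite mxE mulrC.
- move=> x; have := congr1 (fun u : 'rV[R]_d.+1 => u 0 ord0) (nE x); rewrite mxE => ->.
  rewrite summxE mulr_sumr; apply: eq_bigr => i _.
  by rewrite mxE mulrCA; case: (Hhh i) => ->.
- move=> z zL i; apply: (@intr_inj R); rewrite dotn.
  suff -> : \row_j bvec m d s (\sum_i (z i * hh i)%:~R) j = \sum_i (z i)%:~R *: b i.
    rewrite dot_suml (bigD1 i) //= dotZl bD eqxx mulr1 big1 ?addr0 // => l li.
    by rewrite dotZl bD (negbTE li) mulr0.
  apply/rowP => j; rewrite mxE /bvec.
  have [c Hc] := fin_all_exists (fun i => Hh i j).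
  have [|k2 ->] := lift_eqmod m (s j * (\sum_i (z i * hh i)%:~R)) (\sum_i z i * (((s j : nat) : int) * h i)).
    rewrite mulr_sumr rmorph_sum; apply: eq_bigr => l _.
    by rewrite /= !intrM intr_ord; case: (Hhh l) => _ ->; ring.
  (* Since [rho < 1/2], the lattice vector itself is the vector of signed fractional parts; this
     gives properness. *)
  apply: (@sfr_uniq _ _ (k2 - \sum_l z l * c l)).
    by have := small z zL j; rewrite ler_norml; move: rho_half; lra.
  rewrite summxE intrB addrA addrAC; congr (_ + _).
  rewrite !rmorph_sum mulr_suml -sumrB; apply: eq_bigr => l _.
  by rewrite mxE Hc !intrM; ring.
- move=> x xL j; have := small _ xL j; by rewrite -nE mxE.
move=> tau x tau0 Hx i; have [_ /(_ i) Hi] := HnL x.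
have tL : 0 <= tau * L i by apply: mulr_ge0 => //; apply: ltW.
rewrite -(@ler_pXn2r _ 2) ?nnegrE // real_normK ?num_real //.
rewrite /L mulrA expr_div_n ler_pdivlMr ?exprn_gt0 // nbE; apply: le_trans Hi _.
apply: le_trans (_ : Cr * (d.+1%:R * (tau * (rho1 / ((Cr + 1) * d.+1%:R))) ^+ 2) <= _).
  rewrite ler_wpM2l // /nsq /dot.
  apply: le_trans (_ : \sum_(j < d.+1) (tau * (rho1 / ((Cr + 1) * d.+1%:R))) ^+ 2 <= _).
    apply: ler_sum => j _; rewrite mxE -expr2 -(real_normK (num_real (bvec _ _ _ _ _))).
    by rewrite lerXn2r ?nnegrE ?(le_trans (normr_ge0 _) (Hx j)).
  by rewrite sumr_const card_ord -[_ *+ d.+1]mulr_natl.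
have -> : Cr * (d.+1%:R * (tau * (rho1 / ((Cr + 1) * d.+1%:R))) ^+ 2) =
  (tau * rho1) ^+ 2 * (Cr / ((Cr + 1) ^+ 2 * d.+1%:R)).
  by move: (d.+1%:R : R) d0 C10 => t t0 C10; field; rewrite !gt_eqF // ltr_pwDr.
rewrite ler_piMr ?sqr_ge0 // ler_pdivrMr ?mul1r; last by rewrite mulr_gt0 // exprn_gt0 // ltr_pwDr.
have : 1 <= d.+1%:R :> R by rewrite ler1n.
move: (d.+1%:R : R) => t; rewrite expr2; nra.
Qed.

(** * Symmetry of the frequencies *)

Section Box.
Variables (m d : nat) (s : 'I_d.+1 -> 'I_m.+2) (rho rho' : R).
Variable bc : bohr_coordinates m d s rho rho'.
Hypothesis s0 : s ord0 = 1.
Notation G := 'I_m.+2.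
Notation M := (m.+2%:R : R).
Notation k := (bc_k m d s rho rho' bc).
Notation n := (bc_n m d s rho rho' bc).
Notation h := (bc_h m d s rho rho' bc).
Notation L := (bc_L m d s rho rho' bc).

Definition box (t : R) : {set G} := [set x | [forall i, `|(n x i)%:~R| <= t * L i]].

Lemma boxP (t : R) x : reflect (forall i, `|(n x i)%:~R| <= t * L i) (x \in box t).
Proof. by rewrite inE; apply: forallP. Qed.

Lemma L_gt0 i : 0 < L i. Proof. exact: bc_L_gt0. Qed.

Lemma box_mono (t t' : R) x : t <= t' -> x \in box t -> x \in box t'.
Proof.
move=> tt /boxP H; apply/boxP => i; apply: le_trans (H i) _.
by rewrite ler_wpM2r // ltW // L_gt0.
Qed.

Lemma coords_repr x : x = \sum_i (n x i * h i)%:~R.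
Proof.
have := bc_lift _ _ _ _ _ bc x; rewrite /bvec s0 mul1r.
have [c ->] := sfr_int ((x : nat)%:R / M).
rewrite mulrBr mulrC divfK ?modulus_neq0 // => E.
have {}E : ((x : nat) : int) - (m.+2 : int) * c = \sum_i n x i * h i.
  apply: (@intr_inj R); rewrite intrB intrM -!pmulrn E rmorph_sum.
  by apply: eq_bigr => i _; rewrite /= intrM.
have := congr1 (fun z : int => z%:~R : G) E.
rewrite intrB intrM -[X in _ - X * _]pmulrn.
have -> : m.+2%:R = 0 :> G by rewrite Zp_nat; apply/val_inj; rewrite /= modnn.
by rewrite mul0r subr0 intr_ord rmorph_sum.
Qed.

Lemma coordsD x y : (forall i, `|(n x i + n y i)%:~R| <= L i) ->
  forall i, n (x + y) i = n x i + n y i.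
Proof.
move=> H i; rewrite -(bc_box _ _ _ _ _ bc (fun i => n x i + n y i) H i).
congr (n _ i); rewrite {1}(coords_repr x) {1}(coords_repr y) -big_split.
by apply: eq_bigr => l _; rewrite mulrDl intrD.
Qed.

Lemma coordsB x y : (forall i, `|(n x i - n y i)%:~R| <= L i) ->
  forall i, n (x - y) i = n x i - n y i.
Proof.
move=> H i; rewrite -(bc_box _ _ _ _ _ bc (fun i => n x i - n y i) H i).
congr (n _ i); rewrite {1}(coords_repr x) {1}(coords_repr y) -sumrB.
by apply: eq_bigr => l _; rewrite mulrBl intrB.
Qed.

Lemma coords_shift x (t : int) j :
  (forall i, `|(n x i + t * (i == j)%:R)%:~R| <= L i) ->
  forall i, n (x + t%:~R * (h j)%:~R) i = n x i + t * (i == j)%:R.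
Proof.
move=> H i; rewrite -(bc_box _ _ _ _ _ bc (fun i => n x i + t * (i == j)%:R) H i).
congr (n _ i); rewrite {1}(coords_repr x).
transitivity (\sum_i (n x i * h i)%:~R + \sum_i (t * (i == j)%:R * h i)%:~R : G).
  congr (_ + _); rewrite (bigD1 j) //= big1 ?addr0.
    by rewrite eqxx mulr1 intrM.
  by move=> l lj; rewrite (negbTE lj) mulr0 mul0r.
by rewrite -big_split; apply: eq_bigr => l _; rewrite mulrDl intrD.
Qed.

Lemma coords0 i : n 0 i = 0.
Proof.
have := coordsB 0 0; rewrite subrr => H; rewrite H ?subrr // => j.
by rewrite subrr normr0 ltW // L_gt0.
Qed.

Lemma coords_gen j : 1 <= L j -> forall i, n (h j)%:~R i = (i == j)%:R.
Proof.
move=> L1 i; have := coords_shift 0 1 j; rewrite mul1r add0r => ->.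
  by rewrite coords0 add0r mul1r.
move=> l; rewrite coords0 add0r mul1r; case: eqP => [->|_].
  by rewrite mulr1z normr1.
by rewrite mulr0z normr0 ltW // L_gt0.
Qed.

Lemma box_sub (t t' : R) x y : t + t' <= 1 -> x \in box t -> y \in box t' ->
  (x - y \in box (t + t')) /\ forall i, n (x - y) i = n x i - n y i.
Proof.
move=> tt /boxP xb /boxP yb.
have H i : `|(n x i - n y i)%:~R : R| <= (t + t') * L i.
  by rewrite intrB mulrDl; apply: le_trans (ler_normB _ _) _; rewrite lerD.
have E := coordsB x y (fun i => le_trans (H i) (ler_piMl (ltW (L_gt0 i)) tt)).
by split => //; apply/boxP => i; rewrite E.
Qed.

Lemma box_add (t t' : R) x y : t + t' <= 1 -> x \in box t -> y \in box t' ->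
  (x + y \in box (t + t')) /\ forall i, n (x + y) i = n x i + n y i.
Proof.
move=> tt /boxP xb /boxP yb.
have H i : `|(n x i + n y i)%:~R : R| <= (t + t') * L i.
  by rewrite intrD mulrDl; apply: le_trans (ler_normD _ _) _; rewrite lerD.
have E := coordsD x y (fun i => le_trans (H i) (ler_piMl (ltW (L_gt0 i)) tt)).
by split => //; apply/boxP => i; rewrite E.
Qed.

Variable phi : G -> G.
Hypothesis phi_add : forall x y, x \in box 1 -> y \in box 1 -> x + y \in box 1 ->
  phi (x + y) = phi x + phi y.

Definition slope (i : 'I_k) : int := ((phi (h i)%:~R : nat) : int).

Lemma zero_in_box : 0 \in box 1.
Proof. by apply/boxP => i; rewrite coords0 normr0 mul1r ltW // L_gt0. Qed.

Lemma phi0 : phi 0 = 0.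
Proof.
have := phi_add 0 0 zero_in_box zero_in_box; rewrite addr0 => /(_ zero_in_box) /eqP.
by rewrite -subr_eq0 opprD addrA subrr sub0r oppr_eq0 => /eqP.
Qed.

(** Induction on the l1 norm of the coordinates: one generator is removed towards zero, which stays
    in the box. A nonzero coordinate forces [1 <= L j], so the generator is itself in the box and
    additivity applies. *)
Lemma phi_linear x : x \in box 1 -> phi x = \sum_i (n x i * slope i)%:~R.
Proof.
have [N] := ubnP (\sum_i absz (n x i))%N; elim: N x => // N IH x ltN /boxP xb.
have [/forallP z|/forallPn[j nz]] := boolP [forall i, n x i == 0].
  have -> : x = 0.
    by rewrite (coords_repr x) big1 // => i _; rewrite (eqP (z i)) mul0r.
  by rewrite phi0 big1 // => i _; rewrite coords0 mul0r.
have Lj : 1 <= L j.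
  apply: le_trans (_ : `|(n x j)%:~R| <= _); last by have := xb j; rewrite mul1r.
  by rewrite -intr_norm ler1z; move: nz; lia.
have hb : (h j)%:~R \in box 1.
  apply/boxP => i; rewrite coords_gen // mul1r; case: eqP => [->|_].
    by rewrite mulr1z normr1.
  by rewrite mulr0z normr0 ltW // L_gt0.
pose sg : int := if 0 < n x j then 1 else -1.
pose y := x + (- sg)%:~R * (h j)%:~R.
have yL i : `|(n x i + (- sg) * (i == j)%:R)%:~R : R| <= `|(n x i)%:~R|.
  rewrite -!intr_norm ler_int; case: eqP => [->|_]; last by rewrite mulr0 addr0.
  by rewrite /sg; case: ltP nz; lia.
have yn : forall i, n y i = n x i + (- sg) * (i == j)%:R.
  by apply: coords_shift => i; apply: le_trans (yL i) _; have := xb i; rewrite mul1r.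
have yb : y \in box 1.
  by apply/boxP => i; rewrite yn; apply: le_trans (yL i) _; apply: xb.
have yN : (\sum_i absz (n y i) < N)%N.
  rewrite -ltnS; apply: leq_trans ltN; rewrite ltnS (bigD1 j) //= [X in (_ < X)%N](bigD1 j) //=.
  rewrite (eq_bigr (fun i => absz (n x i))).
    rewrite ltn_add2r yn eqxx mulr1 /sg; case: ltP nz; lia.
  by move=> i ij; rewrite yn (negbTE ij) mulr0 addr0.
have E : phi x = phi y + sg%:~R * phi (h j)%:~R.
  have xE : x = y + sg%:~R * (h j)%:~R by rewrite /y intrN mulNr subrK.
  (* For a negative coordinate additivity is applied to [y = x + h j], which involves the generator
     and not its negative. *)
  move: xE yb; rewrite /sg; case: ifP => _ xE yb.
    by rewrite !mul1r in xE *; rewrite {1}xE; apply: phi_add => //; rewrite -xE; apply/boxP.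
  rewrite !mulN1r in xE *.
  have -> : phi y = phi x + phi (h j)%:~R.
    have yE : y = x + (h j)%:~R by rewrite xE subrK.
    by rewrite {1}yE; apply: phi_add => //; [apply/boxP | rewrite -yE].
  by rewrite addrK.
rewrite E IH // (bigD1 j) //= [in RHS](bigD1 j) //= addrAC; congr (_ + _).
  have slopeE : (slope j)%:~R = phi (h j)%:~R by apply: intr_ord.
  by rewrite yn eqxx mulr1 !intrM slopeE intrD !intrN; ring.
by apply: eq_bigr => i ij; rewrite yn (negbTE ij) mulr0 addr0.
Qed.

Lemma phi_sub (t t' : R) x y : t + t' <= 1 -> 0 <= t -> 0 <= t' -> x \in box t -> y \in box t' ->
  phi (x - y) = phi x - phi y.
Proof.
move=> tt t0 t'0 xb yb; have [xyb xyn] := box_sub t t' x y tt xb yb.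
rewrite !phi_linear; try by [apply: box_mono xyb|apply: box_mono xb; lra|apply: box_mono yb; lra].
by rewrite -sumrB; apply: eq_bigr => i _; rewrite xyn mulrBl intrB.
Qed.

Lemma phi_sum (t t' : R) x y : t + t' <= 1 -> 0 <= t -> 0 <= t' -> x \in box t -> y \in box t' ->
  phi (x + y) = phi x + phi y.
Proof.
move=> tt t0 t'0 xb yb; have [xyb xyn] := box_add t t' x y tt xb yb.
by apply: phi_add; [apply: box_mono xb|apply: box_mono yb|apply: box_mono xyb]; lra.
Qed.

(** Fix [z = h2 + h3] and put [u = h1], [v = h3], both relative to [h0]. On the support of [c] the
    map [xi] is affine, so the quadruple condition is automatic and the phase is -(phi w - phi u -
    phi v)(u - v). Its mixed part is phi(v) u - phi(u) v; the rest depends on one variable and goes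
    into [C1] and [C2]. *)
Lemma symmetric_form_large (c : G -> C) (xi : G -> G) (h0 xi0 : G) (eta : R) :
  (forall x, nrm (c x) <= 1) ->
  (forall x, c x != 0 -> x - h0 \in box 4^-1 /\ xi x = xi0 + phi (x - h0)) ->
  eta * M ^+ 3 <= nrm (\sum_h1 \sum_h2 \sum_h3
    (xi h1 + xi (h2 + h3 - h1) == xi h2 + xi h3)%:R *
     (c h1 * (c h2)^* * (c h3)^* * c (h2 + h3 - h1) *
     psi m (- ((xi (h2 + h3 - h1) - xi h3) * (h1 - h3))))) ->
  exists C1 C2 : G -> C, [/\ forall x, nrm (C1 x) <= 1, forall x, nrm (C2 x) <= 1 &
    eta * M ^+ 2 <= nrm (\sum_(u in box 4^-1) \sum_(v in box 4^-1)
       C1 u * C2 v * psi m (phi v * u - phi u * v))].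
Proof.
move=> c1 cH; have Mp := modulus_gt0 m.
pose f z u v : C := (xi u + xi (z - u) == xi (z - v) + xi v)%:R *
  (c u * (c (z - v))^* * (c v)^* * c (z - u) * psi m (- ((xi (z - u) - xi v) * (u - v)))).
have -> : \sum_h1 \sum_h2 \sum_h3
    (xi h1 + xi (h2 + h3 - h1) == xi h2 + xi h3)%:R *
     (c h1 * (c h2)^* * (c h3)^* * c (h2 + h3 - h1) *
     psi m (- ((xi (h2 + h3 - h1) - xi h3) * (h1 - h3)))) = \sum_z \sum_u \sum_v f z u v.
  rewrite [RHS]exchange_big; apply: eq_bigr => u _ /=.
  rewrite exchange_big [RHS]exchange_big; apply: eq_bigr => v _ /=.
  rewrite (reindex_inj (addIr (- v))) /=; apply: eq_bigr => z _.
  by rewrite /f subrK.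
move=> HS.
have [z Hz] : exists z, eta * M ^+ 2 <= nrm (\sum_u \sum_v f z u v).
  apply/existsP; apply: contraLR HS => /existsPn H; rewrite -ltNge.
  apply: le_lt_trans (ler_nrm_sum _ _ _ _) _.
  apply: lt_le_trans (_ : \sum_(z : G) eta * M ^+ 2 <= _).
    by apply: ltr_sum => [|z _]; [apply/hasP; exists 0; rewrite ?mem_index_enum | rewrite ltNge H].
  by rewrite sumr_const card_ord -[_ *+ m.+2]mulr_natl; apply: le_of_eq; ring.
pose w := z - h0 - h0.
exists (fun u => c (h0 + u) * c (z - (h0 + u)) * psi m (- (phi w * u) + phi u * u)),
  (fun v => (c (h0 + v))^* * (c (z - (h0 + v)))^* * psi m (phi w * v - phi v * v)).
split=> [x|x|].
- by rewrite !nrmM nrm_psi mulr1 mulr_ile1 ?nrm_ge0.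
- by rewrite !nrmM nrm_psi mulr1 !nrmJ mulr_ile1 ?nrm_ge0.
apply: le_trans Hz _; apply: le_of_eq; congr nrm.
rewrite (reindex_inj (addrI h0)) /= [RHS]big_mkcond /=; apply: eq_bigr => u _.
have [cu|cu] := eqVneq (c (h0 + u)) 0.
  rewrite big1 => [|v _]; last by rewrite /f cu !mul0r mulr0.
  by case: ifP => // _; rewrite big1 // => v _; rewrite cu !mul0r.
have [] := cH _ cu; rewrite addrAC subrr add0r => ub xiu.
rewrite ub (reindex_inj (addrI h0)) /= [RHS]big_mkcond /=; apply: eq_bigr => v _.
have [cv|cv] := eqVneq (c (h0 + v)) 0.
  by rewrite /f cv rmorph0; case: ifP => _; rewrite !(mul0r, mulr0).
have [] := cH _ cv; rewrite addrAC subrr add0r => vb xiv.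
rewrite vb /f.
have [cu'|cu'] := eqVneq (c (z - (h0 + u))) 0; first by rewrite cu' !(mul0r, mulr0).
have [cv'|cv'] := eqVneq (c (z - (h0 + v))) 0; first by rewrite cv' rmorph0 !(mul0r, mulr0).
have [ub' xiu'] := cH _ cu'; have [vb' xiv'] := cH _ cv'.
have q : 4^-1 + 4^-1 <= 1 :> R by lra.
have q0 : 0 <= 4^-1 :> R by lra.
have wu : phi w = phi (z - (h0 + u) - h0) + phi u.
  by rewrite -(phi_sum _ _ _ _ q q0 q0 ub' ub); congr phi; rewrite /w; ring.
have wv : phi w = phi (z - (h0 + v) - h0) + phi v.
  by rewrite -(phi_sum _ _ _ _ q q0 q0 vb' vb); congr phi; rewrite /w; ring.
have {}xiu' : xi (z - (h0 + u)) = xi0 + phi w - phi u by rewrite xiu' wu; ring.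
have {}xiv' : xi (z - (h0 + v)) = xi0 + phi w - phi v by rewrite xiv' wv; ring.
rewrite xiu xiv xiu' xiv'.
have -> : (xi0 + phi u + (xi0 + phi w - phi u) == xi0 + phi w - phi v + (xi0 + phi v)).
  by apply/eqP; ring.
rewrite mul1r.
set a := psi m _; set b := psi m (_ + _); set b' := psi m (_ - _ * _ ); set a' := psi m _.
suff -> : a = b * b' * a' by ring.
by rewrite /a /b /b' /a' -!psiD; congr (psi m _); ring.
Qed.
Definition alt (i j : 'I_k) : G := (slope j)%:~R * (h i)%:~R - (slope i)%:~R * (h j)%:~R.

(** The [2 * l + 1] translates of the slice along [h j] that bring its j-th coordinate to the values
    -l, ..., l are disjoint. *)
Lemma level_card (a : int) j (l : nat) : `|a| <= l%:Z -> l%:R <= 4^-1 * L j ->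
  #|[set v in box 4^-1 | n v j == a]|%:R * (2 * l + 1)%:R <= M.
Proof.
move=> al lL; rewrite -natrM ler_nat -[X in (_ <= X)%N](card_ord m.+2) -cardsT.
have L0 i := L_gt0 i.
have cn (v : G) (t : 'I_(2 * l + 1)) : v \in [set v in box 4^-1 | n v j == a] ->
   forall i, n (v + (((t : nat) : int) - l%:Z - a)%:~R * (h j)%:~R) i =
     n v i + (((t : nat) : int) - l%:Z - a) * (i == j)%:R.
  rewrite inE => /andP[/boxP vb /eqP va]; apply: coords_shift => i; case: eqP => [->|_].
    rewrite mulr1 va -intr_norm.
    have : `|a + (((t : nat) : int) - l%:Z - a)| <= l%:Z by have := ltn_ord t; lia.
    rewrite -(ler_int R) => /le_trans; apply; rewrite -pmulrn; have := L0 j; lra.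
  by rewrite mulr0 addr0; have := vb i; have := L0 i; lra.
rewrite -[(2 * l + 1)%N]card_ord -cardsT -cardsX.
apply: (card_le_inj _ _ (fun vt : G * 'I_(2 * l + 1) =>
   vt.1 + (((vt.2 : nat) : int) - l%:Z - a)%:~R * (h j)%:~R)) => [|vt _]; last by rewrite inE.
move=> [v t] [v' t']; rewrite !in_setX !in_setT !andbT /= => vE v'E E.
have tt' : t = t'.
  have := congr1 (fun x => n x j) E; rewrite /= cn // cn // eqxx !mulr1.
  by move: vE v'E; rewrite !inE => /andP[_ /eqP ->] /andP[_ /eqP ->]; move=> ?; apply/val_inj => /=; lia.
by move: E; rewrite tt' => /addIr ->.
Qed.

(** Shifting the box by [h j] multiplies the summand by a constant [psi theta] and exchanges only
    the two extreme slices. Hence [(psi theta - 1) * T] is bounded by two slices, which are small by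
    [level_card]. *)
Lemma character_sum_on_box (d1 delta : G) (eta : R) j : 0 < eta -> eta <= 1 ->
  eta * M <= nrm (\sum_(v in box 4^-1) psi m (phi v * d1 - delta * v)) ->
  circ m (phi (h j)%:~R * d1 - delta * (h j)%:~R) <= 8 / (eta * L j).
Proof.
move=> e0 e1 HT; have Mp := modulus_gt0 m; have Lj := L_gt0 j.
have eL : 0 < eta * L j by rewrite mulr_gt0.
(* For a short side the asserted bound exceeds 2 and is trivial. *)
have [L4|L4] := ltP (L j) 4.
  apply: le_trans (nint_le_half _) _; rewrite ler_pdivlMr //; nra.
set theta := phi _ * _ - _.
have [l /andP[l1 l2]] : exists l : nat, l%:R <= 4^-1 * L j < l.+1%:R.
  by exists (Num.truncn (4^-1 * L j)); apply: Num.Theory.truncn_itv; lra.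
have Lp i := L_gt0 i.
have nl v : v \in box 4^-1 -> `|n v j| <= l%:Z.
  move=> /boxP /(_ j) H; have : `|n v j| < l.+1%:Z.
    by rewrite -(ltr_int R) intr_norm; apply: le_lt_trans H _; rewrite -pmulrn.
  by rewrite intS addrC ltzD1.
have step (sg : int) v : `|sg| = 1 -> v \in box 4^-1 -> n v j != sg * l%:Z ->
    (v + sg%:~R * (h j)%:~R \in box 4^-1) /\
    forall i, n (v + sg%:~R * (h j)%:~R) i = n v i + sg * (i == j)%:R.
  move=> sg1 vb vl; have vl' := nl v vb.
  have H i : `|(n v i + sg * (i == j)%:R)%:~R : R| <= 4^-1 * L i.
    case: eqP => [->|_]; last by rewrite mulr0 addr0; apply/boxP.
    rewrite mulr1 -intr_norm; apply: le_trans l1.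
    rewrite [l%:R]pmulrn ler_int; move: (n v j) vl vl' sg1; clear; nia.
  have E : forall i, n (v + sg%:~R * (h j)%:~R) i = n v i + sg * (i == j)%:R.
    by apply: coords_shift => i; have := H i; have := Lp i; lra.
  by split => //; apply/boxP => i; rewrite E.
have hj : (h j)%:~R \in box 4^-1.
  apply/boxP => i; rewrite coords_gen; last lra.
  case: eqP => [->|_]; first by rewrite mulr1z normr1; lra.
  by rewrite mulr0z normr0; have := Lp i; lra.
pose ell v := psi m (phi v * d1 - delta * v).
have shift : (\sum_(v in box 4^-1 | n v j != l%:Z) ell v) * psi m theta =
    \sum_(v in box 4^-1 | n v j != - l%:Z) ell v.
  rewrite [RHS](reindex_inj (addIr (h j)%:~R)) /= mulr_suml.
  apply: eq_big => [v|v /andP[vb vl]]; last first.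
    have q4 : 4^-1 + 4^-1 <= 1 :> R by lra.
    have q0 : 0 <= 4^-1 :> R by lra.
    rewrite /ell /theta -psiD (phi_sum _ _ _ _ q4 q0 q0 vb hj).
    by congr (psi m _); ring.
  apply/andP/andP => [[vb vl]|[vb vl]].
    have [] := step 1 v (normr1 _) vb; first by rewrite mul1r.
    rewrite mul1r => wb wn; split; first exact: wb.
    by rewrite wn eqxx; have := nl v vb; move: (n v j) vl; clear; lia.
  have [] := step (-1) (v + (h j)%:~R) (normrN1 _) vb; first by rewrite mulN1r.
  rewrite mulN1r addrK => wb wn; split; first exact: wb.
  by rewrite wn eqxx; have := nl _ vb; move: (n (v + _) j) vl; clear; lia.
set T := \sum_(v in _) _ in HT.
have TE (a : int) : T = \sum_(v in box 4^-1 | n v j != a) ell v +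
    \sum_(v in [set v in box 4^-1 | n v j == a]) ell v.
  rewrite /T (bigID (fun v => n v j != a)) /=; congr (_ + _); apply: eq_bigl => v.
  by rewrite [RHS]inE negbK.
have nE (a : int) : `|a| <= l%:Z ->
    nrm (\sum_(v in [set v in box 4^-1 | n v j == a]) ell v) * (2 * l + 1)%:R <= M.
  move=> al; apply: le_trans (level_card a j l al l1); rewrite ler_wpM2r //.
  apply: le_trans (ler_nrm_sum _ _ _ _) _; rewrite -[leRHS]mulr1 -sum_constR.
  by apply: ler_sum => v _; rewrite nrm_psi.
have key : (psi m theta - 1) * T =
    psi m theta * (\sum_(v in [set v in box 4^-1 | n v j == l%:Z]) ell v) -
    \sum_(v in [set v in box 4^-1 | n v j == - l%:Z]) ell v.
  by rewrite mulrBl mul1r {1}(TE l%:Z) (TE (- l%:Z)) -shift; ring.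
have := nint_le_nrm_eB1 ((theta : nat)%:R / M); rewrite -/(circ m theta) -/(psi m theta).
have := congr1 nrm key; rewrite nrmM => key2 H.
have H2 : nrm (psi m theta - 1) * nrm T * (2 * l + 1)%:R <= 2 * M.
  rewrite key2; apply: le_trans (_ : (nrm (\sum_(v in [set v in box 4^-1 | n v j == l%:Z]) ell v) +
     nrm (\sum_(v in [set v in box 4^-1 | n v j == - l%:Z]) ell v)) * (2 * l + 1)%:R <= _).
    by rewrite ler_wpM2r //; apply: le_trans (ler_nrmB _ _) _; rewrite nrmM nrm_psi mul1r.
  have := nE l%:Z; have := nE (- l%:Z); rewrite mulrDl normrN; move=> h1 h2.
  by have := h1 (lexx _); have := h2 (lexx _); lra.
have l3 : 4^-1 * L j <= (2 * l + 1)%:R.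
  by apply: ltW; apply: lt_le_trans l2 _; rewrite ler_nat addn1 ltnS leq_pmull.
have c0 := circ_ge0 m theta.
have : (2 * circ m theta) * (eta * M) * (4^-1 * L j) <= 2 * M.
  apply: le_trans H2; apply: ler_pM => //; rewrite ?mulr_ge0 ?invr_ge0 ?(ltW e0) ?(ltW Mp) ?(ltW Lj) //.
  by apply: ler_pM; rewrite ?mulr_ge0 ?(ltW e0) ?(ltW Mp).
rewrite ler_pdivlMr // -(ler_pM2r Mp).
move: (circ _ _) (L j) (m.+2%:R : R) Mp c0 => a b c'; nra.
Qed.

(** After [half_box] one base point [w] is fixed by averaging. For each good [u] what is left is the
    sum over the box of a phase linear in [v], ready for [character_sum_on_box]. *)
Lemma many_near_symmetric (C1 C2 : G -> C) (eta : R) : 0 < eta ->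
  (forall x, nrm (C1 x) <= 1) -> (forall x, nrm (C2 x) <= 1) ->
  eta * M ^+ 2 <= nrm (\sum_(u in box 4^-1) \sum_(v in box 4^-1)
       C1 u * C2 v * psi m (phi v * u - phi u * v)) ->
  exists w (W : {set G}), [/\ w \in box 4^-1, W \subset box 4^-1,
    eta ^+ 2 / 2 * M <= #|W|%:R & forall u, u \in W ->
    eta ^+ 2 / 2 * M <= nrm (\sum_(v in box 4^-1) psi m (phi v * (u - w) - (phi u - phi w) * v))].
Proof.
move=> e0 C11 C21 HS; have Mp := modulus_gt0 m.
pose K v u := psi m (phi v * u - phi u * v).
pose N u w := nrm (\sum_(v in box 4^-1) psi m (phi v * (u - w) - (phi u - phi w) * v)).
have Mb : #|box 4^-1|%:R <= M by rewrite ler_nat -[X in (_ <= X)%N](card_ord m.+2) max_card.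
have NE u w : nrm (\sum_(v in box 4^-1) K v u * (K v w)^*) = N u w.
  congr nrm; apply: eq_bigr => v _; rewrite /K -psiN -psiD; congr (psi m _); ring.
have S2 : eta ^+ 2 * M ^+ 3 <= \sum_(w in box 4^-1) \sum_(u in box 4^-1) N u w.
  have := @half_box G G (mem (box 4^-1)) (mem (box 4^-1)) K C1 C2 C11 C21.
  rewrite exchange_big /=.
  under eq_bigr => u _ do under eq_bigr => v _ do rewrite [C2 v * _]mulrC.
  have := HS; set S := nrm _ => HS' H.
  rewrite -(ler_pM2l Mp); apply: le_trans (_ : S ^+ 2 <= _).
    have -> : M * (eta ^+ 2 * M ^+ 3) = (eta * M ^+ 2) ^+ 2 by ring.
    by rewrite lerXn2r ?nnegrE ?mulr_ge0 ?exprn_ge0 ?(ltW e0) ?(ltW Mp) ?nrm_ge0.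
  apply: le_trans H _.
  rewrite [in leRHS]exchange_big /=.
  apply: ler_pM => //.
    by apply: sumr_ge0 => u _; apply: sumr_ge0 => w _; apply: nrm_ge0.
  by apply: ler_sum => u _; apply: ler_sum => w _; rewrite NE.
have [w wb Hw] : exists2 w, w \in box 4^-1 & eta ^+ 2 * M ^+ 2 <= \sum_(u in box 4^-1) N u w.
  apply/exists_inP; apply: contraLR S2 => /exists_inPn H; rewrite -ltNge.
  have zb : 0 \in box 4^-1.
    by apply/boxP => i; rewrite coords0 normr0; have := L_gt0 i; lra.
  apply: lt_le_trans (_ : \sum_(w in box 4^-1) eta ^+ 2 * M ^+ 2 <= _).
    rewrite (bigD1 0) //= [ltRHS](bigD1 0) //= ltr_leD //; first by rewrite ltNge H.
    by apply: ler_sum => w /andP[wb _]; rewrite ltW // ltNge H.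
  rewrite sum_constR; apply: le_trans (_ : M * (eta ^+ 2 * M ^+ 2) <= _).
    by rewrite ler_wpM2r // mulr_ge0 ?exprn_ge0 // ltW.
  by apply: le_of_eq; ring.
pose g u := if u \in box 4^-1 then N u w else 0.
have e2 : 0 < eta ^+ 2 / 2 * M by rewrite mulr_gt0 ?divr_gt0 ?exprn_gt0.
exists w, [set u | eta ^+ 2 / 2 * M <= g u]; split => //.
- apply/subsetP => u; rewrite inE /g; case: ifP => // _.
  by rewrite leNgt e2.
- apply: large_subset_of_sum; last by rewrite /g -big_mkcond.
    move=> u; rewrite /g; case: ifP => _; last exact: ltW.
    by apply: le_trans Mb; apply: nrm_sum_le1 => v; rewrite nrm_psi.
  by rewrite exprn_ge0 // ltW.
- by move=> u; rewrite inE /g; case: ifP => // _; rewrite leNgt e2.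
Qed.
End Box.

(** Take [q] from [s = 1], with signed remainder [tau] of [q * theta]. If [tau] is nonzero, some
    multiple s' |tau| lies in [2 eta, 3 eta], and then t s' |tau| lies in [2 eta, 1/2] for every t
    <= T, so recurrence at q s' is impossible. Therefore q s' T > L, which bounds |tau|. *)
Lemma recurrence_slope (theta eta L : R) (T : nat) : 0 < eta -> (0 < T)%N -> T%:R <= L ->
  6 * eta * T%:R <= 1 ->
  (forall s : nat, (0 < s)%N -> (s * T)%:R <= L ->
     exists2 t : nat, (0 < t <= T)%N & nint ((t * s)%:R * theta) <= eta) ->
  exists2 q : nat, (0 < q <= T)%N & nint (q%:R * theta) <= 3 * eta * T%:R ^+ 2 / L.
Proof.
move=> e0 T0 TL eT rec; have T0' : 0 < T%:R :> R by rewrite ltr0n.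
have L0 : 0 < L by apply: lt_le_trans TL.
have [|q q0 Hq] := rec 1%N isT; first by rewrite mul1n.
rewrite muln1 in Hq.
exists q => //; have [c Hc] := sfr_int (q%:R * theta).
set tau := sfr _ in Hc *; rewrite /nint -/tau in Hq *.
have [->|tau0] := eqVneq tau 0.
  by rewrite normr0 divr_ge0 ?mulr_ge0 ?exprn_ge0 ?(ltW e0) ?(ltW L0).
have at0 : 0 < `|tau| by rewrite normr_gt0.
pose s' := (Num.truncn (2 * eta / `|tau|)).+1.
have /andP[s1 s2] : (Num.truncn (2 * eta / `|tau|))%:R <= 2 * eta / `|tau| < s'%:R.
  by apply: Num.Theory.truncn_itv; rewrite divr_ge0 // mulr_ge0 // ltW.
have s1' : s'%:R * `|tau| <= 3 * eta.
  by move: s1; rewrite ler_pdivlMr // /s' -natr1 mulrDl mul1r; move: Hq; lra.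
have s2' : 2 * eta <= s'%:R * `|tau| by move: s2; rewrite ltr_pdivrMr // => /ltW.
have [big|small] := ltP L ((q * s') * T)%:R.
  rewrite ler_pdivlMr //; apply: le_trans (_ : `|tau| * (T * s' * T)%:R <= _).
    rewrite ler_wpM2l //; apply: le_trans (ltW big) _; rewrite ler_nat.
    by rewrite leq_mul2r leq_mul2r; case/andP: q0 => _ ->; rewrite !orbT.
  rewrite !natrM; have -> : `|tau| * (T%:R * s'%:R * T%:R) = (s'%:R * `|tau|) * T%:R ^+ 2 by ring.
  by rewrite ler_wpM2r // exprn_ge0.
have [|t /andP[t0 tT] Ht] := rec (q * s')%N _ small.
  by rewrite muln_gt0; case/andP: q0 => ->.
exfalso; move: Ht.
have -> : (t * (q * s'))%:R * theta = (t * s')%:R * tau + ((t * s')%:Z * c)%:~R.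
  by rewrite Hc intrM -pmulrn !natrM; ring.
have t1 : 1 <= t%:R :> R by rewrite ler1n.
have tT' : t%:R <= T%:R :> R by rewrite ler_nat.
have E : `|(t * s')%:R * tau| = t%:R * (s'%:R * `|tau|).
  by rewrite natrM -mulrA !normrM !normr_nat.
rewrite nintDz nint_small E.
  by move: t1 s2' e0; nra.
have : t%:R * (s'%:R * `|tau|) <= T%:R * (3 * eta) by apply: ler_pM => //; rewrite mulr_ge0.
by move: eT; lra.
Qed.

Section Symmetry.
Variables (m d : nat) (s : 'I_d.+1 -> 'I_m.+2) (rho rho' : R).
Variable bc : bohr_coordinates m d s rho rho'.
Hypothesis s0 : s ord0 = 1.
Notation G := 'I_m.+2.
Notation M := (m.+2%:R : R).
Notation k := (bc_k m d s rho rho' bc).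
Notation n := (bc_n m d s rho rho' bc).
Notation h := (bc_h m d s rho rho' bc).
Notation L := (bc_L m d s rho rho' bc).
Notation box := (box m d s rho rho' bc).
Variable phi : G -> G.
Hypothesis phi_add : forall x y, x \in box 1 -> y \in box 1 -> x + y \in box 1 ->
  phi (x + y) = phi x + phi y.
Notation slope := (slope m d s rho rho' bc phi).
Notation alt := (alt m d s rho rho' bc phi).

(** Since T > 1 / eta, the [T + 1] translates of [W] by multiples of t h_i cannot be disjoint. A
    coincidence gives two points of [W] differing by N h_i with N = t' t and 0 < t' <= T;
    subtracting their estimates from [character_sum_on_box] shows that N times [alt i j] is O(1 /
    L_j). [recurrence_slope] then gains the factor 1 / L_i as well. *)
Lemma slopes_almost_symmetric (w : G) (W : {set G}) (eta : R) (i j : 'I_k) (T : nat) :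
  0 < eta -> eta <= 1 -> W \subset box 4^-1 -> eta * M <= #|W|%:R ->
  (forall u, u \in W ->
    eta * M <= nrm (\sum_(v in box 4^-1) psi m (phi v * (u - w) - (phi u - phi w) * v))) ->
  eta^-1 < T%:R -> T%:R <= L i -> 96 * T%:R / eta <= L j ->
  exists2 q : nat, (0 < q <= T)%N &
    circ m (q%:R * alt i j) <= 48 * T%:R ^+ 2 / eta / (L i * L j).
Proof.
move=> e0 e1 Wb WM HW eT TLi TLj; have Mp := modulus_gt0 m.
have Lj := bc_L_gt0 _ _ _ _ _ bc j; have Li := bc_L_gt0 _ _ _ _ _ bc i.
have T0 : (0 < T)%N by rewrite -(ltr0n R); apply: lt_trans eT; rewrite invr_gt0.
have T0' : 0 < T%:R :> R by rewrite ltr0n.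
pose eps := 16 / (eta * L j).
have eps0 : 0 < eps by rewrite divr_gt0 // mulr_gt0.
pose th u := phi (h j)%:~R * (u - w) - (phi u - phi w) * (h j)%:~R.
have thb u : u \in W -> circ m (th u) <= 8 / (eta * L j).
  by move=> uW; apply: character_sum_on_box => //; apply: HW.
have rec (t : nat) : (0 < t)%N -> (t * T)%:R <= L i ->
   exists2 t' : nat, (0 < t' <= T)%N & circ m ((t' * t)%:R * alt i j) <= eps.
  move=> t0 tT.
  have [f fE] : exists f : G * 'I_T.+1 -> G, forall x, f x = x.1 + (x.2 * t)%:R * (h i)%:~R.
    by exists (fun x : G * 'I_T.+1 => x.1 + (x.2 * t)%:R * (h i)%:~R).
  have [x [y [xW yW xy fxy]]] : exists x y : G * 'I_T.+1,
      [/\ x.1 \in W, y.1 \in W, (x.2 < y.2)%N & f x = f y].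
    apply: contrapT => H.
    have inj : {in setX W [set: 'I_T.+1] &, injective f}.
      move=> x y; rewrite !inE !andbT => xW yW fxy.
      have xy : x.2 = y.2.
        have [lt|lt|E] := ltngtP x.2 y.2; last exact: val_inj.
          by exfalso; apply: H; exists x; exists y; exact: And4 xW yW lt fxy.
        by exfalso; apply: H; exists y; exists x; exact: And4 yW xW lt (esym fxy).
      rewrite (surjective_pairing x) (surjective_pairing y) xy; congr (_, _).
      by move: fxy; rewrite !fE xy => /addIr.
    have := card_le_inj _ _ f _ [set: G] inj (fun x _ => in_setT _).
    rewrite cardsX !cardsT !card_ord -(ler_nat R) natrM.
    apply/negP; rewrite -ltNge; apply: lt_le_trans (_ : eta * M * T.+1%:R <= _); last by rewrite ler_wpM2r.
    rewrite mulrAC ltr_pMl // -ltr_pdivrMl // mulr1; apply: lt_trans eT _.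
    by rewrite ltr_nat.
  exists (y.2 - x.2)%N; first by rewrite subn_gt0 xy /= (leq_trans (leq_subr _ _)) // -ltnS.
  set N := ((y.2 - x.2) * t)%N.
  have E : x.1 - y.1 = N%:R * (h i)%:~R.
    apply/eqP; rewrite subr_eq; apply/eqP; apply: (addIr ((x.2 * t)%:R * (h i)%:~R)).
    have NE : ((y.2 * t)%:R : G) = N%:R + (x.2 * t)%:R.
      by rewrite /N -natrD -mulnDl subnK // ltnW.
    by rewrite -fE fxy fE NE mulrDl addrA (addrC y.1).
  have q4 : 4^-1 + 4^-1 <= 1 :> R by lra.
  have xb := subsetP Wb _ xW; have yb := subsetP Wb _ yW.
  have NL l : `|(n 0 l + N%:Z * (l == i)%:R)%:~R : R| <= L l.
    rewrite coords0 // add0r; case: eqP => [->|_].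
      rewrite mulr1 -pmulrn normr_nat; apply: le_trans tT; rewrite ler_nat /N mulnC leq_mul2l.
      by rewrite (leq_trans (leq_subr _ _)) ?orbT // -ltnS.
    by rewrite mulr0 normr0 ltW // bc_L_gt0.
  have nN := coords_shift _ _ _ _ _ bc s0 0 N%:Z i NL.
  have phiE : phi x.1 - phi y.1 = N%:R * (slope i)%:~R.
    have q0 : 0 <= 4^-1 :> R by lra.
    rewrite -(phi_sub _ _ _ _ _ bc s0 phi phi_add _ _ _ _ q4 q0 q0 xb yb).
    rewrite E (phi_linear _ _ _ _ _ bc s0 phi phi_add).
      rewrite (bigD1 i) //= big1 ?addr0.
        by move: (nN i); rewrite add0r => ->; rewrite coords0 // add0r eqxx mulr1 intrM.
      move=> l li; move: (nN l); rewrite add0r => ->.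
      by rewrite coords0 // (negbTE li) mulr0 addr0 mul0r.
    apply/boxP => l; move: (nN l); rewrite add0r => ->; rewrite mul1r; exact: NL.
  have -> : N%:R * alt i j = th x.1 - th y.1.
    have -> : th x.1 - th y.1 = phi (h j)%:~R * (x.1 - y.1) - (phi x.1 - phi y.1) * (h j)%:~R.
      by rewrite /th; ring.
    have -> : phi (h j)%:~R = (slope j)%:~R by rewrite /slope intr_ord.
    by rewrite E phiE /alt; ring.
  apply: le_trans (circB _ _ _) _; rewrite /eps.
  have := thb _ xW; have := thb _ yW; rewrite (_ : 16 / _ = 8 / (eta * L j) + 8 / (eta * L j)).
    by lra.
  by rewrite -mulrDl; congr (_ / _); lra.
pose a := ((alt i j : nat)%:R / M : R).
have circE (q : nat) : circ m (q%:R * alt i j) = nint (q%:R * a).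
  rewrite -(intr_ord _ (alt i j)) -[q%:R]/(q%:Z%:~R) -intrM circ_int intrM -mulrA //.
have [|s1 s1p s1T|q q0 Hq] := @recurrence_slope a eps (L i) T eps0 T0 TLi.
(* The requirement 6 eps T <= 1 with eps = 16 / (eta L_j) is the origin of the constant 96. *)
- rewrite /eps; move: TLj; rewrite ler_pdivrMr // => H.
  have -> : 6 * (16 / (eta * L j)) * T%:R = 96 * T%:R / (eta * L j) by field; rewrite !gt_eqF.
  by rewrite ler_pdivrMr ?mulr_gt0 // mul1r [eta * _]mulrC.
- by have [t' Ht' Hc] := rec s1 s1p s1T; exists t' => //; rewrite -circE.
exists q => //; rewrite circE; apply: le_trans Hq _; apply: le_of_eq.
by rewrite /eps; field; rewrite !gt_eqF.
Qed.

(* [T`!] clears all the denominators [q <= T] at once. *)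
Lemma common_denominator (w : G) (W : {set G}) (eta : R) (i j : 'I_k) (T : nat) :
  0 < eta -> eta <= 1 -> W \subset box 4^-1 -> eta * M <= #|W|%:R ->
  (forall u, u \in W ->
    eta * M <= nrm (\sum_(v in box 4^-1) psi m (phi v * (u - w) - (phi u - phi w) * v))) ->
  eta^-1 < T%:R -> T%:R <= L i -> 96 * T%:R / eta <= L j ->
  circ m (T`!%:R * alt i j) <= T`!%:R * (48 * T%:R ^+ 2 / eta) / (L i * L j).
Proof.
move=> e0 e1 Wb WM HW eT TLi TLj.
have [q /andP[q0 qT] Hq] := slopes_almost_symmetric w W eta i j T e0 e1 Wb WM HW eT TLi TLj.
have /dvdnP[r Er] : (q %| T`!)%N by apply: dvdn_fact; rewrite q0.
rewrite Er [in X in circ _ X]natrM -mulrA -[r%:R]/(r%:Z%:~R); apply: le_trans (circ_mulz _ _ _) _.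
rewrite -[`|_|]/(r%:Z) -pmulrn -mulrA -Er; apply: ler_pM => //; first exact: circ_ge0.
  by rewrite ler_nat Er leq_pmulr.
Qed.
End Symmetry.

(** * Bracket quadratics *)

Lemma sfr_no_wrap (y : R) : - 2^-1 <= y -> y < 7 / 8 -> `|sfr y| <= 8^-1 -> sfr y = y.
Proof.
move=> y1 y2 H; have [y3|y3] := ltP y 2^-1; first by apply: sfr_id; rewrite y1 y3.
have E : sfr y = y - 1.
  by apply: (@sfr_uniq _ _ 1); [lra | rewrite mulr1z subrK].
by move: H; rewrite E ler_norml; lra.
Qed.

Lemma floorDz_small (w v : R) (z : int) :
  (Num.floor w)%:~R <= w + v -> w + v < (Num.floor w)%:~R + 1 ->
  Num.floor (w + z%:~R + v) = Num.floor w + z.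
Proof. by move=> H1 H2; apply: floor_def; rewrite !intrD; lra. Qed.

(** Hermite's identity for two terms. *)
Lemma floor_double (y : R) :
  Num.floor (2 * y) - Num.floor y = Num.floor (y + 2^-1).
Proof.
have := floor_itv y; have := floor_itv (y + 2^-1).
rewrite !intrD; set a := Num.floor y; set b := Num.floor (y + 2^-1) => H1 H2.
suff -> : Num.floor (2 * y) = a + b by rewrite addrAC subrr add0r.
apply: floor_def; rewrite !intrD.
have : b = a \/ b = a + 1.
  have : a%:~R <= b%:~R + 2^-1 :> R by lra.
  have : (b%:~R : R) < a%:~R + 2 by lra.
  rewrite -(intrD _ a 2) ltr_int => h1 h2.
  have : (a%:~R : R) < b%:~R + 1 by lra.
  rewrite -(intrD _ b 1) ltr_int; lia.
case=> E; move: H1; rewrite E ?intrD; lra.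
Qed.

(* The nearest integer to [sigma n - w] is, up to a constant, [floor (sigma n)],
   or [floor (sigma n + 1/2) = floor (2 sigma n) - floor (sigma n)] when [w] is
   close to an integer. *)
Lemma rounding_as_floors (sigma w : R) : exists (k1 k2 K : int), forall (n R0 : int) (v : R),
  sigma * n%:~R = w + R0%:~R + v -> `|v| <= 8^-1 ->
  R0 = k1 * Num.floor (sigma * n%:~R) + k2 * Num.floor (2 * sigma * n%:~R) - K.
Proof.
have := floor_itv w; have := floor_itv (w + 2^-1).
rewrite !intrD => Hh Hw.
have [/andP[a1 a2]|a] := boolP ((Num.floor w)%:~R + 4^-1 <= w < (Num.floor w)%:~R + 3 / 4).
  exists 1, 0, (Num.floor w) => n R0 v E; rewrite ler_norml => Hv.
  by rewrite E floorDz_small; [lia|lra|lra].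
exists (-1), 1, (Num.floor (w + 2^-1)) => n R0 v E; rewrite ler_norml => Hv.
suff H : Num.floor (sigma * n%:~R + 2^-1) = Num.floor (w + 2^-1) + R0.
  by have := floor_double (sigma * n%:~R); rewrite H mulrA; lia.
rewrite E; have -> : w + R0%:~R + v + 2^-1 = (w + 2^-1) + R0%:~R + v by ring.
have h : Num.floor (w + 2^-1) = Num.floor w \/ Num.floor (w + 2^-1) = Num.floor w + 1.
  have h1 : ((Num.floor (w + 2^-1))%:~R : R) < (Num.floor w)%:~R + 2 by lra.
  have h2 : ((Num.floor w)%:~R : R) < (Num.floor (w + 2^-1))%:~R + 1 by lra.
  move: h1 h2; rewrite -(intrD _ _ 2) -(intrD _ _ 1) !ltr_int; lia.
rewrite floorDz_small //.
  move: a; rewrite negb_and -!ltNge -leNgt => /orP a.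
  by case: h Hh => -> Hh; rewrite ?intrD in Hh *; case: a => a; lra.
move: a; rewrite negb_and -!ltNge -leNgt => /orP a.
by case: h Hh => -> Hh; rewrite ?intrD in Hh *; case: a => a; lra.
Qed.

Definition bracket (D : nat) (alpha beta : R) (sigma tau : 'I_D -> R) (n : int) : R :=
  alpha * n%:~R ^+ 2 + beta * n%:~R +
  \sum_l tau l * n%:~R * (Num.floor (sigma l * n%:~R))%:~R.

Section BracketForm.
Variables (m d : nat) (s : 'I_d.+1 -> 'I_m.+2).
Notation G := 'I_m.+2.
Notation M := (m.+2%:R : R).

(** The 0-th signed fractional part is exactly (n - X') / M, and each other one is an affine
    function of n minus an integer given by [rounding_as_floors]. Their product is a bracket
    quadratic, except for a constant multiple of the rounding integer, whose treatment causes the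
    error. *)
Lemma bracket_of_local_quadratic (a : 'I_d.+1 -> R) (X : G) (N : nat) (rho : R) :
  s ord0 = 1 -> (8 * N = m.+2)%N -> rho <= 8^-1 ->
  exists (alpha beta theta : R) (sigma tau : 'I_(d.+1 + d.+1) -> R),
  forall n : nat, (1 <= n <= N)%N ->
   (forall j, `|sfr ((nat_of_ord (s j * (n%:R - X))%R)%:R / M)| <= rho) ->
   nint (2^-1 * (\sum_j a j * sfr ((nat_of_ord (s j * (n%:R - X))%R)%:R / M)) *
          sfr ((nat_of_ord (s ord0 * (n%:R - X))%R)%:R / M)
         - (bracket _ alpha beta sigma tau n%:Z + theta)) <= d.+1%:R * rho.
Proof.
move=> s0 NM rho8; have Mp := modulus_gt0 m.
(* With the centred representative and n <= M/8, the quotient (n - X') / M lies in [-1/2, 7/8), the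
   range required by [sfr_no_wrap]. *)
pose X' : int := if (2 * (X : nat) <= m.+2)%N then (X : nat)%:Z else (X : nat)%:Z - m.+2%:Z.
have X'E : (X'%:~R : G) = X.
  rewrite /X'; case: ifP => _; first exact: intr_ord.
  rewrite intrB intr_ord -[X in _ - X]/(m.+2%:R).
  have -> : m.+2%:R = 0 :> G by rewrite Zp_nat; apply/val_inj; rewrite /= modnn.
  by rewrite subr0.
pose sg j : R := (s j : nat)%:R / M.
have [k1 Hk1] := fin_all_exists (fun j => rounding_as_floors (sg j) (sg j * X'%:~R)).
have [k2 Hk2] := fin_all_exists Hk1.
have [K HK] := fin_all_exists Hk2.
pose A j := a j / (2 * M).
pose c j := A j * X'%:~R.
(* The integer part of [c j] multiplies an integer, so only its fractional part
   [g j] matters, and [g j * v j] is small. *)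
pose g j := c j - (Num.floor (c j))%:~R.
have g01 j : 0 <= g j <= 1.
  by have := floor_itv (c j); rewrite intrD /g; lra.
exists (\sum_j A j * sg j),
  (\sum_j (A j * (K j)%:~R - 2 * A j * sg j * X'%:~R + g j * sg j)),
  (\sum_j (A j * sg j * X'%:~R ^+ 2 - A j * (K j)%:~R * X'%:~R - g j * sg j * X'%:~R + g j * (K j)%:~R)),
  (fun l => match split l with inl j => sg j | inr j => 2 * sg j end),
  (fun l => match split l with inl j => - A j * (k1 j)%:~R | inr j => - A j * (k2 j)%:~R end).
move=> n nN Hv.
pose v j := sfr ((nat_of_ord (s j * (n%:R - X))%R)%:R / M).
have vE j : exists R0 : int, sg j * (n%:Z)%:~R = sg j * X'%:~R + R0%:~R + v j.
  have E : s j * (n%:R - X) = (((s j : nat)%:Z * (n%:Z - X'))%:~R : G).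
    by rewrite intrM intr_ord intrB X'E.
  have [c1 Hc1] := lift_int m ((s j : nat)%:Z * (n%:Z - X')).
  have [c2 Hc2] := sfr_int ((nat_of_ord (s j * (n%:R - X))%R)%:R / M).
  exists (c1 + c2); rewrite /v Hc2 E Hc1 intrM intrB intrD -!pmulrn /sg.
  by move: (m.+2%:R : R) Mp => t t0; field; rewrite gt_eqF.
have v0E : M * v ord0 = n%:R - X'%:~R.
  have E : s ord0 * (n%:R - X) = ((n%:Z - X')%:~R : G) by rewrite s0 mul1r intrB X'E.
  have [c1 Hc1] := lift_int m (n%:Z - X').
  have v0 : v ord0 = sfr ((n%:Z - X')%:~R / M).
    by rewrite /v E Hc1 -intrN sfrDz.
  rewrite v0 sfr_no_wrap.
  - by rewrite mulrC divfK ?gt_eqF // intrB.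
  - rewrite ler_pdivlMr // /X'; have := ltn_ord X; case: ifP => h hX.
      rewrite -[leRHS]/(_%:~R) (_ : - 2^-1 * M = - (M / 2)); last by ring.
      have : ((- m.+2%:Z)%:~R : R) <= (2 * (n%:Z - (X : nat)%:Z))%:~R by rewrite ler_int; lia.
      by rewrite intrN intrM -pmulrn; lra.
    have : ((- m.+2%:Z)%:~R : R) <= (2 * (n%:Z - ((X : nat)%:Z - m.+2%:Z)))%:~R by rewrite ler_int; lia.
    by rewrite intrN intrM -pmulrn; lra.
  - rewrite ltr_pdivrMr // /X'; have := ltn_ord X; case: ifP => h hX.
      have : ((8 * (n%:Z - (X : nat)%:Z))%:~R : R) < (7 * m.+2%:Z)%:~R by rewrite ltr_int; lia.
      by rewrite !intrM -[m.+2%:Z%:~R]/M; lra.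
    have : ((8 * (n%:Z - ((X : nat)%:Z - m.+2%:Z)))%:~R : R) < (7 * m.+2%:Z)%:~R by rewrite ltr_int; lia.
    by rewrite !intrM -[m.+2%:Z%:~R]/M; lra.
  - by rewrite -v0; apply: le_trans (Hv ord0) rho8.
have [R0 HR0] := fin_all_exists vE.
pose fl j := k1 j * Num.floor (sg j * n%:Z%:~R) + k2 j * Num.floor (2 * sg j * n%:Z%:~R).
have R0E j : R0 j = fl j - K j.
  by apply: (HK j n%:Z (R0 j) (v j) (HR0 j)); apply: le_trans (Hv j) rho8.
have flE j : (fl j)%:~R = sg j * (n%:R - X'%:~R) + (K j)%:~R - v j.
  have := HR0 j; rewrite R0E intrB -pmulrn => H; move: H; lra.
rewrite -/(v ord0) (eq_bigr (fun j => a j * v j)) //.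
set Qv := 2^-1 * _ * _.
have QE : Qv = \sum_j A j * (n%:R - X'%:~R) * v j.
  rewrite /Qv -v0E mulr_sumr mulr_suml; apply: eq_bigr => j _.
  by rewrite /A; move: (m.+2%:R : R) Mp => t t0; field; rewrite gt_eqF.
have -> : Qv - (bracket _ (\sum_j A j * sg j)
     (\sum_j (A j * (K j)%:~R - 2 * A j * sg j * X'%:~R + g j * sg j))
     (fun l => match split l with inl j => sg j | inr j => 2 * sg j end)
     (fun l => match split l with inl j => - A j * (k1 j)%:~R | inr j => - A j * (k2 j)%:~R end) n%:Z +
   \sum_j (A j * sg j * X'%:~R ^+ 2 - A j * (K j)%:~R * X'%:~R - g j * sg j * X'%:~R + g j * (K j)%:~R))
   = - (\sum_j g j * v j) + (\sum_j Num.floor (c j) * fl j)%:~R.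
  rewrite QE /bracket big_split_ord /= mulr_suml mulr_suml.
  rewrite rmorph_sum /= -sumrN.
  under [X in _ - (_ + _ + (X + _) + _)]eq_bigr => j _ do rewrite (unsplitK (inl j)).
  under [X in _ - (_ + _ + (_ + X) + _)]eq_bigr => j _ do rewrite (unsplitK (inr j)).
  rewrite -!big_split -sumrB; apply: eq_bigr => j _ /=.
  have -> : (Num.floor (c j) * fl j)%:~R = (c j - g j) * (fl j)%:~R.
    by rewrite intrM; congr (_ * _); rewrite /g; ring.
  rewrite flE.
  have flE' : (k2 j)%:~R * (Num.floor (2 * sg j * n%:Z%:~R))%:~R =
     sg j * (n%:R - X'%:~R) + (K j)%:~R - v j - (k1 j)%:~R * (Num.floor (sg j * n%:Z%:~R))%:~R :> R.
    by rewrite -flE /fl intrD !intrM; ring.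
  have -> : - A j * (k2 j)%:~R * n%:Z%:~R * (Num.floor (2 * sg j * n%:Z%:~R))%:~R =
     - A j * n%:Z%:~R * ((k2 j)%:~R * (Num.floor (2 * sg j * n%:Z%:~R))%:~R) by ring.
  by rewrite flE' /c -!pmulrn; ring.
rewrite nintDz nintN; apply: le_trans (nint_sum _ _ _ _) _.
apply: le_trans (_ : \sum_(j < d.+1) rho <= _); last first.
  by rewrite sumr_const card_ord -[_ *+ d.+1]mulr_natl.
apply: ler_sum => j _; apply: le_trans (nint_le_norm _) _.
have /andP[g0 g1] := g01 j.
rewrite normrM (ger0_norm g0); apply: le_trans (Hv j).
by apply: ler_piMl.
Qed.
End BracketForm.

(** Generator [i] gets frequency sigma_i and generator [D + i] gets -tau_i. With zero polynomials
    and exponent 1 on the pair [(D + i, i)], the coset function is exactly e(tau_i n floor(sigma_i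
    n)). *)
Lemma chi_bracket (D : nat) (alpha beta : R) (sigma tau : 'I_D -> R) :
  exists (mm : nat -> nat -> int) (xi : nat -> R),
   (forall i' i, `|mm i' i| <= 1) /\
   forall n : nat, chi alpha beta (D + D) mm xi (fun _ _ => 0) n%:Z =
     e (bracket D alpha beta sigma tau n%:Z).
Proof.
pose fs (F : 'I_D -> R) (i : nat) : R := if insub i is Some j then F j else 0.
exists (fun i' i => ((i' == D + i)%N : int)),
  (fun i => if (i < D)%N then fs sigma i else - fs tau (i - D)%N).
split; first by move=> i' i; case: (_ == _).
move=> n; rewrite /chi /bracket [in RHS]eD; congr (_ * _).
rewrite big_split_ord /= big1 ?mul1r; last first.
  move=> i' _; rewrite big1 // => i _.
  have -> : (nat_of_ord i' == (D + i)%N) = false.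
    by apply: ltn_eqF; apply: leq_trans (ltn_ord i') _; rewrite leq_addr.
  exact: expr0z.
rewrite (big_morph e eD e0); apply: eq_bigr => l _.
have lD : (l < D + l)%N by rewrite -[X in (X < _)%N]add0n ltn_add2r (leq_ltn_trans _ (ltn_ord l)).
rewrite (bigD1 (Ordinal lD)) //= big1 ?mulr1; last first.
  move=> i il; have -> : (D + l == D + i)%N = false; last exact: expr0z.
  by rewrite eqn_add2l eq_sym; apply: contraNF il => /eqP E; apply/eqP/val_inj.
rewrite eqxx expr1z /F_coset /= horner0 sub0r ltn_ord ltnNge leq_addr /= addKn.
rewrite /fs; case: insubP => [j _ jl|]; last by rewrite ltn_ord.
by have -> : j = l by [apply/val_inj]; congr e; ring.
Qed.

(** * Correlation with a local quadratic phase *)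

Lemma exists_phase (z : C) : exists2 u : C, nrm u <= 1 & u * z = ((nrm z)%:C)%C.
Proof.
have [->|z0] := eqVneq z 0; first by exists 0; rewrite ?nrm0 ?mulr0.
have n0 : nrm z != 0 by apply: contraNneq z0 => H; rewrite -normr_eq0 normC_nrm H.
exists (((nrm z)^-1)%:C%C * z^*).
  by rewrite nrmM nrmJ nrm_real ger0_norm ?invr_ge0 ?nrm_ge0 // mulVf.
rewrite -mulrA [_^* * z]mulrC mulCJ_nrm -rmorphM /= expr2 mulrA mulVf ?mul1r //.
Qed.

Lemma nrm_eB_le (a b : R) : nrm (e a - e b) <= 8 * nint (a - b).
Proof.
have -> : e a - e b = (e (a - b) - 1) * e b by rewrite mulrBl mul1r -eD subrK.
by rewrite nrmM nrm_e mulr1 nrm_eB1_le.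
Qed.

Section Phases.
Variable m : nat.
Notation G := 'I_m.+2.
Notation M := (m.+2%:R : R).

Definition cut (H : {set G}) (c : G -> C) (h : G) : C := if h \in H then c h else 0.

(** Once the phases make every Fourier coefficient nonnegative there is no cancellation between
    different [h], so the lower bound passes to every subset. It is used for [H] itself and for both
    of its later refinements. *)
Lemma derivative_phases (F : G -> C) (H : {set G}) (xi : G -> G) (c0 : R) :
  (forall h, h \in H -> c0 * M <= nrm (fourier m (deriv m h F) (xi h))) ->
  exists2 c : G -> C, (forall h, nrm (c h) <= 1) &
   forall H' : {set G}, H' \subset H -> c0 * M * #|H'|%:R <=
    nrm (\sum_x \sum_(h in H') F (x + h) * (F x)^* * c h * psi m (- (xi h * x))).
Proof.
move=> HF.
have [c Hc Hcf] := fin_all_exists2 (fun h => exists_phase (fourier m (deriv m h F) (xi h))).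
exists c => // H' sH.
have -> : \sum_x \sum_(h in H') F (x + h) * (F x)^* * c h * psi m (- (xi h * x)) =
   ((\sum_(h in H') nrm (fourier m (deriv m h F) (xi h)))%:C)%C.
  rewrite exchange_big rmorph_sum /=; apply: eq_bigr => h _.
  rewrite -Hcf /fourier mulr_sumr; apply: eq_bigr => x _.
  by rewrite /deriv; ring.
rewrite nrm_real ger0_norm; last by apply: sumr_ge0 => h _; apply: nrm_ge0.
rewrite mulrC mulr_natl -sumr_const; apply: ler_sum => h hH; apply: HF.
exact: (subsetP sH).
Qed.

Lemma quadruples_on_subset (F c : G -> C) (H : {set G}) (xi : G -> G) (eta : R) :
  (forall x, nrm (F x) <= 1) -> 0 <= eta ->
  eta * M ^+ 2 <=
    nrm (\sum_x \sum_(h in H) F (x + h) * (F x)^* * c h * psi m (- (xi h * x))) ->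
  eta ^+ 4 * M ^+ 3 <= nrm (\sum_h1 \sum_h2 \sum_h3
    (xi h1 + xi (h2 + h3 - h1) == xi h2 + xi h3)%:R *
     (cut H c h1 * (cut H c h2)^* * (cut H c h3)^* * cut H c (h2 + h3 - h1) *
     psi m (- ((xi (h2 + h3 - h1) - xi h3) * (h1 - h3))))).
Proof.
move=> F1 eta0 Hs; apply: (@quadruple_sum_large m F (fun x => (F x)^*)) => //.
  by move=> x; rewrite nrmJ.
apply: le_trans Hs _; apply: le_of_eq; congr nrm; apply: eq_bigr => x _.
rewrite big_mkcond; apply: eq_bigr => h _; rewrite /cut.
by case: ifP => // _; rewrite mulr0 mul0r.
Qed.

Lemma energy_of_quadruples (c : G -> C) (H : {set G}) (xi : G -> G) :
  (forall h, nrm (c h) <= 1) ->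
  nrm (\sum_h1 \sum_h2 \sum_h3
    (xi h1 + xi (h2 + h3 - h1) == xi h2 + xi h3)%:R *
     (cut H c h1 * (cut H c h2)^* * (cut H c h3)^* * cut H c (h2 + h3 - h1) *
     psi m (- ((xi (h2 + h3 - h1) - xi h3) * (h1 - h3))))) <=
  \sum_h1 \sum_h2 \sum_h3
    ind [&& h1 \in H, h2 \in H, h3 \in H, h2 + h3 - h1 \in H &
     xi h1 + xi (h2 + h3 - h1) == xi h2 + xi h3].
Proof.
move=> c1; have c'1 h : nrm (cut H c h) <= ind (h \in H).
  by rewrite /cut; case: (h \in H); rewrite ?nrm0.
apply: le_trans (ler_nrm_sum _ _ _ _) _; apply: ler_sum => h1 _.
apply: le_trans (ler_nrm_sum _ _ _ _) _; apply: ler_sum => h2 _.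
apply: le_trans (ler_nrm_sum _ _ _ _) _; apply: ler_sum => h3 _.
rewrite !nrmM !nrmJ nrm_psi mulr1 nrm_nat.
apply: le_trans (_ : (xi h1 + xi (h2 + h3 - h1) == xi h2 + xi h3)%:R *
  (ind (h1 \in H) * ind (h2 \in H) * ind (h3 \in H) * ind (h2 + h3 - h1 \in H)) <= _).
  by rewrite ler_wpM2l ?ler0n // !ler_pM ?mulr_ge0 ?nrm_ge0 ?c'1.
by apply: le_of_eq; rewrite -!natrM !mulnb andbC -!andbA.
Qed.

Lemma exists_translate (T : G -> C) (Y : {set G}) (B : R) :
  B * M <= nrm (\sum_x T x) -> exists x, B * #|Y|%:R <= nrm (\sum_(y in Y) T (x + y)).
Proof.
move=> HB; have [/existsP //|] := boolP [exists x, B * #|Y|%:R <= nrm (\sum_(y in Y) T (x + y))].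
rewrite negb_exists => /forallP H; exfalso.
have [Y0|Y0] := posnP #|Y|.
  by have := H 0; rewrite Y0 mulr0 nrm_ge0.
have E : \sum_x \sum_(y in Y) T (x + y) = #|Y|%:R * \sum_x T x.
  rewrite exchange_big mulr_natl -sumr_const; apply: eq_bigr => y _.
  by rewrite [RHS](reindex_inj (addIr y)).
have : nrm (\sum_x \sum_(y in Y) T (x + y)) < \sum_(x : G) B * #|Y|%:R.
  apply: le_lt_trans (ler_nrm_sum _ _ _ _) _.
  apply: ltr_sum => [|x _]; last by rewrite ltNge H.
  by apply/hasP; exists 0; rewrite ?mem_index_enum.
rewrite E nrmM nrm_nat sumr_const card_ord -[_ *+ _]mulr_natl.
have := ler_wpM2l (ler0n R #|Y|) HB; lra.
Qed.
End Phases.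

Lemma inord_absz_inj (J : nat) (a b : int) : 0 <= a <= J%:Z -> 0 <= b <= J%:Z ->
  (inord `|a|%N : 'I_J.+1) = inord `|b|%N -> a = b.
Proof.
move=> Ha Hb /(congr1 val); rewrite /= !inordK; try by rewrite ltnS; lia.
lia.
Qed.

Lemma int_lt1_eq0 (a : int) : `|a%:~R| < 1 :> R -> a = 0.
Proof. by rewrite -intr_norm ltrz1; lia. Qed.

Lemma double_inv_le1 (J : nat) : (1 < J)%N -> J%:R^-1 + J%:R^-1 <= 1 :> R.
Proof.
move=> J1; have J0 : 0 < (J%:R : R) by rewrite ltr0n ltnW.
have : 2 <= (J%:R : R) by rewrite ler_nat.
by rewrite -(lef_pV2 (x := J%:R)) ?posrE //; lra.
Qed.

Section SmallBoxes.
Variables (m d : nat) (s : 'I_d.+1 -> 'I_m.+2) (rho rho' : R).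
Variable bc : bohr_coordinates m d s rho rho'.
Hypothesis s0 : s ord0 = 1.
Notation G := 'I_m.+2.
Notation M := (m.+2%:R : R).
Notation k := (bc_k m d s rho rho' bc).
Notation n := (bc_n m d s rho rho' bc).
Notation gen := (bc_h m d s rho rho' bc).
Notation L := (bc_L m d s rho rho' bc).
Notation coef := (bc_D m d s rho rho' bc).
Notation box := (box m d s rho rho' bc).

(** Two points in one cell of [cell_refine] differ by an element of a Bohr set, hence of the box; so
    the box is at least as large as a popular cell. *)
Lemma box_card (t : R) (J : nat) : (0 < J)%N -> 0 <= t -> J%:R^-1 <= t * rho' ->
  M <= (J ^ d.+1)%:R * #|box t|%:R.
Proof.
move=> J0 t0 Jt.
have [A [_ A0 cA HA]] := @cell_refine m G 'I_d.+1 setT (fun j x => s j * x) J 0 J0 (in_setT _).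
have [x0 x0A] := set0Pn _ A0.
rewrite -natrM ler_nat; move: cA; rewrite cardsT !card_ord => cA.
apply: leq_trans cA _; rewrite leq_mul2l; apply/orP; right.
apply: (card_le_inj _ _ (fun x => x - x0)) => [x y _ _ /addIr //|x xA].
apply/boxP => i; apply: bc_bohr t0 _ i => j.
rewrite bvec_circ mulrBr; apply: le_trans Jt; exact: HA.
Qed.

Variable phi : G -> G.
Hypothesis phi_add : forall x y, x \in box 1 -> y \in box 1 -> x + y \in box 1 ->
  phi (x + y) = phi x + phi y.
Notation slope := (slope m d s rho rho' bc phi).
Notation alt := (alt m d s rho rho' bc phi).

(** Pigeonhole on the residue of each coordinate modulo [q] and on its position at scale [L i / J]:
    differences within a class are then divisible and small. The position label runs from 0 to [J]
    inclusive. *)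
Lemma cell_in_box (H : {set G}) (xi : G -> G) (h0 xi0 : G) (q J : nat) (x0 : G) :
  (0 < q)%N -> (0 < J)%N -> x0 \in H ->
  (forall h, h \in H -> h - h0 \in box 4^-1 /\ xi h = xi0 + phi (h - h0)) ->
  exists (h1 : G) (X : {set G}), [/\ X \subset H,
    (#|H| <= (q.+1 * J.+1) ^ d.+1 * #|X|)%N &
    forall h, h \in X -> [/\ h - h1 \in box J%:R^-1, xi h = xi h1 + phi (h - h1) &
      forall i, exists z : int, n (h - h1) i = q%:Z * z]].
Proof.
move=> q0 J0 x0H HH.
pose cell (h : G) : {ffun 'I_k -> 'I_q.+1 * 'I_J.+1} := [ffun i =>
  (inord `|(n (h - h0)%R i %% q)%Z|%N,
   inord `|Num.floor (J%:R * ((n (h - h0)%R i)%:~R / L i + 4^-1))|%N)].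
have [y Xn0 cX] := @pigeonhole_fibre G _ cell H x0 x0H.
set X := [set x in H | cell x == y] in Xn0 cX.
have [h1 h1X] := set0Pn _ Xn0.
exists h1, X; split.
- by apply/subsetP => x; rewrite inE => /andP[].
- apply: leq_trans cX _; rewrite leq_mul2r; apply/orP; right.
  rewrite card_ffun card_prod !card_ord; apply: leq_pexp2l; first by rewrite muln_gt0.
  exact: bc_rank.
move=> h hX.
have hH : h \in H by move: hX; rewrite inE => /andP[].
have h1H : h1 \in H by move: h1X; rewrite inE => /andP[].
have [hb ->] := HH _ hH; have [h1b ->] := HH _ h1H.
have hhE : h - h1 = (h - h0) - (h1 - h0) by rewrite opprB addrA subrK.
have [_ nE] := box_sub _ _ _ _ _ bc s0 4^-1 4^-1 (h - h0) (h1 - h0) ltac:(lra) hb h1b.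
have E i : cell h i = cell h1 i.
  by move: hX h1X; rewrite !inE => /andP[_ /eqP ->] /andP[_ /eqP ->].
have Lp i : 0 < L i by apply: L_gt0.
split.
- apply/boxP => i; rewrite hhE nE.
  have fl x : x \in H -> (0 <= Num.floor (J%:R * ((n (x - h0)%R i)%:~R / L i + 4^-1) : R)) &&
     (Num.floor (J%:R * ((n (x - h0)%R i)%:~R / L i + 4^-1) : R) <= J%:Z).
    move=> xH; have [/boxP/(_ i) xb _] := HH _ xH.
    move: xb; rewrite -ler_pdivrMr // -[X in _ / X](gtr0_norm (Lp i)) -normf_div.
    rewrite ler_norml => xb; apply/andP; split.
      by rewrite floor_ge0 mulr_ge0 ?ler0n //; lra.
    rewrite -(ler_int R); apply: le_trans (floor_le _) _.
    by rewrite -[leRHS]mulr1 ler_wpM2l ?ler0n //; lra.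
  have H1 : Num.floor (J%:R * ((n (h - h0)%R i)%:~R / L i + 4^-1) : R) =
     Num.floor (J%:R * ((n (h1 - h0)%R i)%:~R / L i + 4^-1) : R).
    apply: (inord_absz_inj _ _ _ (fl _ hH) (fl _ h1H)).
    by have := congr1 snd (E i); rewrite !ffunE.
  have := floor_itv (J%:R * ((n (h - h0)%R i)%:~R / L i + 4^-1) : R).
  have := floor_itv (J%:R * ((n (h1 - h0)%R i)%:~R / L i + 4^-1) : R).
  rewrite H1 intrD; set z := (_%:~R : R) => b1 b2.
  have JR : 0 < (J%:R : R) by rewrite ltr0n.
  have -> : (n (h - h0)%R i - n (h1 - h0)%R i)%:~R =
     ((n (h - h0)%R i)%:~R / L i - (n (h1 - h0)%R i)%:~R / L i) * L i.
    by rewrite intrB -mulrBl divfK ?gt_eqF.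
  rewrite normrM (gtr0_norm (Lp i)) ler_pM2r // ler_norml.
  move: (_ / L i) (_ / L i) b1 b2 => a b b1 b2.
  have : `|J%:R * (a - b)| <= 1 by rewrite ler_norml; lra.
  by rewrite -ler_norml normrM (gtr0_norm JR) -ler_pdivlMl // mulr1.
- have q1 : 4^-1 + 4^-1 <= 1 :> R by lra.
  have q2 : 0 <= 4^-1 :> R by lra.
  have -> : phi (h - h1) = phi (h - h0) - phi (h1 - h0).
    by rewrite hhE; apply: (phi_sub _ _ _ _ _ bc s0 phi phi_add 4^-1 4^-1).
  by rewrite -addrA [phi (h1 - h0) + _]addrC subrK.
- move=> i; rewrite hhE nE.
  have md x : 0 <= (n x i %% q)%Z <= q%:Z.
    by have q1 : 0 < q%:Z by []; rewrite modz_ge0 ?gt_eqF // ltW ?ltz_pmod.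
  have H1 : (n (h - h0)%R i %% q)%Z = (n (h1 - h0)%R i %% q)%Z.
    apply: (inord_absz_inj _ _ _ (md _) (md _)).
    by have := congr1 fst (E i); rewrite !ffunE.
  exists ((n (h - h0)%R i %/ q)%Z - (n (h1 - h0)%R i %/ q)%Z).
  rewrite [X in X - _](divz_eq _ q) [X in _ - X](divz_eq _ q) H1; ring.
Qed.

Notation int_form z c := (\sum_i n z i * c i : int).
(** Half the product of integer lifts of [phi z] and [z], over [M]. The lift to the reals is what
    makes halving possible, as 2 need not be invertible modulo [M]. *)
Definition local_form (z : G) : R :=
  2^-1 * (int_form z slope)%:~R * (int_form z gen)%:~R / M.

Lemma local_form_bvec : exists a : 'I_d.+1 -> R, forall z,
  local_form z = 2^-1 * (\sum_j a j * bvec m d s z j) * bvec m d s z ord0.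
Proof.
have M0 := modulus_neq0 m.
exists (fun j => \sum_i (slope i)%:~R * coef i j) => z; rewrite /local_form.
have -> : ((int_form z gen)%:~R : R) = M * bvec m d s z ord0.
  by rewrite (bc_lift m d s _ _ bc) rmorph_sum /=; apply: eq_bigr => i _; rewrite intrM.
have -> : ((int_form z slope)%:~R : R) =
   \sum_j (\sum_i (slope i)%:~R * coef i j) * bvec m d s z j.
  rewrite rmorph_sum /=; under [RHS]eq_bigr do rewrite mulr_suml.
  rewrite exchange_big; apply: eq_bigr => i _.
  rewrite intrM (bc_linear m d s _ _ bc) mulr_suml; apply: eq_bigr => j _ /=; ring.
by move: (m.+2%:R : R) M0 => t t0; field.
Qed.

(** The discrepancy is half of the antisymmetric form at [(x, y)]. Writing n_i(x) = 2 q z_i absorbs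
    the half and supplies the factor [q] on [alt]. If [L i] or [L j] is below [J] the corresponding
    coordinate is an integer of size less than 1, hence 0; otherwise the term is at most K / J^2,
    and there are at most (d + 1)^2 terms. *)
Lemma phase_as_local_form (q J : nat) (K : R) (x y : G) : (1 < J)%N -> 0 <= K ->
  (forall i j, J%:R <= L i -> J%:R <= L j -> circ m (q%:R * alt i j) <= K / (L i * L j)) ->
  x \in box J%:R^-1 -> y \in box J%:R^-1 -> (0 < q)%N ->
  (forall i, exists z : int, n x i = (q%:Z *+ 2) * z) ->
  nrm (psi m (phi x * y) - e (local_form (y + x) - local_form y - local_form x)) <=
    8 * (d.+1%:R ^+ 2 * (K / J%:R ^+ 2)).
Proof.
move=> J1 K0 HK xb yb q0 Hz; have Mp := modulus_gt0 m.
have JR : 0 < (J%:R : R) by rewrite ltr0n; lia.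
have J2 := double_inv_le1 J J1.
have Ji : 0 <= J%:R^-1 :> R by rewrite invr_ge0 ltW.
have [z Hz'] := fin_all_exists Hz.
have [_ nD] := box_add _ _ _ _ _ bc s0 _ _ _ _ J2 yb xb.
have x1 : x \in box 1 by apply: box_mono xb; lra.
have -> : psi m (phi x * y) = e ((int_form x slope * int_form y gen)%:~R / M).
  rewrite (phi_linear _ _ _ _ _ bc s0 phi phi_add x x1) {1}[y](coords_repr _ _ _ _ _ bc s0).
  by rewrite -!rmorph_sum /= -intrM psi_int.
apply: le_trans (nrm_eB_le _ _) _; rewrite ler_pM2l //.
have -> : (int_form x slope * int_form y gen)%:~R / M -
    (local_form (y + x) - local_form y - local_form x) =
    \sum_i \sum_j (z i * n y j * (q%:Z * (slope i * gen j - slope j * gen i)))%:~R / M.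
  rewrite /local_form.
  under [X in _ - (2^-1 * X%:~R * _ / _ - _ - _)]eq_bigr do rewrite nD mulrDl.
  under [X in _ - (2^-1 * _ * X%:~R / _ - _ - _)]eq_bigr do rewrite nD mulrDl.
  rewrite !big_split /= !intrD.
  have -> : \sum_i \sum_j (z i * n y j * (q%:Z * (slope i * gen j - slope j * gen i)))%:~R / M =
     2^-1 * ((int_form x slope)%:~R * (int_form y gen)%:~R - 
       (int_form y slope)%:~R * (int_form x gen)%:~R) / M :> R.
    rewrite -!intrM -intrB [int_form y slope * _]mulrC !big_distrlr /= -sumrB rmorph_sum /=.
    rewrite mulr_sumr mulr_suml; apply: eq_bigr => i _.
    rewrite -sumrB rmorph_sum /= mulr_sumr mulr_suml; apply: eq_bigr => j _.
    by congr (_ / _); rewrite Hz' -mulr_natl !(intrM, intrB) /=; field.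
  by rewrite intrM; move: (m.+2%:R : R) Mp => t t0; field; rewrite gt_eqF.
apply: le_trans (nint_sum _ _ _ _) _.
have KJ : 0 <= K / J%:R ^+ 2 by rewrite divr_ge0 // exprn_ge0 // ltW.
apply: le_trans (_ : k%:R ^+ 2 * (K / J%:R ^+ 2) <= _); last first.
  by rewrite ler_wpM2r // -!natrX ler_nat leq_exp2r //; exact: bc_rank.
have cst (t : R) : k%:R * t = \sum_(i < k) t by rewrite sumr_const card_ord mulr_natl.
rewrite expr2 -mulrA cst.
apply: ler_sum => i _; apply: le_trans (nint_sum _ _ _ _) _.
rewrite cst.
apply: ler_sum => j _.
rewrite intrM -mulrA; apply: le_trans (nint_mulz _ _) _.
rewrite -circ_int.
have -> : ((q%:Z * (slope i * gen j - slope j * gen i))%:~R : G) = q%:R * alt j i.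
  by rewrite intrM intrB !intrM.
have [Li Lj] : 0 < L i /\ 0 < L j by split; apply: L_gt0.
have zx : `|(z i)%:~R| <= `|(n x i)%:~R| :> R.
  rewrite -!intr_norm ler_int Hz' normrM ler_peMl ?normr_ge0 //.
  by rewrite -mulr_natl; clear -q0; lia.
have xi : `|(n x i)%:~R| <= J%:R^-1 * L i :> R by move/boxP: xb; apply.
have yj : `|(n y j)%:~R| <= J%:R^-1 * L j :> R by move/boxP: yb; apply.
have small (t : R) (a : int) : t < J%:R -> `|a%:~R| <= J%:R^-1 * t -> a = 0.
  move=> tJ; rewrite mulrC; have : t / J%:R < 1 by rewrite ltr_pdivrMr // mul1r.
  by move=> h1 h2; apply: int_lt1_eq0; apply: le_lt_trans h2 h1.
have [iJ|iJ] := ltP (L i) J%:R.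
  by rewrite (small _ (z i) iJ) ?mul0r ?normr0 ?mul0r //; apply: le_trans xi.
have [jJ|jJ] := ltP (L j) J%:R.
  by rewrite (small _ (n y j) jJ) ?mulr0 ?normr0 ?mul0r.
apply: le_trans (_ : (J%:R^-1 * L i * (J%:R^-1 * L j)) * (K / (L j * L i)) <= _).
  apply: ler_pM; rewrite ?ler0z ?normr_ge0 ?circ_ge0 ?HK //.
  by rewrite intr_norm intrM normrM ler_pM ?normr_ge0 //; apply: le_trans xi.
apply: le_of_eq; move: (L i) (L j) (J%:R : R) Li Lj JR => a b t a0 b0 t0.
by field; rewrite !gt_eqF.
Qed.

(** For [x = x1 + y + h], [xi h * (x1 + y)] equals [xi h * x1 + xi h1 * y + phi (h - h1) * y].
    Polarization turns the last term into the local form at [x - (x1 + h1)], a bracket quadratic in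
    [x], plus functions of [y] and of [h]; the trilinear bound finishes. *)
Lemma bracket_correlation (N : nat) (F c : G -> C) (xi : G -> G) (H : {set G}) (h0 xi0 x0 : G)
    (c0 cH K B : R) (q J J' : nat) :
  (8 * N = m.+2)%N -> rho <= 8^-1 ->
  (forall x, nrm (F x) <= 1) -> (forall x : G, F x != 0 -> (1 <= (x : nat) <= N)%N) ->
  (forall h, nrm (c h) <= 1) -> 0 < c0 ->
  (forall H' : {set G}, H' \subset H -> c0 * M * #|H'|%:R <=
    nrm (\sum_x \sum_(h in H') F (x + h) * (F x)^* * c h * psi m (- (xi h * x)))) ->
  (forall h, h \in H -> h - h0 \in box 4^-1 /\ xi h = xi0 + phi (h - h0)) ->
  x0 \in H -> cH * M <= #|H|%:R ->
  (1 < J)%N -> (0 < q)%N -> (0 < J')%N -> 0 <= K -> J'%:R^-1 <= J%:R^-1 * rho' ->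
  (forall i j, J%:R <= L i -> J%:R <= L j -> circ m (q%:R * alt i j) <= K / (L i * L j)) ->
  32 * (d.+1%:R ^+ 2 * (K / J%:R ^+ 2)) <= c0 -> 32 * (d.+1%:R * rho) <= c0 ->
  0 <= B -> 4 * B ^+ 2 * (((q * 2).+1 * J.+1) ^ d.+1 * J' ^ d.+1)%:R < c0 ^+ 2 * cH ->
  exists (alpha beta : R) (sigma tau : 'I_(d.+1 + d.+1) -> R) (r : G),
    B * M < nrm (fourier m (fun x => F x * (e (bracket _ alpha beta sigma tau (x : nat)%:Z))^*) r).
Proof.
move=> NM rho8 F1 Fs c1 c00 Hc HH x0H cHM J1 q0 J'0 K0 JJ' HK eK erho B0 HB.
have Mp := modulus_gt0 m.
have q20 : (0 < q * 2)%N by rewrite muln_gt0 q0.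
have [h1 [X [XH cX HX]]] := cell_in_box H xi h0 xi0 (q * 2) J x0 q20 (ltnW J1) x0H HH.
have Ji : 0 <= J%:R^-1 :> R by rewrite invr_ge0 ler0n.
set Y := box J%:R^-1.
have cY : M <= (J' ^ d.+1)%:R * #|Y|%:R by apply: box_card.
have [x1 Hx1] : exists x1, c0 * #|X|%:R * #|Y|%:R <= nrm (\sum_(y in Y)
    \sum_(h in X) F (x1 + y + h) * (F (x1 + y))^* * c h * psi m (- (xi h * (x1 + y)))).
  apply: (exists_translate m (fun x => \sum_(h in X) F (x + h) * (F x)^* * c h * psi m (- (xi h * x)))).
  by rewrite mulrAC; apply: Hc.
have [a Ha] := local_form_bvec.
have [alpha [beta [theta [sigma [tau Hbr]]]]] :=
  bracket_of_local_quadratic m d s a (x1 + h1) N rho s0 NM rho8.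
exists alpha, beta, sigma, tau.
set br := bracket _ alpha beta sigma tau in Hbr *.
pose g (x : G) := F x * (e (br (x : nat)%:Z))^*.
pose A y := (F (x1 + y))^* * (psi m (xi h1 * y))^* * e (local_form y).
pose b h := c h * (psi m (xi h * x1))^* * e (local_form (h - h1)) * (e theta)^*.
have J2 := double_inv_le1 J J1.
(* Each approximation costs at most c0 / 4: the bilinear phase by the local form, then the local
   form by the bracket. *)
have term y h : y \in Y -> h \in X ->
  nrm (F (x1 + y + h) * (F (x1 + y))^* * c h * psi m (- (xi h * (x1 + y)))
       - g (x1 + y + h) * A y * b h) <= c0 / 2.
  move=> yY /HX [hb xiE hz].
  set x := x1 + y + h; set z := y + (h - h1).
  pose w := br (x : nat)%:Z + theta - local_form y - local_form (h - h1).
  have -> : F x * (F (x1 + y))^* * c h * psi m (- (xi h * (x1 + y))) - g x * A y * b h =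
    F x * (F (x1 + y))^* * c h * (psi m (xi h1 * y))^* * (psi m (xi h * x1))^* *
     (psi m (phi (h - h1) * y) - e w)^*.
    rewrite psiN mulrDr {2}xiE mulrDl !psiD /g /A /b /w !eD !eN !rmorphB !rmorphM /=.
    rewrite !conjCK; ring.
  (* Where [F x] is nonzero, [x] lies in [1, N], as the bracket expansion requires. *)
  have [->|Fx0] := eqVneq (F x) 0; first by rewrite !mul0r nrm0 divr_ge0 ?ltW.
  rewrite !nrmM !nrmJ !nrm_psi !mulr1.
  apply: le_trans (_ : 1 * 1 * 1 * nrm (psi m (phi (h - h1) * y) - e w) <= _).
    by rewrite ler_wpM2r ?nrm_ge0 // !ler_pM ?mulr_ge0 ?nrm_ge0 // F1.
  rewrite !mul1r.
  have -> : psi m (phi (h - h1) * y) - e w = 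
    (psi m (phi (h - h1) * y) - e (local_form z - local_form y - local_form (h - h1))) +
    (e (local_form z - local_form y - local_form (h - h1)) - e w) by ring.
  apply: le_trans (ler_nrmD _ _) _.
  have hz' : forall i, exists z0 : int, n (h - h1) i = (q%:Z *+ 2) * z0.
    by move=> i; have [z0 ->] := hz i; exists z0; rewrite PoszM -mulr_natr.
  have E1 := phase_as_local_form q J K _ _ J1 K0 HK hb yY q0 hz'.
  have E2 := nrm_eB_le (local_form z - local_form y - local_form (h - h1)) w.
  suff E3 : nint (local_form z - local_form y - local_form (h - h1) - w) <= d.+1%:R * rho.
    by rewrite -/z in E1; clear -E1 E2 E3 eK erho; lra.
  have -> : local_form z - local_form y - local_form (h - h1) - w =
     local_form z - (br (x : nat)%:Z + theta) by rewrite /w; ring.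
  have xzE : ((x : nat)%:R : G) - (x1 + h1) = z.
    have -> : ((x : nat)%:R : G) = x by exact: intr_ord.
    by apply/eqP; rewrite subr_eq addrACA subrK [y + x1]addrC.
  have zb : z \in box 1.
    by have [zb _] := box_add _ _ _ _ _ bc s0 _ _ _ _ J2 yY hb; apply: box_mono zb.
  rewrite Ha -xzE; apply: Hbr; first exact: Fs.
  move=> j; rewrite xzE; apply: (bc_small m d s _ _ bc) => i.
  by move/boxP: zb => /(_ i); rewrite mul1r.
have large : c0 / 2 * #|X|%:R * #|Y|%:R <=
    nrm (\sum_(y in Y) \sum_(h in X) g (x1 + y + h) * A y * b h).
  have : nrm (\sum_(y in Y) \sum_(h in X) F (x1 + y + h) * (F (x1 + y))^* * c h * psi m (- (xi h * (x1 + y)))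
     - \sum_(y in Y) \sum_(h in X) g (x1 + y + h) * A y * b h) <= c0 / 2 * #|X|%:R * #|Y|%:R.
    rewrite -sumrB; apply: le_trans (ler_nrm_sum _ _ _ _) _.
    rewrite [leRHS]mulrC mulr_natl -sumr_const; apply: ler_sum => y yY.
    rewrite -sumrB; apply: le_trans (ler_nrm_sum _ _ _ _) _.
    rewrite [leRHS]mulrC mulr_natl -sumr_const; apply: ler_sum => h hX.
    exact: term.
  set S0 := \sum_(y in Y) _ in Hx1 *; set S1 := \sum_(y in Y) _ => dS.
  have := ler_nrmD (S0 - S1) S1; rewrite subrK.
  have E : c0 / 2 * #|X|%:R * #|Y|%:R = c0 * #|X|%:R * #|Y|%:R / 2 :> R by ring.
  by rewrite E in dS *; clear -dS Hx1; lra.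
apply: (trilinear_fourier_large m g (fun x => if x - x1 \in Y then A (x - x1) else 0) (cut m X b)).
  by rewrite mulr_ge0 // ltW.
have -> : \sum_x \sum_y g (x + y) * (if x - x1 \in Y then A (x - x1) else 0) * cut m X b y =
    \sum_(y in Y) \sum_(h in X) g (x1 + y + h) * A y * b h.
  rewrite (reindex_inj (addrI x1)) [RHS]big_mkcond; apply: eq_bigr => y _ /=.
  rewrite addrAC subrr add0r; case: ifP => yY; last first.
    by apply: big1 => h _; rewrite mulr0 mul0r.
  by rewrite [RHS]big_mkcond; apply: eq_bigr => h _; rewrite /cut; case: ifP; rewrite ?mulr0.
set S := nrm _ in large *.
have aY : \sum_x nrm (if x - x1 \in Y then A (x - x1) else 0) ^+ 2 <= #|Y|%:R.
  rewrite (reindex_inj (addrI x1)) /= -sumr_const [leRHS]big_mkcond; apply: ler_sum => y _.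
  rewrite addrAC subrr add0r; case: ifP => _; last by rewrite nrm0 expr0n.
  by rewrite /A !nrmM !nrmJ nrm_psi nrm_e !mulr1 exprn_ile1 ?nrm_ge0.
have bX : \sum_h nrm (cut m X b h) ^+ 2 <= #|X|%:R.
  rewrite -sumr_const [leRHS]big_mkcond; apply: ler_sum => h _.
  rewrite /cut; case: ifP => _; last by rewrite nrm0 expr0n.
  by rewrite /b !nrmM !nrmJ nrm_psi !nrm_e !mulr1 exprn_ile1 ?nrm_ge0.
apply: le_lt_trans (_ : (B * M) ^+ 2 * #|Y|%:R * #|X|%:R < _).
  by rewrite !ler_pM ?mulr_ge0 ?exprn_ge0 ?sumr_ge0 ?(ltW Mp) // => *; rewrite exprn_ge0 ?nrm_ge0.
apply: lt_le_trans (_ : (c0 / 2 * #|X|%:R * #|Y|%:R) ^+ 2 <= _); last first.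
  by rewrite ler_pXn2r ?nnegrE ?nrm_ge0 // !mulr_ge0 ?ler0n ?invr_ge0 // ltW.
set Q1 := (((q * 2).+1 * J.+1) ^ d.+1)%N in cX HB; set Q2 := (J' ^ d.+1)%N in cY HB.
have H1 : cH * M <= Q1%:R * #|X|%:R by apply: le_trans cHM _; rewrite -natrM ler_nat.
have Xp : 0 < (#|X|%:R : R).
  rewrite ltr0n lt0n; apply/eqP => X0; move: cX; rewrite X0 muln0 leqn0 cards_eq0 => /eqP H'.
  by rewrite H' inE in x0H.
have Yp : 0 < (#|Y|%:R : R).
  by rewrite lt_neqAle ler0n andbT; apply/eqP => Y0; move: cY; rewrite -Y0 mulr0 leNgt Mp.
have Q1p : 0 < (Q1%:R : R) by rewrite ltr0n expn_gt0.
have Q2p : 0 < (Q2%:R : R) by rewrite ltr0n expn_gt0 J'0.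
clear -H1 Xp Yp Q1p Q2p HB cY c00 Mp B0.
rewrite natrM in HB.
move: (#|X|%:R : R) (#|Y|%:R : R) (Q1%:R : R) (Q2%:R : R) (m.+2%:R : R) H1 Xp Yp Q1p Q2p HB cY Mp.
move=> x y u v t H1 Xp Yp Q1p Q2p HB cY Mp.
have P : 4 * B ^+ 2 * t ^+ 2 * (u * v) < c0 ^+ 2 * (x * y) * (u * v).
  apply: lt_le_trans (_ : c0 ^+ 2 * cH * t ^+ 2 <= _).
    have := HB; rewrite -(ltr_pM2r (exprn_gt0 2 Mp)); lra.
  have h1 := ler_wpM2r (ltW Mp) H1.
  have h2 : u * x * t <= u * x * (v * y) by rewrite ler_wpM2l // mulr_ge0 ?ltW.
  have h3 : cH * t * t <= u * x * (v * y) by lra.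
  have := ler_wpM2l (exprn_ge0 2 (ltW c00)) h3; lra.
rewrite ltr_pM2r ?mulr_gt0 // in P.
have := P; rewrite -(ltr_pM2r (mulr_gt0 Xp Yp)); lra.
Qed.
End SmallBoxes.

Lemma exists_nat_ge (x : R) : exists2 J : nat, (0 < J)%N & x <= J%:R.
Proof.
exists (Num.bound `|x|).+1 => //; apply: le_trans (ler_norm x) _.
by apply: ltW; apply: lt_trans (archi_boundP (normr_ge0 x)) _; rewrite ltr_nat.
Qed.

Lemma exists_inv_le (t : R) : 0 < t -> exists2 J : nat, (0 < J)%N & J%:R^-1 <= t.
Proof.
move=> t0; have [J J0 HJ] := exists_nat_ge t^-1; exists J => //.
by rewrite -[t]invrK lef_pV2 ?posrE ?invr_gt0 ?ltr0n.
Qed.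

Lemma exists_small_square (Z Q : R) : 0 < Z -> 0 < Q -> exists2 B : R, 0 < B & 4 * B ^+ 2 * Q < Z.
Proof.
(* Then B < 1 and 4 Q B = Z (1 - B), hence 4 Q B^2 < Z. *)
move=> Z0 Q0; pose B := Z / (4 * Q + Z).
have W0 : 0 < 4 * Q + Z by lra.
exists B; first exact: divr_gt0.
have B1 : B < 1 by rewrite ltr_pdivrMr //; lra.
have B0 : 0 < B by apply: divr_gt0.
have E : 4 * Q * B = Z - Z * B by rewrite /B; field; rewrite gt_eqF.
have QB : 0 < 4 * Q * B by apply: mulr_gt0 => //; apply: mulr_gt0.
have : 4 * Q * B * B <= 4 * Q * B by apply: ler_piMr; apply: ltW.
have : 0 < Z * B by apply: mulr_gt0.
have := E; lra.
Qed.

Theorem bracket_correlation_on_group (c : R) : 0 < c -> exists (d : nat) (B : R), 0 < B /\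
  forall (m N : nat) (F : 'I_m.+2 -> C),
  (8 * N = m.+2)%N -> (forall x, nrm (F x) <= 1) ->
  (forall x : 'I_m.+2, F x != 0 -> (1 <= (x : nat) <= N)%N) ->
  c * m.+2%:R ^+ 4 <= nrm (\sum_x \sum_h1 \sum_h2 \sum_h3
     deriv m h1 (deriv m h2 (deriv m h3 F)) x) ->
  exists (alpha beta : R) (sigma tau : 'I_(d.+1 + d.+1) -> R) (r : 'I_m.+2),
    B * m.+2%:R <
    nrm (fourier m (fun x => F x * (e (bracket _ alpha beta sigma tau (x : nat)%:Z))^*) r).
Proof.
move=> c_gt0; pose c0 := c / 2; have c0p : 0 < c0 by rewrite /c0; lra.
have [c1 [dR [c1p Hlin]]] := locally_linear_on_bohr ((c0 ^+ 2) ^+ 4) ltac:(by rewrite !exprn_gt0).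
have [d _ Hd] := exists_nat_ge dR.
have dp : 0 < 32 * d.+1%:R :> R by rewrite mulr_gt0 ?ltr0n.
(* 1/8 is the tolerance of [rounding_as_floors]; the other bound keeps the bracket error 8 (d + 1)
   rho below c0 / 4. *)
pose rho : R := Num.min 8^-1 (c0 / (32 * d.+1%:R)).
have rp : 0 < rho by rewrite lt_min invr_gt0 ltr0n /= divr_gt0.
have r8 : rho <= 8^-1 by rewrite ge_min lexx.
have rc : 32 * (d.+1%:R * rho) <= c0.
  by rewrite mulrA mulrC -ler_pdivlMr // ge_min lexx orbT.
have le41 : 4^-1 <= 1 :> R by lra.
have le40 : 0 <= 4^-1 :> R by lra.
have r4 : rho <= 4^-1 by lra.
have [rho' r'p Hbc] := bohr_coordinates_exist d rho rp ltac:(lra).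
have [J4 J4p HJ4] : exists2 J : nat, (0 < J)%N & J%:R^-1 <= 4^-1 * rho'.
  by apply: exists_inv_le; lra.
pose c2 : R := (J4 ^ d.+1)%:R^-1.
have c2p : 0 < c2 by rewrite invr_gt0 ltr0n expn_gt0 J4p.
pose cH := c1 * c2; have cHp : 0 < cH by apply: mulr_gt0.
(* The fourth power comes from [quadruples_on_subset], the halved square from
   [many_near_symmetric]. *)
pose eta := ((c0 * cH) ^+ 4) ^+ 2 / 2.
have ep : 0 < eta by rewrite divr_gt0 // !exprn_gt0 // mulr_gt0.
have [T0 T0p HT0] := exists_nat_ge eta^-1.
pose T := T0.+1; have HT : eta^-1 < T%:R by apply: le_lt_trans HT0 _; rewrite ltr_nat.
pose K : R := T`!%:R * (48 * T%:R ^+ 2 / eta).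
have K0 : 0 <= K by rewrite !mulr_ge0 ?invr_ge0 ?exprn_ge0 ?ler0n ?(ltW ep).
(* A sum of nonnegative lower bounds for [J]: one makes 1 < J, two meet the side lengths asked by
   [common_denominator], and the last makes the polarization error small. *)
pose tJ : R := 2 + T%:R + 96 * T%:R / eta + 32 * (d.+1%:R ^+ 2 * K) / c0.
have [J Jp HJ] := exists_nat_ge tJ.
have p1 : 0 <= 96 * T%:R / eta by rewrite !mulr_ge0 ?invr_ge0 ?ler0n ?(ltW ep).
have p2 : 0 <= 32 * (d.+1%:R ^+ 2 * K) / c0.
  by apply: divr_ge0 (ltW c0p); apply: mulr_ge0 => //; apply: mulr_ge0 => //; apply: exprn_ge0.
have p3 : 0 <= T%:R :> R by rewrite ler0n.
have J1 : (1 < J)%N by rewrite -(ltr_nat R); clear -HJ p1 p2 p3; move: HJ; rewrite /tJ; lra.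
have JT : T%:R <= J%:R :> R by clear -HJ p1 p2 p3; move: HJ; rewrite /tJ; lra.
have J96 : 96 * T%:R / eta <= J%:R by clear -HJ p1 p2 p3; move: HJ; rewrite /tJ; lra.
have JK : 32 * (d.+1%:R ^+ 2 * (K / J%:R ^+ 2)) <= c0.
  have h1 : 32 * (d.+1%:R ^+ 2 * K) <= J%:R * c0.
    by rewrite -ler_pdivrMr //; clear -HJ p1 p2 p3; move: HJ; rewrite /tJ; lra.
  have J1R : 1 <= (J%:R : R) by rewrite ler1n.
  have h2 : J%:R * c0 <= J%:R ^+ 2 * c0 by rewrite ler_pM2r // expr2 ler_peMl ?ler0n.
  have -> : 32 * (d.+1%:R ^+ 2 * (K / J%:R ^+ 2)) = 32 * (d.+1%:R ^+ 2 * K) / J%:R ^+ 2 by ring.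
  by rewrite ler_pdivrMr ?exprn_gt0 ?ltr0n // [c0 * _]mulrC; apply: le_trans h1 h2.
have [J' J'p HJ'] : exists2 J' : nat, (0 < J')%N & J'%:R^-1 <= J%:R^-1 * rho'.
  by apply: exists_inv_le; rewrite mulr_gt0 ?invr_gt0 ?ltr0n.
have [B Bp HB] := exists_small_square (c0 ^+ 2 * cH)
  (((T`! * 2).+1 * J.+1) ^ d.+1 * J' ^ d.+1)%:R ltac:(by rewrite mulr_gt0 ?exprn_gt0)
  ltac:(by rewrite ltr0n muln_gt0 !expn_gt0 J'p).
exists d, B; split=> // m N F NM F1 Fs HF.
have Mp := modulus_gt0 m.
have [H [xi [Hcard Hxi]]] := u3_large_derivatives m F c (ltW c_gt0) F1 HF.
have [ph ph1 Hph] := derivative_phases m F H xi c0 Hxi.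
have energy : (c0 ^+ 2) ^+ 4 * m.+2%:R ^+ 3 <= \sum_h1 \sum_h2 \sum_h3
    ind [&& h1 \in H, h2 \in H, h3 \in H, h2 + h3 - h1 \in H &
     xi h1 + xi (h2 + h3 - h1) == xi h2 + xi h3].
  apply: le_trans (energy_of_quadruples m ph H xi ph1).
  apply: (quadruples_on_subset m F) => //; first by rewrite exprn_ge0 ?ltW.
  apply: le_trans (Hph H (subxx _)).
  have -> : c0 ^+ 2 * m.+2%:R ^+ 2 = c0 * m.+2%:R * (c0 * m.+2%:R) by ring.
  by rewrite ler_wpM2l // mulr_ge0 ?ler0n // ltW.
have [spec [phi [Hspec phiD Hphi]]] := Hlin m H xi energy.
(* The frequency 1 is put first, and the list is padded with the frequency 0 up to length [d]. *)
pose s (i : 'I_d.+1) : 'I_m.+2 := if (i == 0 :> nat)%N then 1 else nth 0 (enum spec) i.-1.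
have s0 : s ord0 = 1 by [].
have [bc] := Hbc m s s0.
have sub1 : box m d s rho rho' bc 1 \subset bohr m spec 4^-1.
  apply/subsetP => x /boxP xb; apply/bohrP => t tS.
  have tI : (index t (enum spec) < d)%N.
    apply: leq_trans (_ : (size (enum spec) <= d)%N); first by rewrite index_mem mem_enum.
    by rewrite -cardE -(ler_nat R); apply: le_trans Hspec Hd.
  have -> : t = s (inord (index t (enum spec)).+1).
    by rewrite /s inordK ?ltnS //= nth_index // mem_enum.
  rewrite -bvec_circ; apply: le_trans (_ : rho <= _); last exact: r4.
  by apply: (bc_small m d s _ _ bc) => i; have := xb i; rewrite mul1r.
have phi_add x y : x \in box m d s rho rho' bc 1 -> y \in box m d s rho rho' bc 1 ->
    x + y \in box m d s rho rho' bc 1 -> phi (x + y) = phi x + phi y.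
  by move=> hx hy hxy; apply: phiD; apply: (subsetP sub1).
have [h0 [xi0]] := Hphi (box m d s rho rho' bc 4^-1) (subset_trans (introT subsetP
   (fun x => box_mono m d s rho rho' bc _ _ x le41)) sub1).
set H1 := [set h in H | _] => HH1.
have H1c : cH * m.+2%:R <= #|H1|%:R.
  apply: le_trans HH1; rewrite -mulrA ler_pM2l // ler_pdivrMl ?ltr0n ?expn_gt0 ?J4p //.
  exact: box_card.
have sH1 : H1 \subset H by apply/subsetP => x; rewrite inE => /andP[].
have H1P h : h \in H1 -> h - h0 \in box m d s rho rho' bc 4^-1 /\ xi h = xi0 + phi (h - h0).
  by rewrite inE => /and3P[_ -> /eqP].
have [x0 x0H] : exists x0, x0 \in H1.
  apply/set0Pn; rewrite -card_gt0 -(ltr0n R); apply: lt_le_trans H1c.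
  exact: mulr_gt0.
have quad : c0 * cH * m.+2%:R ^+ 2 <=
    nrm (\sum_x \sum_(h in H1) F (x + h) * (F x)^* * ph h * psi m (- (xi h * x))).
  apply: le_trans (Hph H1 sH1).
  have -> : c0 * cH * m.+2%:R ^+ 2 = c0 * m.+2%:R * (cH * m.+2%:R) by ring.
  by rewrite ler_wpM2l // mulr_ge0 ?ler0n // ltW.
have c0cH : 0 <= c0 * cH by rewrite mulr_ge0 ?ltW.
have quad4 := quadruples_on_subset m F ph H1 xi (c0 * cH) F1 c0cH quad.
have [C1 [C2 [C11 C21 HC]]] := symmetric_form_large m d s rho rho' bc s0 phi phi_add
  (cut m H1 ph) xi h0 xi0 _ ltac:(by move=> x; rewrite /cut; case: ifP; rewrite ?nrm0)
  ltac:(by move=> x; rewrite /cut; case: ifP => [/H1P //|]; rewrite eqxx) quad4.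
have [w [W [wb Wb Wc HW]]] := many_near_symmetric m d s rho rho' bc s0 phi C1 C2
  ((c0 * cH) ^+ 4) (exprn_gt0 4 (mulr_gt0 c0p cHp)) C11 C21 HC.
have e1 : eta <= 1.
  rewrite -(ler_pM2r Mp) mul1r; apply: le_trans Wc _.
  by rewrite ler_nat -[X in (_ <= X)%N](card_ord m.+2) max_card.
apply: (bracket_correlation m d s rho rho' bc s0 phi phi_add N F ph xi H1 h0 xi0 x0 c0 cH K B T`! J J') => //.
- by move=> H' sH'; apply: Hph; apply: subset_trans sH' sH1.
- exact: fact_gt0.
- move=> i j Li Lj; apply: (common_denominator m d s rho rho' bc s0 phi phi_add w W eta i j T) => //.
    exact: le_trans JT Li.
  exact: le_trans J96 Lj.
- exact: ltW.
Qed.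

(** * Back to the interval *)

Lemma Delta_deriv (m : nat) (F : nat -> C) (FG : 'I_m.+2 -> C) (h : nat) :
  (forall n : nat, F n = FG n%:R) -> forall n : nat, Delta h F n = deriv m h%:R FG n%:R.
Proof. by move=> E n; rewrite /Delta /deriv !E natrD. Qed.

Lemma ord_natr (m : nat) (x : 'I_m.+2) : ((x : nat)%:R : 'I_m.+2) = x.
Proof. exact: intr_ord. Qed.

Lemma natr_ord (m n : nat) : ((n%:R : 'I_m.+2) : nat) = (n %% m.+2)%N.
Proof. by rewrite Zp_nat. Qed.

Lemma zext_mod (M N : nat) (f : nat -> C) n : zext M N f (n %% M) = zext M N f n.
Proof. by rewrite /zext modn_mod. Qed.

Lemma gowers8_group (m N : nat) (f : nat -> C) :
  gowers8 m.+2 (zext m.+2 N f) = m.+2%:R ^- 4 * \sum_x \sum_h1 \sum_h2 \sum_h3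
    deriv m h1 (deriv m h2 (deriv m h3 (fun y : 'I_m.+2 => zext m.+2 N f y))) x.
Proof.
rewrite /gowers8; congr (_ * _).
apply: eq_bigr => x _; apply: eq_bigr => h1 _; apply: eq_bigr => h2 _; apply: eq_bigr => h3 _.
rewrite -{2}(ord_natr m x) -{2}(ord_natr m h1) -{2}(ord_natr m h2) -{2}(ord_natr m h3).
do 3! apply: Delta_deriv.
by move=> n; rewrite natr_ord zext_mod.
Qed.

Lemma Delta_nat (h : nat) (u : nat -> nat) (F : nat -> C) :
  (forall n, F n = (u n)%:R) -> forall n, Delta h F n = (u (n + h) * u n)%:R.
Proof. by move=> E n; rewrite /Delta !E rmorph_nat natrM. Qed.

Lemma sum_le_indicator (M K : nat) : (K < M)%N -> (\sum_(h < M) (h <= K) = K.+1)%N.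
Proof.
move=> KM; transitivity (\sum_(h < K.+1) 1)%N; last by rewrite sum1_card card_ord.
by rewrite (big_ord_widen M (fun=> 1%N) KM) [RHS]big_mkcond; apply: eq_bigr => i _; rewrite ltnS; case: leqP.
Qed.

Lemma gowers8_interval_ge (m N : nat) : (8 * N = m.+2)%N ->
  32 ^- 4 <= complex.Re (gowers8 m.+2 (zext m.+2 N (fun _ => 1))).
Proof.
(* Every [x] in [1, K+1] with all shifts at most [K] contributes 1, since x + h1 + h2 + h3 <= 4K + 1
   <= N; and K + 1 >= N/4 = M/32. *)
move=> NM; pose K := (N.-1 %/ 4)%N.
pose u n : nat := (1 <= n %% m.+2 <= N)%N.
have uE n : zext m.+2 N (fun _ => 1) n = (u n)%:R :> C.
  by rewrite /zext /u; case: ifP.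
pose D h (v : nat -> nat) n := (v (n + h) * v n)%N.
pose S := (\sum_(x < m.+2) \sum_(h1 < m.+2) \sum_(h2 < m.+2) \sum_(h3 < m.+2) D h1 (D h2 (D h3 u)) x)%N.
have -> : gowers8 m.+2 (zext m.+2 N (fun _ => 1)) = ((m.+2%:R ^- 4 * S%:R : R)%:C)%C.
  rewrite /gowers8 rmorphM fmorphV rmorphXn !rmorph_nat; congr (_ * _).
  rewrite /S natr_sum; apply: eq_bigr => x _; rewrite natr_sum; apply: eq_bigr => h1 _.
  rewrite natr_sum; apply: eq_bigr => h2 _; rewrite natr_sum; apply: eq_bigr => h3 _.
  exact: (Delta_nat h1 _ _ (Delta_nat h2 _ _ (Delta_nat h3 u _ uE))).
have KS : (K.+1 ^ 4 <= S)%N.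
  pose i (x : nat) : nat := (1 <= x <= K.+1)%N; pose j (h : nat) : nat := (h <= K)%N.
  have -> : (K.+1 ^ 4 = \sum_(x < m.+2) \sum_(h1 < m.+2) \sum_(h2 < m.+2) \sum_(h3 < m.+2)
      i x * (j h1 * (j h2 * j h3)))%N.
    have jE : (\sum_(h < m.+2) j h = K.+1)%N by apply: sum_le_indicator; rewrite /K; lia.
    have iE : (\sum_(x < m.+2) i x = K.+1)%N.
      by rewrite big_ord_recl add0n; apply: sum_le_indicator; rewrite /K; lia.
    under eq_bigr => x _.
      under eq_bigr => h1 _.
        under eq_bigr => h2 _ do rewrite -!big_distrr /= jE.
        rewrite -!big_distrr /= -big_distrl /= jE.
        over.
      rewrite -big_distrr /= -big_distrl /= jE.
      over.
    by rewrite -big_distrl /= iE !expnS expn0 muln1.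
  have uI y : (1 <= y <= N)%N -> u y = 1%N.
    by move=> H; rewrite /u modn_small ?H //; lia.
  apply: leq_sum => x _; apply: leq_sum => h1 _; apply: leq_sum => h2 _; apply: leq_sum => h3 _.
  rewrite /i /j; case: (boolP (1 <= x <= K.+1)%N) => [Hx|_]; last by rewrite mul0n.
  case: (leqP h1 K) => [H1|_]; last by rewrite !muln0.
  case: (leqP h2 K) => [H2|_]; last by rewrite !muln0.
  case: (leqP h3 K) => [H3|_]; last by rewrite !muln0.
  have K4 : (K * 4 <= N.-1)%N by apply: leq_trunc_div.
  by rewrite /D !uI //; clear -NM Hx H1 H2 H3 K4; lia.
have K4 : (m.+2 <= 32 * K.+1)%N.
  have := ltn_ceil N.-1 (isT : (0 < 4)%N); rewrite -/K; lia.
have Mp : 0 < m.+2%:R ^+ 4 :> R by rewrite exprn_gt0 ?ltr0n.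
rewrite ler_pdivlMl // ler_pdivrMr ?exprn_gt0 ?ltr0n // -!natrX -natrM ler_nat.
by apply: leq_trans (_ : (32 * K.+1) ^ 4 <= _)%N; rewrite ?leq_exp2r // expnMn mulnC leq_mul2r KS orbT.
Qed.

Lemma eighth_root (g : R) : 0 <= g -> Num.sqrt (Num.sqrt (Num.sqrt g)) ^+ 8 = g.
Proof.
by move=> g0; rewrite (exprM _ 2 4) sqr_sqrtr ?sqrtr_ge0 // (exprM _ 2 2) sqr_sqrtr ?sqrtr_ge0 // sqr_sqrtr.
Qed.

Lemma large_U3_large_sum (delta : R) (N : nat) (f : nat -> C) : 0 < delta ->
  delta <= U3normN N f -> exists2 m : nat, (8 * N = m.+2)%N &
   delta ^+ 8 / 32 ^+ 4 * m.+2%:R ^+ 4 <= nrm (\sum_x \sum_h1 \sum_h2 \sum_h3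
    deriv m h1 (deriv m h2 (deriv m h3 (fun y : 'I_m.+2 => zext m.+2 N f y))) x).
Proof.
move=> d0; rewrite /U3normN; case: N => [|N].
  (* For [N = 0] all sums are empty and the quotient is 0, contradicting 0 < delta. *)
  rewrite muln0 /U3norm_cyclic /gowers8 !big_ord0 mulr0 /= !sqrtr0 mul0r; lra.
have [m NM] : exists m, (8 * N.+1 = m.+2)%N by exists (8 * N + 6)%N; lia.
exists m => //; rewrite NM in H *.
have Mp := modulus_gt0 m.
have gI := gowers8_interval_ge m N.+1 NM.
move: H; rewrite /U3norm_cyclic.
set g1 := complex.Re (gowers8 _ (zext _ _ (fun=> 1))) in gI *.
set g := complex.Re _.
have k0 : 0 < 32 ^- 4 :> R by rewrite invr_gt0 exprn_gt0.
have g1p : 0 < g1 by apply: lt_le_trans gI.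
rewrite ler_pdivlMr ?sqrtr_gt0 // => H.
have g0 : 0 <= g.
  (* Nonnegativity of [g] need not be proved in general: a negative value would have root 0, against
     the lower bound. *)
  case: (ltP g 0) => // gn; move: H; rewrite (ler0_sqrtr (ltW gn)) !sqrtr0 leNgt.
  by rewrite mulr_gt0 ?sqrtr_gt0.
have {}H : delta ^+ 8 * g1 <= g.
  rewrite -(eighth_root g1 (ltW g1p)) -(eighth_root g g0) -exprMn.
  by rewrite lerXn2r ?nnegrE ?mulr_ge0 ?sqrtr_ge0 // ltW.
have : g <= m.+2%:R ^- 4 * nrm (\sum_x \sum_h1 \sum_h2 \sum_h3
    deriv m h1 (deriv m h2 (deriv m h3 (fun y : 'I_m.+2 => zext m.+2 N.+1 f y))) x).
  apply: le_trans (Re_le_nrm _) _; rewrite gowers8_group nrmM nrmV nrmX nrm_nat.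
  exact: lexx.
rewrite mulrC ler_pdivlMr ?exprn_gt0 // => H2.
apply: le_trans H2; rewrite ler_pM2r ?exprn_gt0 //; apply: le_trans H.
by rewrite ler_pM2l ?exprn_gt0.
Qed.

Theorem theorem5p4 :
  forall delta : R, 0 < delta <= 1 ->
  exists Cd cd : R, 0 < cd /\
    forall (N : nat) (f : nat -> C),
      (forall n : nat, (1 <= n <= N)%N -> `|f n| <= 1) ->
      delta <= U3normN N f ->
      exists (alpha beta : R) (k : nat) (m : nat -> nat -> int)
             (xi : nat -> R) (q : nat -> nat -> {poly R}),
        [/\ k%:R <= Cd,
            (forall i i' : nat, (i < i' < k)%N -> `|m i' i|%:~R <= Cd),
            (forall i i' : nat, (i < i' < k)%N -> (size (q i' i) <= 3)%N) &
            (cd%:C)%C <= `|avgN N (fun n => f n * (chi alpha beta k m xi q n%:Z)^*)|].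
Proof.
move=> delta /andP[d0 _].
have [d [B [B0 HB]]] :=
  bracket_correlation_on_group (delta ^+ 8 / 32 ^+ 4) ltac:(by rewrite divr_gt0 ?exprn_gt0).
pose D := (d.+1 + d.+1)%N.
(* There are [D + D] generators, and the factor 8 comes from averaging over [N] instead of
   [M = 8 * N]. *)
exists (D + D)%:R, (8 * B); split; first by lra.
move=> N f f1 /(large_U3_large_sum _ _ _ d0) [m NM HU].
have Mp := modulus_gt0 m.
pose F (x : 'I_m.+2) := zext m.+2 N f x.
have FE (x : 'I_m.+2) : F x = if (1 <= (x : nat) <= N)%N then f x else 0.
  by rewrite /F /zext modn_small ?ltn_ord.
have F1 x : nrm (F x) <= 1.
  rewrite FE; case: ifP => [/f1|_]; last by rewrite nrm0.
  by rewrite normC_nrm -[1]/((1%:C)%C) lecR.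
have Fs (x : 'I_m.+2) : F x != 0 -> (1 <= (x : nat) <= N)%N.
  by rewrite FE; case: ifP => //; rewrite eqxx.
have [alpha [beta [sigma [tau [r Hr]]]]] := HB m N F NM F1 Fs HU.
(* The Fourier frequency [r] is absorbed into the linear coefficient. *)
have [mm [xi [mm1 Hchi]]] := chi_bracket D alpha (beta + (r : nat)%:R / m.+2%:R) sigma tau.
exists alpha, (beta + (r : nat)%:R / m.+2%:R), (D + D)%N, mm, xi, (fun _ _ => 0); split=> //.
- move=> i i' _; apply: le_trans (_ : 1 <= _); first by rewrite lerz1.
  by rewrite ler1n addn_gt0.
- by move=> *; rewrite size_poly0.
have E : fourier m (fun x => F x * (e (bracket D alpha beta sigma tau (x : nat)%:Z))^*) r =
   \sum_(1 <= n < N.+1) f n * (chi alpha (beta + (r : nat)%:R / m.+2%:R) (D + D) mm xi (fun _ _ => 0) n%:Z)^*.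
  pose T n := if (1 <= n <= N)%N then
    f n * (chi alpha (beta + (r : nat)%:R / m.+2%:R) (D + D) mm xi (fun _ _ => 0) n%:Z)^* else 0.
  transitivity (\sum_(x < m.+2) T x).
    apply: eq_bigr => x _; rewrite FE /T; case: ifP => _; last by rewrite !mul0r.
    rewrite Hchi -mulrA psiN -rmorphM; congr (_ * _^*).
    have -> : r * x = ((r : nat)%:Z * (x : nat)%:Z)%:~R by rewrite intrM !intr_ord.
    rewrite psi_int -eD; congr e; rewrite /bracket intrM -!pmulrn; ring.
  rewrite -(big_mkord xpredT T) (@big_cat_nat _ _ _ 1%N) //= big_nat1 {1}/T add0r.
  rewrite (@big_cat_nat _ _ _ N.+1) //=; last by lia.
  rewrite [X in _ + X]big_nat_cond [X in _ + X]big1 ?addr0; last first.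
    by move=> n /andP[/andP[Nn _] _]; rewrite /T andbC leqNgt Nn.
  by rewrite !big_nat; apply: eq_bigr => n; rewrite ltnS /T => ->.
rewrite normC_nrm lecR /avgN -E nrmM nrmV nrm_nat.
have N0 : 0 < (N%:R : R) by rewrite ltr0n; lia.
rewrite ler_pdivlMl //; apply: ltW; apply: le_lt_trans Hr.
by rewrite -NM natrM; apply: le_of_eq; ring.
Qed.
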